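(* Let $n\ge 1$, let $P\in\mathscr{P}_n$ with $P(z)\neq 0$ for $|z|<1$, let $m=\min_{|z|=1}|P(z)|$, and let $B\in\mathcal{B}_n$ with coefficients $\lambda_0,\lambda_1,\lambda_2$. Then for all $\alpha,\beta,\delta\in\mathbb{C}$ with $|\alpha|\le 1$, $|\beta|\le 1$, $|\delta|\le 1$, all real $R>r\ge 1$ and all $0\le p<\infty$, writing $\phi_n=\phi_n(R,r,\alpha,\beta)$, $\sigma(z)=Rz$ and $\rho(z)=rz$, $$\left\|B[P\circ\sigma](z)+\phi_n\,B[P\circ\rho](z)+\delta\,\frac{\big(|R^n+\phi_nr^n||\Lambda_n|-|1+\phi_n||\lambda_0|\big)m}{2}\right\|_p\le \frac{\left\|(R^n+\phi_n r^n)\Lambda_n z+(1+\phi_n)\lambda_0\right\|_p}{\|1+z\|_p}\,\|P(z)\|_p .$$ The result is best possible, and equality holds for $P(z)=az^n+b$ with $|a|=|b|\neq 0$.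
   Context: $\mathscr{P}_n$ denotes the class of complex polynomials $P(z)=\sum_{j=0}^n a_jz^j$ of degree $n$. For a polynomial $P$, $\|P(z)\|_0:=\exp\left\{\frac1{2\pi}\int_0^{2\pi}\log|P(e^{i\theta})|\,d\theta\right\}$ and $\|P(z)\|_p:=\left\{\frac1{2\pi}\int_0^{2\pi}|P(e^{i\theta})|^p\,d\theta\right\}^{1/p}$ for $0<p<\infty$. $(P\circ\psi)(z):=P(\psi(z))$. $\mathcal{B}_n$ is the class of operators $B$ of the form $$B[P](z):=\lambda_0P(z)+\lambda_1\left(\frac{nz}{2}\right)\frac{P'(z)}{1!}+\lambda_2\left(\frac{nz}{2}\right)^2\frac{P''(z)}{2!},$$ where $\lambda_0,\lambda_1,\lambda_2\in\mathbb{C}$ are such that all the zeros of $u(z):=\lambda_0+\binom n1\lambda_1z+\binom n2\lambda_2z^2$ lie in the half plane $|z|\le|z-n/2|$. $\Lambda_n:=\lambda_0+\lambda_1\frac{n^2}{2}+\lambda_2\frac{n^3(n-1)}{8}$. $\phi_n(R,r,\alpha,\beta):=\beta\left\{\left(\frac{R+1}{r+1}\right)^n-|\alpha|\right\}-\alpha$. *)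

(* Defs.v *)
From HB Require Import structures.
From mathcomp Require Import all_boot all_order all_algebra.
From mathcomp Require Import complex.
From mathcomp Require Import all_classical all_reals all_analysis.

Set Implicit Arguments.
Unset Strict Implicit.
Unset Printing Implicit Defensive.

Import Order.TTheory GRing.Theory Num.Theory.
Import numFieldNormedType.Exports.

Local Open Scope ring_scope.
Local Open Scope complex_scope.

(* The norm `|z| of R[i] takes values in R[i]; normc is its real-valued
   version. *)
Notation normc := ComplexField.Normc.normc.

Definition expi (K : realType) (t : K) : K[i] := cos t +i* sin t.

(* ||P||_p for 0 <= p < oo.  For p = 0 the logarithm is the extended real one,
   with value -oo at 0, so that the zero polynomial has norm exp(-oo) = 0. *)
Definition pnorm (K : realType) (p : K) (P : {poly K[i]}) : K :=
  if p == 0 then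
    fine (expeR (((2 * pi)^-1)%:E *
      \int[@lebesgue_measure K]_(t in `[0%R, (2 * pi)%R]%classic)
        lne (normc P.[expi t])%:E))%E
  else
    ((2 * pi)^-1 *
      \int[@lebesgue_measure K]_(t in `[0, 2 * pi]%classic)
        (normc P.[expi t] `^ p)) `^ p^-1.

Definition poly_dilate (K : realType) (s : K) (P : {poly K[i]}) : {poly K[i]} :=
  P \Po (s%:C *: 'X).

Definition opB (K : realType) (n : nat) (l0 l1 l2 : K[i]) (P : {poly K[i]}) :
    {poly K[i]} :=
  l0 *: P
  + l1 *: (((n%:R / 2) *: 'X) * ((1`!%:R)^-1 *: P^`()))
  + l2 *: (((n%:R / 2) *: 'X) ^+ 2 * ((2`!%:R)^-1 *: P^`(2))).

(* When u = 0 every complex number is a zero of u, so that the condition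
   fails for n >= 1. *)
Definition classB (K : realType) (n : nat) (l0 l1 l2 : K[i]) : Prop :=
  let u := l0%:P + ('C(n, 1)%:R * l1) *: 'X + ('C(n, 2)%:R * l2) *: 'X^2 in
  forall z : K[i], root u z -> `|z| <= `|z - n%:R / 2|.

Definition Lambda (K : realType) (n : nat) (l0 l1 l2 : K[i]) : K[i] :=
  l0 + l1 * ((n ^ 2)%:R / 2) + l2 * ((n ^ 3 * (n - 1))%:R / 8).

Definition phi (K : realType) (n : nat) (R r : K) (alpha beta : K[i]) : K[i] :=
  beta * ((((R + 1) / (r + 1)) ^+ n)%:C - `|alpha|) - alpha.

Definition is_min_on_circle (K : realType) (P : {poly K[i]}) (m : K) : Prop :=
  (exists2 z : K[i], `|z| = 1 & normc P.[z] = m) /\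
  (forall z : K[i], `|z| = 1 -> m <= normc P.[z]).

Definition zero_free (K : realType) (n : nat) (P : {poly K[i]}) : Prop :=
  size P = n.+1 /\ forall z : K[i], `|z| < 1 -> P.[z] != 0.

Definition lhs_poly (K : realType) (n : nat) (l0 l1 l2 : K[i]) (R r : K)
    (alpha beta delta : K[i]) (P : {poly K[i]}) (m : K) : {poly K[i]} :=
  let ph := phi n R r alpha beta in
  opB n l0 l1 l2 (poly_dilate R P)
  + ph *: opB n l0 l1 l2 (poly_dilate r P)
  + (delta * (((`|R%:C ^+ n + ph * r%:C ^+ n| * `|Lambda n l0 l1 l2|
                - `|1 + ph| * `|l0|) * m%:C) / 2))%:P.

Definition rhs_const (K : realType) (n : nat) (l0 l1 l2 : K[i]) (R r : K)
    (alpha beta : K[i]) (p : K) : K :=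
  let ph := phi n R r alpha beta in
  pnorm p (((R%:C ^+ n + ph * r%:C ^+ n) * Lambda n l0 l1 l2) *: 'X
           + ((1 + ph) * l0)%:P)
  / pnorm p (1 + 'X).

(* Main.v *)
Require Import Defs.
From HB Require Import structures.
From mathcomp Require Import all_boot all_order all_algebra.
From mathcomp Require Import complex.
From mathcomp Require Import all_classical all_reals all_analysis.
From mathcomp Require Import measurable_realfun.
From mathcomp Require Import ring lra.

(** Why the inequality holds.  The operator E sending P to
B[P o sigma] + phi B[P o rho] is diagonal on monomials: it multiplies the
coefficient of z^k by a number e_k, with e_n = (R^n + phi r^n) Lambda_n and
e_0 = (1 + phi) lambda_0.  It maps polynomials of degree n with all zeros in
the closed unit disc to polynomials of the same kind.  For B this is Grace's
theorem ([grace]): it is enough to test (X - zeta)^n with |zeta| <= 1, and the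
value of B on that power is (w - zeta)^n u((n/2) w / (w - zeta)).  For the
dilations one compares |f(R w)| with |f(r w)| one zero at a time
([dilation_factor]); |phi| <= ((R + 1)/(r + 1))^n is exactly what this needs.

A zero-preserving multiplier respects domination outside the disc
([multop_comparison]).  With Q the reciprocal polynomial of P this gives, on
the circle, |E P| + m (|e_n| - |e_0|) <= |E Q| ([pointwise_bound]): one
compares P + c with its reciprocal polynomial for |c| < m, where the minimum
modulus principle ([minimum_modulus]) keeps P + c free of zeros in the disc,
and chooses the argument of c.

For p > 0, let E' be the multiplier with coefficients conj(e_(n-k)); on the
circle |E' P| = |E Q|.  The twisted operators e^(i eta) E + E' again preserve
zeros in the disc ([twist_zero_preserving]), except when
e^(i eta) e_n + conj(e_0) = 0, which concerns a null set of eta, and their extreme multipliers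
have the same modulus |e^(i eta) e_n + conj(e_0)|.  For such an operator T
with extreme modulus c, the mean of |T P|^p is at most c^p times that of
|P|^p ([power_mean_multop]).  Averaging over eta, the pointwise bound gives
|e^(i eta) E P + E' P| >= |F| |1 + e^(i eta')| for the polynomial F on the left
of the theorem, after a rotation of eta ([cosine_kernel_lower_bound]), and
the quotient of norms of linear polynomials appears
([twisted_power_bound]).

The bound for T goes through Mahler measures, as no convexity is available
for p < 1.  Reflecting the zeros of f into the disc shows that
M(T f) <= |e_n| M(f) ([mahler_measure_multop]).  Applying this to P + s for
all s on a circle |s| = rho and integrating turns it, by Jensen's formula,
into an inequality between means of log max(|T P|/c, rho) and
log max(|P|, rho) ([level_inequality]).  Since x^p is a convex increasing
function of log x, hence a positive combination of the functions
log max(x, rho), the inequality passes to p-th powers ([power_mean_le]).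

For p = 0 the Mahler measure of a polynomial with all its zeros in the disc
is the modulus of its leading coefficient, and |F| <= |E Q| on the circle is
enough.  For a z^n + b with |a| = |b| the minimum m vanishes, both norms are
norms of linear polynomials in z^n, and equality is a computation; the
polynomial z^n + 1 shows that the constant is best possible. *)

Set Implicit Arguments.
Unset Strict Implicit.
Unset Printing Implicit Defensive.

Import Order.TTheory GRing.Theory Num.Theory.
Import numFieldNormedType.Exports.

Local Open Scope ring_scope.

(** * Grace's theorem for the closed unit disc *)

Section Grace.
Variable C : numClosedFieldType.
Implicit Types (z w zeta : C) (f g : {poly C}).

Lemma normC_le1 z : (`|z| <= 1) = (0 <= 1 - z * z^*).
Proof. by rewrite subr_ge0 -normCK expr_le1. Qed.

Lemma normC_gt1 z : (1 < `|z|) = (0 < z * z^* - 1).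
Proof. by rewrite subr_gt0 -normCK expr_gt1. Qed.

Lemma normC_lt1 z : (`|z| < 1) = (0 < 1 - z * z^*).
Proof. by rewrite subr_gt0 -normCK expr_lt1. Qed.

(** For |w| > 1 the Moebius image (z1 - w)/(zeta - w) lies in an open half plane
whose normal 1 - z1 conj(zeta) does not depend on w.  The sum in the statement
is (1 - |zeta|^2)|v|^2 + (1 - |z1|^2) + (|w|^2 - 1)|z1 - zeta|^2/|zeta - w|^2,
with v the image. *)
Lemma polar_factor_gt0 z1 zeta w :
  `|z1| <= 1 -> `|zeta| <= 1 -> 1 < `|w| -> z1 != zeta ->
  0 < (1 - z1^* * zeta) * ((z1 - w) / (zeta - w)) +
      ((1 - z1^* * zeta) * ((z1 - w) / (zeta - w)))^*.
Proof.
move=> z1D zetaD wD z1zeta.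
have d0 : zeta - w != 0.
  by rewrite subr_eq0; apply: contraTneq wD => <-; rewrite real_ltNge ?negbK.
have dc0 : zeta^* - w^* != 0 by rewrite -rmorphB conjC_eq0.
have -> : (1 - z1^* * zeta) * ((z1 - w) / (zeta - w)) +
      ((1 - z1^* * zeta) * ((z1 - w) / (zeta - w)))^* =
   (1 - zeta * zeta^*) * (((z1 - w) / (zeta - w)) * ((z1 - w) / (zeta - w))^*)
   + (1 - z1 * z1^*)
   + (w * w^* - 1) * (((z1 - zeta) * (z1 - zeta)^*) /
                      ((zeta - w) * (zeta - w)^*)).
  rewrite !(rmorphM, rmorphB, rmorph1, fmorphV) /= ?conjCK.
  by field; rewrite d0 dc0.
apply: ltr_wpDl.
  apply: addr_ge0; last by rewrite -normC_le1.
  by apply: mulr_ge0; rewrite ?mul_conjC_ge0 -?normC_le1.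
apply: mulr_gt0; first by rewrite -normC_gt1.
by apply: divr_gt0; rewrite mul_conjC_gt0 // subr_eq0.
Qed.

(** The limiting case w = oo, which accounts for the degree that a polynomial
lacks. *)
Lemma polar_const_gt0 z1 zeta :
  `|z1| <= 1 -> `|zeta| <= 1 -> z1 != zeta ->
  0 < (1 - z1^* * zeta) + (1 - z1^* * zeta)^*.
Proof.
move=> z1D zetaD z1zeta.
have -> : (1 - z1^* * zeta) + (1 - z1^* * zeta)^* =
   (1 - zeta * zeta^*) + (1 - z1 * z1^*) + (z1 - zeta) * (z1 - zeta)^*.
  by rewrite !(rmorphM, rmorphB, rmorph1) /= ?conjCK; ring.
apply: ltr_wpDl; first by apply: addr_ge0; rewrite -normC_le1.
by rewrite mul_conjC_gt0 subr_eq0.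
Qed.

Lemma horner_deriv_prod (s : seq C) z : z \notin s ->
  (\prod_(w <- s) ('X - w%:P))^`().[z] =
  (\prod_(w <- s) ('X - w%:P)).[z] * \sum_(w <- s) (z - w)^-1.
Proof.
elim: s => [|w s IH] /=; first by rewrite !big_nil -polyC1 derivC horner0 mulr0.
rewrite inE negb_or => /andP[zw zs].
rewrite !big_cons derivM hornerD !hornerM derivXsubC hornerC mul1r IH //.
rewrite hornerXsubC mulrDr mulrAC divff ?subr_eq0 // mul1r.
by rewrite mulrA.
Qed.

(** Laguerre's theorem on polar derivatives, for the exterior of the disc: for
z1 <> zeta, after division by q(zeta), the polar derivative is a sum of n numbers, one for each
zero of q and one for each zero at infinity, all in one open half plane. *)
Lemma polar_neq0 n (q : {poly C}) z1 zeta : (0 < n)%N ->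
  (size q <= n.+1)%N -> (forall z, `|z| <= 1 -> q.[z] != 0) ->
  `|z1| <= 1 -> `|zeta| <= 1 ->
  n%:R * q.[zeta] + (z1 - zeta) * q^`().[zeta] != 0.
Proof.
move=> n0 sq qD z1D zetaD.
have [->|z1zeta] := eqVneq z1 zeta.
  by rewrite subrr mul0r addr0 mulf_neq0 ?qD // pnatr_eq0 -lt0n.
have [s qs] := closed_field_poly_normal q.
have q0 : q != 0 by apply: contraTneq (qD _ zetaD) => ->; rewrite horner0 eqxx.
have lq0 : lead_coef q != 0 by rewrite lead_coef_eq0.
have ss : (size s <= n)%N.
  by move: sq; rewrite qs size_scale // size_prod_XsubC ltnS.
have sD w : w \in s -> 1 < `|w|.
  move=> ws; rewrite real_ltNge //; apply/negP => /qD.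
  by rewrite qs hornerZ mulf_eq0 negb_or -rootE root_prod_XsubC ws andbF.
have zs : zeta \notin s.
  by apply/negP => /sD; rewrite real_ltNge // zetaD.
have -> : q^`().[zeta] = q.[zeta] * \sum_(w <- s) (zeta - w)^-1.
  by rewrite [in LHS]qs [in RHS]qs derivZ !hornerZ horner_deriv_prod // mulrA.
rewrite mulrCA [n%:R * _]mulrC -mulrDr mulf_neq0 ?qD //.
have -> : n%:R + (z1 - zeta) * (\sum_(w <- s) (zeta - w)^-1) =
   \sum_(w <- s) ((z1 - w) / (zeta - w)) + (n - size s)%:R.
  have -> : n%:R = \sum_(w <- s) 1 + (n - size s)%:R :> C.
    rewrite -[in LHS](subnKC ss) natrD; congr (_ + _).
    by rewrite -sum1_size natr_sum.
  rewrite addrAC mulr_sumr -big_split /=; congr (_ + _).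
  rewrite big_seq [RHS]big_seq; apply: eq_bigr => w ws.
  have ? : zeta - w != 0 by rewrite subr_eq0; apply: contraNneq zs => ->.
  by field.
set V := (X in X != 0).
suff : 0 < (1 - z1^* * zeta) * V + ((1 - z1^* * zeta) * V)^*.
  by apply: contraTneq => ->; rewrite !(mulr0, rmorph0, addr0) ltxx.
have VE : (1 - z1^* * zeta) * V + ((1 - z1^* * zeta) * V)^* =
  \sum_(w <- s) ((1 - z1^* * zeta) * ((z1 - w) / (zeta - w)) +
      ((1 - z1^* * zeta) * ((z1 - w) / (zeta - w)))^*)
  + (n - size s)%:R * ((1 - z1^* * zeta) + (1 - z1^* * zeta)^*).
  rewrite /V big_split /= -mulr_sumr -rmorph_sum /= -mulr_sumr.
  have conjn m (y : C) : (y * m%:R)^* = m%:R * y^*.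
    by rewrite rmorphM /= rmorph_nat mulrC.
  by rewrite mulrDr [X in _ + X]rmorphD /= conjn; ring.
rewrite {}VE.
have sumge0 : 0 <= \sum_(w <- s) ((1 - z1^* * zeta) * ((z1 - w) / (zeta - w)) +
      ((1 - z1^* * zeta) * ((z1 - w) / (zeta - w)))^*).
  rewrite big_seq sumr_ge0 // => w /sD wD; apply/ltW.
  exact: polar_factor_gt0.
have [sn|sn] := ltnP (size s) n.
  apply: ltr_wpDl => //; rewrite mulr_gt0 ?ltr0n ?subn_gt0 //.
  exact: polar_const_gt0.
(* No zero at infinity: the finite zeros alone give a positive sum. *)
have -> : (n - size s = 0)%N by apply/eqP; rewrite subn_eq0.
rewrite mul0r addr0.
case: s {qs ss zs V sumge0} sD sn => [|w s] sD sn.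
  by move: sn; rewrite leqNgt n0.
rewrite big_cons ltr_pwDl ?polar_factor_gt0 ?sD ?mem_head //.
rewrite big_seq sumr_ge0 // => x xs; apply/ltW.
by apply: polar_factor_gt0 => //; rewrite sD // in_cons xs orbT.
Qed.

Definition linear_functional (L : {poly C} -> C) :=
  forall (a : C) f g, L (a *: f + g) = a * L f + L g.

Section Functional.
Variables (L : {poly C} -> C) (linL : linear_functional L).

Lemma functional0 : L 0 = 0.
Proof.
have := linL 1 0 0; rewrite scaler0 addr0 mul1r => /eqP.
by rewrite -subr_eq subrr eq_sym => /eqP.
Qed.

Lemma functionalZ a f : L (a *: f) = a * L f.
Proof. by rewrite -[a *: f]addr0 linL functional0 addr0. Qed.

Lemma functionalD f g : L (f + g) = L f + L g.
Proof. by rewrite -[f]scale1r linL mul1r scale1r. Qed.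

Lemma functional_sum m (c : 'I_m -> C) (F : 'I_m -> {poly C}) :
  L (\sum_(i < m) c i *: F i) = \sum_(i < m) c i * L (F i).
Proof.
apply: (big_ind2 (fun f y => L f = y)); first exact: functional0.
  by move=> f y g t <- <-; rewrite functionalD.
by move=> i _; rewrite functionalZ.
Qed.

(** The polynomial zeta |-> L((X - zeta)^n). *)
Definition power_generating n : {poly C} :=
  \poly_(k < n.+1) ((-1) ^+ k * 'C(n, k)%:R * L 'X^(n - k)).

Lemma horner_power_generating n zeta :
  (power_generating n).[zeta] = L (('X - zeta%:P) ^+ n).
Proof.
rewrite /power_generating horner_poly exprBn.
rewrite (eq_bigr (fun k : 'I_n.+1 =>
   ((-1) ^+ k * 'C(n, k)%:R * zeta ^+ k) *: 'X^(n - k))); last first.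
  move=> k _; rewrite -mulr_natr -polyC_exp -mul_polyC !polyCM.
  rewrite !polyC_exp polyCN polyC_natr -!polyC_exp; ring.
by rewrite functional_sum; apply: eq_bigr => k _; ring.
Qed.

Lemma deriv_power_generating n :
  (power_generating n.+1)^`() = - n.+1%:R *: power_generating n.
Proof.
apply/polyP => k; rewrite coef_deriv coefZ !coef_poly ltnS.
case: ifP => kn; last by rewrite mul0rn mulr0.
rewrite subSS exprS.
have /(congr1 (fun m => m%:R : C)) : (k.+1 * 'C(n.+1, k.+1) = n.+1 * 'C(n, k))%N.
  by rewrite mul_bin_diag.
rewrite !natrM => H; rewrite -[LHS]mulr_natl.
transitivity (- (k.+1%:R * 'C(n.+1, k.+1)%:R) * (-1) ^+ k * L 'X^(n - k)).
  by ring.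
by rewrite H; ring.
Qed.

End Functional.

(** Replacing one factor X - zeta by X - z1 in L((X - zeta)^n) produces a polar
derivative of zeta |-> L((X - zeta)^n), so that the hypothesis is inherited by
the functional f |-> L((X - z1) f) in degree n - 1. *)
Theorem grace n (L : {poly C} -> C) (s : seq C) :
  linear_functional L -> size s = n ->
  (forall z, `|z| <= 1 -> L (('X - z%:P) ^+ n) != 0) ->
  (forall z, z \in s -> `|z| <= 1) ->
  L (\prod_(z <- s) ('X - z%:P)) != 0.
Proof.
elim: n L s => [|n IH] L s linL.
  move/eqP/nilP => -> LD _; rewrite big_nil.
  by have := LD 0; rewrite expr0; apply; rewrite normr0 ler01.
case: s => // z1 s [ss] LD sD.
have z1D : `|z1| <= 1 by rewrite sD // mem_head.
rewrite big_cons.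
apply: (IH (fun f => L (('X - z1%:P) * f))) => //; last first.
- by move=> z zs; rewrite sD // in_cons zs orbT.
- move=> zeta zetaD.
  have := @polar_neq0 n.+1 (power_generating L n.+1) z1 zeta isT.
  rewrite size_poly => /(_ isT).
  rewrite deriv_power_generating hornerZ !(horner_power_generating linL) => H.
  have {}H := H _ z1D zetaD.
  have /H : forall z : C, `|z| <= 1 -> (power_generating L n.+1).[z] != 0.
    by move=> z zD; rewrite (horner_power_generating linL) LD.
  apply: contra_neq => H0.
  have : L (('X - z1%:P) * ('X - zeta%:P) ^+ n) =
      (zeta - z1) * L (('X - zeta%:P) ^+ n) + L (('X - zeta%:P) ^+ n.+1).
    rewrite -linL; congr L.
    by rewrite -mul_polyC polyCB exprS; ring.
  rewrite H0 => /(congr1 (fun x => n.+1%:R * x)); rewrite mulr0 => ->.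
  by ring.
- move=> a f g /=; rewrite mulrDr -scalerAr; exact: linL.
Qed.


End Grace.

(** * Coefficient multipliers and domination outside the disc *)

Section Multipliers.
Variable C : numClosedFieldType.
Implicit Types (z w zeta mu : C) (f g : {poly C}) (e : nat -> C).

(** The exact degree is part of the notion: a missing top coefficient would be a
zero at infinity, outside the disc. *)
Definition disc_rooted n f := size f = n.+1 /\ forall z, root f z -> `|z| <= 1.

Lemma disc_rooted_neq0 n f : disc_rooted n f -> f != 0.
Proof. by case=> sf _; rewrite -size_poly_eq0 sf. Qed.

Lemma disc_rooted_lead n f : disc_rooted n f -> lead_coef f = f`_n.
Proof. by case=> sf _; rewrite lead_coefE sf. Qed.

Lemma disc_rooted_coef_neq0 n f : disc_rooted n f -> f`_n != 0.
Proof. by move=> fI; rewrite -(disc_rooted_lead fI) lead_coef_eq0 (disc_rooted_neq0 fI). Qed.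

Lemma disc_rooted_horner_neq0 n f w : disc_rooted n f -> 1 < `|w| -> f.[w] != 0.
Proof.
move=> [_ fI] w1; apply/negP => /fI; apply/negP.
by rewrite -real_ltNge.
Qed.

Lemma linear_factors f : exists s : seq C, f = lead_coef f *: \prod_(z <- s) ('X - z%:P)
  /\ (f != 0 -> size f = (size s).+1).
Proof.
have [s fs] := closed_field_poly_normal f; exists s; split=> // f0.
by rewrite fs size_scale ?lead_coef_eq0 // size_prod_XsubC.
Qed.

Lemma disc_rooted_factor n f : disc_rooted n f -> exists s : seq C,
  [/\ size s = n, f = f`_n *: \prod_(z <- s) ('X - z%:P) &
      forall z, z \in s -> `|z| <= 1].
Proof.
move=> fI; have [s [fs ss]] := linear_factors f.
exists s; split.
- by have := ss (disc_rooted_neq0 fI); rewrite fI.1 => -[].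
- by rewrite -(disc_rooted_lead fI).
- move=> z zs; apply: fI.2; rewrite fs rootZ ?root_prod_XsubC //.
  by rewrite lead_coef_eq0 (disc_rooted_neq0 fI).
Qed.

Definition multop n e f := \poly_(k < n.+1) (e k * f`_k).

Lemma coef_multop n e f k : (multop n e f)`_k = if (k < n.+1)%N then e k * f`_k else 0.
Proof. exact: coef_poly. Qed.

Lemma multop_linear n e a f g : multop n e (a *: f + g) = a *: multop n e f + multop n e g.
Proof.
apply/polyP => k; rewrite coefD coefZ !coef_multop coefD coefZ.
by case: ifP => _; ring.
Qed.

Lemma multopZ n e a f : multop n e (a *: f) = a *: multop n e f.
Proof. by apply/polyP => k; rewrite !(coefZ, coef_multop); case: ifP => _; ring. Qed.

Lemma multopB n e f g : multop n e (f - g) = multop n e f - multop n e g.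
Proof. by rewrite -scaleN1r addrC multop_linear scaleN1r addrC. Qed.

Lemma multop_functional n e w : linear_functional (fun f => (multop n e f).[w]).
Proof. by move=> a f g; rewrite multop_linear hornerD hornerZ. Qed.

Lemma size_multop n e f : (size (multop n e f) <= n.+1)%N.
Proof. exact: size_poly. Qed.

Lemma size_multE n e f : e n * f`_n != 0 -> size (multop n e f) = n.+1.
Proof. by move=> H; rewrite size_poly_eq. Qed.

Definition zero_preserving n e := forall f, disc_rooted n f -> disc_rooted n (multop n e f).

Lemma zero_preserving_neq0 n e : zero_preserving n e -> e n != 0.
Proof.
move=> eI.
have /eI fI : disc_rooted n ('X^n : {poly C}).
  split; first by rewrite size_polyXn.
  move=> z; rewrite rootE hornerXn => /eqP z0; rewrite -(@expr_le1 _ n.+1) //.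
  by rewrite exprS -normrX z0 normr0 mulr0 ler01.
have := disc_rooted_coef_neq0 fI; rewrite coef_multop ltnSn.
by apply: contraNneq => ->; rewrite mul0r.
Qed.

(** Evaluation of the image at an exterior point is a linear functional, to which
Grace's theorem applies. *)
Lemma zero_preserving_grace n e : e n != 0 ->
  (forall zeta w, `|zeta| <= 1 -> 1 < `|w| ->
     (multop n e (('X - zeta%:P) ^+ n)).[w] != 0) ->
  zero_preserving n e.
Proof.
move=> en H f fI; split.
  by rewrite size_multE // mulf_neq0 // disc_rooted_coef_neq0.
have [s [ss fs sD]] := disc_rooted_factor fI.
move=> w; rewrite rootE => w0; rewrite real_leNgt //; apply/negP => w1; move: w0.
rewrite fs multopZ hornerZ mulf_eq0 (negPf (disc_rooted_coef_neq0 fI)) /=; apply/negP.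
apply: (grace (multop_functional n e w) ss) => // zeta zD; exact: H.
Qed.

(** A radial modulus of continuity at points of the circle, which replaces any
appeal to the topology of the complex field. *)
Lemma horner_radial_lipschitz f w : `|w| = 1 ->
  exists2 M : C, 0 <= M & forall t : C, 0 <= t <= 1 ->
    `|f.[(1 + t) * w] - f.[w]| <= t * M.
Proof.
move=> w1.
have /factor_theorem[g fg] : root (f - (f.[w])%:P) w.
  by rewrite rootE hornerD hornerN hornerC subrr.
exists (\sum_(i < size g) `|g`_i| * 2 ^+ i).
  by apply: sumr_ge0 => i _; rewrite mulr_ge0 // exprn_ge0.
move=> t /andP[t0 t1].
have -> : f.[(1 + t) * w] - f.[w] = g.[(1 + t) * w] * (t * w).
  have /(congr1 (fun h => h.[(1 + t) * w])) := fg.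
  rewrite hornerD hornerN hornerC hornerM hornerXsubC => ->; ring.
rewrite !normrM w1 mulr1 (ger0_norm t0) mulrC ler_wpM2l //.
rewrite horner_coef (le_trans (ler_norm_sum _ _ _)) // ler_sum // => i _.
rewrite normrM ler_wpM2l // normrX lerXn2r ?nnegrE ?normr_ge0 //.
by rewrite normrM w1 mulr1 ger0_norm ?addr_ge0 // lerD2l.
Qed.

Lemma horner_le_unit f g :
  (forall w, 1 < `|w| -> `|g.[w]| <= `|f.[w]|) ->
  forall w, `|w| = 1 -> `|g.[w]| <= `|f.[w]|.
Proof.
move=> gf w w1; rewrite real_leNgt ?normr_real //; apply/negP => fg.
have [M M0 HM] := horner_radial_lipschitz f w1.
have [N N0 HN] := horner_radial_lipschitz g w1.
pose d := `|g.[w]| - `|f.[w]|; have d0 : 0 < d by rewrite subr_gt0.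
have MN0 : 0 <= M + N by exact: addr_ge0.
have D0 : 0 < d + (M + N) + 1 by rewrite ltr_wpDl // addr_ge0 // ltW.
pose t := d / (d + (M + N) + 1).
have t0 : 0 < t by rewrite divr_gt0.
have t1 : 0 <= t <= 1.
  by rewrite ltW //= ler_pdivrMr // mul1r -addrA lerDl addr_ge0.
have tMN : t * (M + N) < d.
  rewrite mulrAC ltr_pdivrMr // ltr_pM2l //.
  by rewrite -addrA addrCA ltrDl addr_gt0.
have tw : 1 < `|(1 + t) * w|.
  by rewrite normrM w1 mulr1 ger0_norm ?ltrDl // addr_ge0 // ltW.
have := gf _ tw; apply/negP; rewrite -real_ltNge ?normr_real //.
have h1 : `|f.[(1 + t) * w]| <= `|f.[w]| + t * M.
  by rewrite -lerBlDl (le_trans (lerB_dist _ _)) // HM.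
have h2 : `|g.[w]| - t * N <= `|g.[(1 + t) * w]|.
  by rewrite lerBlDr -lerBlDl (le_trans (lerB_dist _ _)) // distrC HN.
apply: le_lt_trans h1 (lt_le_trans _ h2).
by rewrite ltrBrDr -addrA -mulrDr -ltrBrDl.
Qed.

(** If |T g(w)| > |T f(w)|, take la = T g(w)/T f(w): then |la| > 1, so la f - g has
no zero outside the disc, although its image vanishes at w. *)
Lemma multop_comparison n e f g : zero_preserving n e -> disc_rooted n f ->
  (size g <= n.+1)%N -> `|g`_n| <= `|f`_n| ->
  (forall w, 1 < `|w| -> `|g.[w]| <= `|f.[w]|) ->
  forall w, 1 <= `|w| -> `|(multop n e g).[w]| <= `|(multop n e f).[w]|.
Proof.
move=> eI fI sg gn gf.
suff H w : 1 < `|w| -> `|(multop n e g).[w]| <= `|(multop n e f).[w]|.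
  move=> w; rewrite le_eqVlt => /predU1P[/esym w1|]; last exact: H.
  exact: horner_le_unit.
move=> w1; rewrite real_leNgt ?normr_real //; apply/negP => Hlt.
have Tf0 := disc_rooted_horner_neq0 (eI _ fI) w1.
(* la f - g contradicts the preservation of zeros at w. *)
pose la := (multop n e g).[w] / (multop n e f).[w].
have la1 : 1 < `|la| by rewrite normf_div ltr_pdivlMr ?normr_gt0 // mul1r.
have hlt (x y : C) : x != 0 -> `|y| <= `|x| -> la * x + (-1) * y != 0.
  move=> x0 yx; rewrite mulN1r subr_eq0; apply: contraTneq yx => <-.
  by rewrite -real_ltNge ?normr_real // normrM ltr_pMl // normr_gt0.
have hn : la * f`_n - g`_n != 0.
  by have := hlt _ _ (disc_rooted_coef_neq0 fI) gn; rewrite mulN1r.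
have hI : disc_rooted n (la *: f - g).
  split.
    apply/eqP; rewrite eqn_leq; apply/andP; split.
      rewrite (leq_trans (size_polyD _ _)) // geq_max size_polyN sg andbT.
      by rewrite (leq_trans (size_scale_leq _ _)) // fI.1.
    by rewrite ltnNge; apply: contra hn => /leq_sizeP/(_ n (leqnn n)); rewrite coefB coefZ => ->.
  move=> z; rewrite rootE hornerD hornerN hornerZ => z0.
  rewrite real_leNgt //; apply/negP => z1; move: z0; apply/negP.
  have := hlt _ _ (disc_rooted_horner_neq0 fI z1) (gf _ z1).
  by rewrite mulN1r.
have /negP := disc_rooted_horner_neq0 (eI _ hI) w1; apply.
by rewrite multopB multopZ hornerD hornerN hornerZ /la divfK // subrr.
Qed.

(** The polynomial z^n conj(f(1/conj z)). *)
Definition recip n f := \poly_(k < n.+1) (f`_(n - k))^*.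

Lemma horner_recip n f w : (size f <= n.+1)%N -> w != 0 ->
  (recip n f).[w] = w ^+ n * (f.[(w^*)^-1])^*.
Proof.
move=> sf w0; rewrite horner_poly (horner_coef_wide _ sf) rmorph_sum mulr_sumr.
rewrite (reindex_inj rev_ord_inj) /=; apply: eq_bigr => k _.
have kn : (k <= n)%N by rewrite -ltnS.
rewrite subSS subKn // rmorphM rmorphXn fmorphV /= conjCK mulrCA.
congr (_ * _); rewrite exprVn -[in w ^+ n](subnK kn).
by rewrite exprD mulfK // expf_neq0.
Qed.

Lemma recip_multop n e f :
  recip n (multop n e f) = multop n (fun k => (e (n - k)%N)^*) (recip n f).
Proof.
apply/polyP => k; rewrite !coef_poly; case: ifP => // kn.
by rewrite ltnS leq_subr rmorphM.
Qed.

Lemma norm_horner_recip n f w : (size f <= n.+1)%N -> `|w| = 1 ->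
  `|(recip n f).[w]| = `|f.[w]|.
Proof.
move=> sf w1; have w0 : w != 0 by rewrite -normr_gt0 w1 ltr01.
rewrite horner_recip // normrM normrX w1 expr1n mul1r norm_conjC.
suff -> : (w^*)^-1 = w by [].
have ww : w * w^* = 1 by rewrite -normCK w1 expr1n.
by rewrite -[LHS]mul1r -ww mulfK // conjC_eq0.
Qed.

Lemma horner_recip_prod (s : seq C) c w : w != 0 ->
  (recip (size s) (c *: \prod_(z <- s) ('X - z%:P))).[w] =
  c^* * \prod_(z <- s) (1 - z^* * w).
Proof.
move=> w0; rewrite horner_recip //; last first.
  by rewrite (leq_trans (size_scale_leq _ _)) // size_prod_XsubC.
rewrite hornerZ rmorphM mulrCA; congr (_ * _).
rewrite horner_prod rmorph_prod /=; elim: s => [|z s IH].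
  by rewrite !big_nil expr0 mulr1.
rewrite !big_cons exprS mulrACA IH; congr (_ * _).
by rewrite hornerXsubC rmorphB fmorphV /= conjCK mulrBr divff // mulrC.
Qed.

(** |w - z|^2 - |1 - conj(z) w|^2 = (|w|^2 - 1)(1 - |z|^2). *)
Lemma factor_reflect z w : `|z| <= 1 -> 1 <= `|w| -> `|1 - z^* * w| <= `|w - z|.
Proof.
move=> z1 w1; rewrite -ler_sqr ?nnegrE // !normCK -subr_ge0.
have -> : (w - z) * (w - z)^* - (1 - z^* * w) * (1 - z^* * w)^* =
   (w * w^* - 1) * (1 - z * z^*).
  by rewrite !(rmorphB, rmorphM, rmorph1) /= ?conjCK; ring.
apply: mulr_ge0; last by rewrite -normC_le1.
by rewrite subr_ge0 -normCK expr_ge1.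
Qed.

Lemma factor_reflect_lt z w : `|z| < 1 -> 1 < `|w| -> `|1 - z^* * w| < `|w - z|.
Proof.
move=> z1 w1; rewrite -ltr_sqr ?nnegrE // !normCK -subr_gt0.
have -> : (w - z) * (w - z)^* - (1 - z^* * w) * (1 - z^* * w)^* =
   (w * w^* - 1) * (1 - z * z^*).
  by rewrite !(rmorphB, rmorphM, rmorph1) /= ?conjCK; ring.
by apply: mulr_gt0; rewrite -?normC_lt1 // -normC_gt1.
Qed.

Lemma factor_reflect_out z w : 1 <= `|z| -> 1 <= `|w| -> `|w - z| <= `|1 - z^* * w|.
Proof.
move=> z1 w1; rewrite -ler_sqr ?nnegrE // !normCK -subr_ge0.
have -> : (1 - z^* * w) * (1 - z^* * w)^* - (w - z) * (w - z)^* =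
   (w * w^* - 1) * (z * z^* - 1).
  by rewrite !(rmorphB, rmorphM, rmorph1) /= ?conjCK; ring.
by apply: mulr_ge0; rewrite subr_ge0 -normCK expr_ge1.
Qed.

Lemma ler_prod_seq (s : seq C) (F G : C -> C) :
  (forall z, z \in s -> `|F z| <= `|G z|) ->
  `|\prod_(z <- s) F z| <= `|\prod_(z <- s) G z|.
Proof.
elim: s => [|z s IH] H; first by rewrite !big_nil.
rewrite !big_cons !normrM ler_pM // ?H ?mem_head //.
by apply: IH => x xs; apply: H; rewrite in_cons xs orbT.
Qed.

Lemma recip_le n f w : disc_rooted n f -> 1 <= `|w| -> `|(recip n f).[w]| <= `|f.[w]|.
Proof.
move=> fI w1; have [s [ss fs sD]] := disc_rooted_factor fI.
have w0 : w != 0 by rewrite -normr_gt0 (lt_le_trans ltr01).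
rewrite {2}fs [in X in X <= _]fs -ss horner_recip_prod // hornerZ horner_prod !normrM norm_conjC.
rewrite ler_wpM2l //; apply: ler_prod_seq => z /sD zD.
by rewrite hornerXsubC factor_reflect.
Qed.

Lemma recip_coef_le n f : disc_rooted n f -> `|f`_0| <= `|f`_n|.
Proof.
move=> fI; have [s [ss fs sD]] := disc_rooted_factor fI.
rewrite -horner_coef0 {1}fs hornerZ horner_prod normrM ler_piMr //.
apply: (le_trans (ler_prod_seq (G := fun=> 1) _)); last first.
  by rewrite big1 ?normr1.
by move=> z /sD; rewrite hornerXsubC sub0r normrN normr1.
Qed.

End Multipliers.

(** * Multipliers that preserve zeros in the disc *)

Section Operators.
Variable C : numClosedFieldType.
Implicit Types (z w zeta mu c : C) (f g : {poly C}) (e : nat -> C).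

Lemma coef_XsubC_exp n c k : (k <= n)%N ->
  (('X - c%:P) ^+ n)`_k = (- c) ^+ (n - k) * 'C(n, k)%:R.
Proof.
move=> kn; rewrite addrC -polyCN exprDn coef_sum.
have kn1 : (k < n.+1)%N by rewrite ltnS.
rewrite (bigD1 (Ordinal kn1)) //= big1 ?addr0.
  by rewrite coefMn -polyC_exp coefCM coefXn eqxx mulr1 mulr_natr.
move=> i; rewrite -val_eqE /= => /negPf ik.
by rewrite coefMn -polyC_exp coefCM coefXn eq_sym ik mulr0 mul0rn.
Qed.

Lemma size_XsubC_exp n c : size (('X - c%:P) ^+ n) = n.+1.
Proof.
elim: n => [|n IH]; first by rewrite expr0 size_poly1.
by rewrite exprS size_monicM ?monicXsubC ?expf_neq0 ?polyXsubC_eq0 // IH size_XsubC.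
Qed.

Lemma disc_rooted_XsubC_exp n c : `|c| <= 1 -> disc_rooted n (('X - c%:P) ^+ n).
Proof.
move=> c1; split; first exact: size_XsubC_exp.
by move=> z; rewrite rootE horner_exp hornerXsubC expf_eq0 => /andP[_]; rewrite subr_eq0 => /eqP ->.
Qed.

(** Homogeneity of diagonal operators: a zero zeta is moved to 1 by rescaling w. *)
Lemma multop_XsubC_exp n e zeta w : zeta != 0 ->
  (multop n e (('X - zeta%:P) ^+ n)).[w] =
  zeta ^+ n * (multop n e (('X - 1%:P) ^+ n)).[w / zeta].
Proof.
move=> z0; rewrite !horner_poly mulr_sumr; apply: eq_bigr => k _.
have kn : (k <= n)%N by rewrite -ltnS.
rewrite !coef_XsubC_exp // expr_div_n -[in zeta ^+ n](subnK kn) exprD.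
rewrite [(- zeta) ^+ _]exprNn [(- 1) ^+ _]exprNn expr1n.
have ? : zeta ^+ k != 0 by rewrite expf_neq0.
by field.
Qed.

(** (X - 1)^n is its own reciprocal polynomial up to the sign (-1)^n. *)
Lemma recip_multop_XsubC1 n e k : (k <= n)%N ->
  (-1) ^+ n * (recip n (multop n e (('X - 1%:P) ^+ n)))`_k =
  (e (n - k)%N)^* * (('X - 1%:P) ^+ n : {poly C})`_k.
Proof.
move=> kn; rewrite coef_poly ltnS kn coef_multop ltnS leq_subr.
rewrite !coef_XsubC_exp ?leq_subr // subKn // bin_sub // rmorphM mulrCA.
congr (_ * _); rewrite rmorphM rmorphXn rmorphN1 rmorph_nat mulrA -exprD.
congr (_ * _); rewrite -{1}(subnK kn) -addnA exprD addnn -mul2n exprM.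
by rewrite sqrrN expr1n expr1n mulr1.
Qed.

Lemma ltr_prod_seq (s : seq C) (F G : C -> C) :
  (forall z, z \in s -> `|F z| <= `|G z|) -> (forall z, z \in s -> 0 < `|G z|) ->
  (exists2 z, z \in s & `|F z| < `|G z|) ->
  `|\prod_(z <- s) F z| < `|\prod_(z <- s) G z|.
Proof.
move=> FG G0 [z zs Hz]; rewrite !(big_rem z zs) /= !normrM.
apply: (@le_lt_trans _ _ (`|F z| * `|\prod_(y <- rem z s) G y|)).
  by rewrite ler_wpM2l // ler_prod_seq // => y /mem_rem; exact: FG.
rewrite ltr_pM2r // normr_prod big_seq; apply: prodr_gt0 => y /mem_rem; exact: G0.
Qed.

(** By Grace's theorem and homogeneity only (X - 1)^n matters.  Its image is
mu h +- h', where h is the image under the given operator and h' is the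
reciprocal polynomial of h.  Outside the disc |h'| < |h| unless all zeros of h
are on the circle; then h' is a unimodular multiple of h, and the image is a
multiple of h, nonzero because its leading coefficient is. *)
Lemma twist_zero_preserving n e mu : zero_preserving n e -> `|mu| = 1 ->
  mu * e n + (e 0)^* != 0 ->
  zero_preserving n (fun k => mu * e k + (e (n - k)%N)^*).
Proof.
move=> eI mu1 top0; apply: zero_preserving_grace; first by rewrite subnn.
move=> zeta w zetaD w1.
have [->|z0] := eqVneq zeta 0.
  rewrite subr0 horner_poly (bigD1 ord_max) //= coefXn eqxx mulr1 subnn.
  rewrite big1 ?addr0; last first.
    move=> i; rewrite -val_eqE /= => /negPf.
    by rewrite coefXn => ->; rewrite mulr0 mul0r.
  have w0 : w != 0 by rewrite -normr_gt0 (lt_trans ltr01).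
  by rewrite mulf_neq0 ?expf_neq0.
rewrite multop_XsubC_exp // mulf_neq0 ?expf_neq0 //.
have : 1 < `|w / zeta|.
  rewrite normf_div ltr_pdivlMr ?normr_gt0 // mul1r.
  exact: le_lt_trans zetaD w1.
move: (w / zeta) => {w1 zetaD z0 zeta}w w1.
set p1 := ('X - 1%:P) ^+ n; pose h := multop n e p1.
have hI : disc_rooted n h by apply: eI; apply: disc_rooted_XsubC_exp; rewrite normr1.
have TE : multop n (fun k => mu * e k + (e (n - k)%N)^*) p1 =
    mu *: h + (-1) ^+ n *: recip n h.
  apply/polyP => k; rewrite coefD !coefZ.
  have [kn|kn] := leqP k n; last first.
    by rewrite !coef_poly ltnS leqNgt kn /=; ring.
  by rewrite recip_multop_XsubC1 // !coef_multop ltnS kn; ring.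
rewrite TE hornerD !hornerZ.
have w0 : w != 0 by rewrite -normr_gt0 (lt_trans ltr01).
have [s [ss hs sD]] := disc_rooted_factor hI.
have [|/allPn[z zs zN]] := boolP (all (fun z => `|z| == 1) s).
  move=> /allP s1.
  (* All zeros on the circle: ka is the constant ratio of recip h to h. *)
  pose ka := (h`_n)^* / h`_n * \prod_(z <- s) (- z^*).
  have revE : (recip n h).[w] = ka * h.[w].
    rewrite {1}hs -ss horner_recip_prod // ss [in h.[w]]hs hornerZ.
    have -> x : ka * (h`_n * x) = (h`_n)^* * (\prod_(z <- s) (- z^*) * x).
      by rewrite /ka; field; exact: disc_rooted_coef_neq0.
    congr (_ * _).
    rewrite horner_prod -big_split /= big_seq [RHS]big_seq.
    apply: eq_bigr => z zs; rewrite hornerXsubC.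
    have zz : z * z^* = 1 by rewrite -normCK (eqP (s1 z zs)) expr1n.
    by rewrite -[X in X - _]zz; ring.
  have topE : (recip n h)`_n = ka * h`_n.
    rewrite coef_poly ltnSn subnn -horner_coef0 {1}hs hornerZ horner_prod.
    rewrite rmorphM /ka mulrAC divfK ?disc_rooted_coef_neq0 //; congr (_ * _).
    rewrite rmorph_prod; apply: eq_bigr => z _.
    by rewrite hornerXsubC sub0r rmorphN.
  have : (multop n (fun k => mu * e k + (e (n - k)%N)^*) p1)`_n != 0.
    rewrite coef_multop ltnSn subnn mulf_neq0 // coef_XsubC_exp // subnn binn.
    by rewrite expr0 mulr1 oner_neq0.
  rewrite TE coefD !coefZ topE revE !mulrA -!mulrDl !mulf_eq0 !negb_or.
  by move=> /andP[-> _] /=; rewrite (disc_rooted_horner_neq0 hI).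
apply: contraTneq (_ : `|(recip n h).[w]| < `|h.[w]|) => [H|].
  have : `|mu * h.[w]| = `|(-1) ^+ n * (recip n h).[w]|.
    by move/eqP: H; rewrite addr_eq0 => /eqP ->; rewrite normrN.
  by rewrite !normrM mu1 normrX normrN1 expr1n !mul1r => ->; rewrite ltxx.
rewrite [in X in X < _]hs -ss horner_recip_prod // ss [in X in _ < X]hs hornerZ.
rewrite !normrM norm_conjC ltr_pM2l ?normr_gt0 ?disc_rooted_coef_neq0 // horner_prod.
apply: ltr_prod_seq.
- by move=> y ys; rewrite hornerXsubC factor_reflect ?sD // ltW.
- move=> y ys; rewrite hornerXsubC normr_gt0 subr_eq0.
  by apply: contraTneq w1 => ->; rewrite -real_leNgt // sD.
- exists z => //; rewrite hornerXsubC factor_reflect_lt // lt_def eq_sym zN.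
  exact: sD.
Qed.

Lemma disc_rooted_mul1 n f c d : disc_rooted n f -> d != 0 -> `|c| <= 1 ->
  disc_rooted n.+1 (d *: ('X - c%:P) * f).
Proof.
move=> fI d0 c1; split.
  rewrite -scalerAl size_scale // size_monicM ?monicXsubC ?(disc_rooted_neq0 fI) //.
  by rewrite fI.1 size_XsubC.
move=> z; rewrite rootM rootZ // root_XsubC => /orP[/eqP -> //|].
exact: fI.2.
Qed.

(** Each zero z outside the disc is replaced by 1/conj(z), with the factor
1 - conj(z) X: the modulus is unchanged on the circle and does not decrease
outside the disc. *)
Lemma reflect_into_disc n f : size f = n.+1 -> exists g,
  [/\ disc_rooted n g, `|f`_n| <= `|g`_n|,
      forall w, 1 <= `|w| -> `|f.[w]| <= `|g.[w]| &
      forall w, `|w| = 1 -> `|g.[w]| = `|f.[w]|].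
Proof.
move=> sf; have [s [fs]] := linear_factors f.
have f0 : f != 0 by rewrite -size_poly_eq0 sf.
move=> /(_ f0); rewrite sf => -[ns].
have lf : lead_coef f = f`_n by rewrite lead_coefE sf.
rewrite -lf; have : lead_coef f != 0 by rewrite lead_coef_eq0.
rewrite fs lead_coefZ (monicP (monic_prod_XsubC _ _ _)) mulr1.
move: (lead_coef f) => c c0 {f fs sf f0 lf}; subst n.
elim: s => [|z s [g [gI cg fg eg]]].
  exists c%:P; split.
  - split; first by rewrite size_polyC c0.
    by move=> z; rewrite rootC (negPf c0).
  - by rewrite coefC.
  - by move=> w _; rewrite big_nil hornerZ !hornerC mulr1.
  - by move=> w _; rewrite big_nil hornerZ !hornerC mulr1.
have fE w : (c *: \prod_(y <- z :: s) ('X - y%:P)).[w] =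
    (w - z) * (c *: \prod_(y <- s) ('X - y%:P)).[w].
  by rewrite big_cons !hornerZ hornerM hornerXsubC mulrCA.
have topE d y : (d *: ('X - y%:P) * g)`_(size s).+1 = d * g`_(size s).
  rewrite -scalerAl coefZ mulrBl coefB coefXM coefCM /=.
  by rewrite [X in _ - _ * X]nth_default ?mulr0 ?subr0 // gI.1.
have [z1|z1] := real_leP (normr_real z) (@real1 C).
  exists (1 *: ('X - z%:P) * g); split.
  - by apply: disc_rooted_mul1; rewrite ?oner_neq0.
  - by rewrite topE mul1r.
  - move=> w w1; rewrite fE scale1r hornerM hornerXsubC !normrM ler_wpM2l //.
    exact: fg.
  - by move=> w w1; rewrite fE scale1r hornerM hornerXsubC !normrM eg.
have z0 : z != 0 by rewrite -normr_gt0 (lt_trans ltr01).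
have zc0 : z^* != 0 by rewrite conjC_eq0.
have gE w : ((- z^*) *: ('X - ((z^*)^-1)%:P) * g).[w] = (1 - z^* * w) * g.[w].
  by rewrite hornerM hornerZ hornerXsubC; field.
exists ((- z^*) *: ('X - ((z^*)^-1)%:P) * g); split.
- apply: disc_rooted_mul1; rewrite ?oppr_eq0 //.
  by rewrite normfV norm_conjC invf_le1 ?(lt_trans ltr01) // ltW.
- rewrite topE normrM normrN norm_conjC (le_trans cg) // ler_peMl //.
  exact: ltW.
- move=> w w1; rewrite fE gE !normrM ler_pM //; last exact: fg.
  by rewrite factor_reflect_out // ltW.
- move=> w w1; rewrite fE gE !normrM eg //; congr (_ * _).
  have -> : w - z = (1 - z^* * w)^* * w.
    have ww : w * w^* = 1 by rewrite -normCK w1 expr1n.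
    by rewrite -[z in LHS]mulr1 -[1 in LHS]ww rmorphB rmorphM rmorph1 /= conjCK; ring.
  by rewrite normrM w1 mulr1 norm_conjC.
Qed.

(** The difference of the squares, cleared of denominators, is (R - r) times
(R r - 1)|w + z|^2 + (|w|^2 - |z|^2)(R + 1)(r + 1). *)
Lemma dilation_factor (R r : C) w z : 1 <= r -> r < R -> 1 < `|w| -> `|z| <= 1 ->
  (R + 1) / (r + 1) * `|r * w - z| < `|R * w - z|.
Proof.
move=> r1 rR w1 z1.
have r0 : 0 < r by rewrite (lt_le_trans ltr01).
have R0 : 0 < R by exact: lt_trans rR.
have r10 : 0 < r + 1 by rewrite addr_gt0.
have R10 : 0 < R + 1 by rewrite addr_gt0.
rewrite mulrAC ltr_pdivrMr // -ltr_sqr ?nnegrE ?mulr_ge0 // ?ltW //.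
rewrite !exprMn !normCK -subr_gt0.
have conjr x : 0 < x -> x^* = x :> C by move=> /gtr0_real/CrealP.
have -> : (R * w - z) * (R * w - z)^* * (r + 1) ^+ 2 -
    (R + 1) ^+ 2 * ((r * w - z) * (r * w - z)^*) =
  (R - r) * ((R * r - 1) * ((w + z) * (w + z)^*) +
             ((w * w^* - 1) + (1 - z * z^*)) * ((R + 1) * (r + 1))).
  by rewrite !(rmorphB, rmorphD, rmorphM) /= (conjr r) // (conjr R) //; ring.
apply: mulr_gt0; first by rewrite subr_gt0.
apply: ltr_wpDl.
  apply: mulr_ge0; last exact: mul_conjC_ge0.
  by rewrite subr_ge0 mulr_ege1 // (le_trans r1) // ltW.
apply: mulr_gt0; last exact: mulr_gt0.
by apply: ltr_wpDr; rewrite -?normC_le1 // -normC_gt1.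
Qed.

Lemma horner_multop_dilation n (R r ph : C) f w : (size f <= n.+1)%N ->
  (multop n (fun k => R ^+ k + ph * r ^+ k) f).[w] = f.[R * w] + ph * f.[r * w].
Proof.
move=> sf; rewrite horner_poly !(horner_coef_wide _ sf) mulr_sumr -big_split /=.
by apply: eq_bigr => k _; rewrite !exprMn; ring.
Qed.

Lemma dilation_zero_preserving n (R r ph : C) : (0 < n)%N -> 1 <= r -> r < R ->
  `|ph| <= ((R + 1) / (r + 1)) ^+ n ->
  zero_preserving n (fun k => R ^+ k + ph * r ^+ k).
Proof.
move=> n0 r1 rR phk.
have r0 : 0 < r by rewrite (lt_le_trans ltr01).
have R0 : 0 < R by exact: lt_trans rR.
have r10 : 0 < r + 1 by rewrite addr_gt0.
have R10 : 0 < R + 1 by rewrite addr_gt0.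
have q0 : 0 < (R + 1) / (r + 1) by exact: divr_gt0.
have lt_ne (x y : C) : `|y| < `|x| -> x + y != 0.
  by rewrite addr_eq0; apply: contraTneq => ->; rewrite normrN ltxx.
move=> f fI; split.
  rewrite size_multE // mulf_neq0 ?disc_rooted_coef_neq0 // lt_ne // normrM.
  apply: (@le_lt_trans _ _ (((R + 1) / (r + 1)) ^+ n * `|r ^+ n|)).
    by rewrite ler_wpM2r.
  rewrite !normrX -exprMn !gtr0_norm // ltrXn2r -?lt0n //.
    by rewrite mulr_ge0 ?ltW.
  rewrite mulrAC ltr_pdivrMr // mulrDl mulrDr mul1r mulr1 ltrD2l //.
move=> w; rewrite rootE => fw; rewrite real_leNgt //; apply/negP => w1.
move: fw; apply/negP; rewrite horner_multop_dilation ?fI.1 //.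
rewrite lt_ne // normrM.
apply: (@le_lt_trans _ _ (((R + 1) / (r + 1)) ^+ n * `|f.[r * w]|)).
  by rewrite ler_wpM2r.
have [s [ss fs sD]] := disc_rooted_factor fI.
rewrite fs !hornerZ !normrM mulrCA ltr_pM2l ?normr_gt0 ?disc_rooted_coef_neq0 //.
rewrite !horner_prod -ss.
have -> : ((R + 1) / (r + 1)) ^+ size s * `|\prod_(z <- s) ('X - z%:P).[r * w]| =
   `|\prod_(z <- s) ((R + 1) / (r + 1) * (r * w - z))|.
  rewrite big_split /= normrM; congr (_ * _).
    by rewrite big_const_seq count_predT iter_mulr_1 ger0_norm // exprn_ge0 ?ltW.
  by congr (`|_|); apply: eq_bigr => z _; rewrite hornerXsubC.
have fac z : z \in s -> `|(R + 1) / (r + 1) * (r * w - z)| < `|('X - z%:P).[R * w]|.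
  move=> /sD z1; rewrite hornerXsubC normrM (gtr0_norm q0).
  exact: dilation_factor.
apply: ltr_prod_seq.
- by move=> z /fac/ltW.
- by move=> z /fac; apply: le_lt_trans.
- case: s ss fac {fs sD} => [n00|z s _ fac]; first by rewrite -n00 in n0.
  by exists z; rewrite ?mem_head // fac ?mem_head.
Qed.

Lemma zero_preserving_comp n e e' : zero_preserving n e -> zero_preserving n e' ->
  zero_preserving n (fun k => e k * e' k).
Proof.
move=> eI eI' f fI.
have -> : multop n (fun k => e k * e' k) f = multop n e (multop n e' f).
  by apply/polyP => k; rewrite !coef_multop; case: ifP => // _; rewrite mulrA.
exact/eI/eI'.
Qed.

End Operators.

(** * Comparison with the reciprocal polynomial *)

Section MoreMultipliers.
Variable C : numClosedFieldType.
Implicit Types (f g : {poly C}) (e : nat -> C) (w z : C).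

(** The constant 1 is dominated by X^n outside the disc. *)
Lemma zero_preserving_coef_le n e : zero_preserving n e -> `|e 0%N| <= `|e n|.
Proof.
move=> eI.
have XI : disc_rooted n ('X^n : {poly C}).
  by have := @disc_rooted_XsubC_exp C n 0; rewrite subr0 normr0 => /(_ ler01).
have := multop_comparison eI XI (g := 1) _ _ _ (w := 1).
rewrite size_poly1 coef1 coefXn eqxx normr1 => /(_ isT) H.
have {}H := H _ _ (lexx _).
have -> : e 0%N = (multop n e 1).[1].
  rewrite horner_poly big_ord_recl /= coef1 !mulr1 big1 ?addr0 // => i _.
  by rewrite coef1 mulr0 mul0r.
have -> : e n = (multop n e 'X^n).[1].
  rewrite horner_poly (bigD1 ord_max) //= coefXn eqxx expr1n !mulr1 big1 ?addr0 // => i.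
  by rewrite -val_eqE /= => /negPf; rewrite coefXn => ->; rewrite mulr0 mul0r.
apply: H; first by case: (n) => [|k]; rewrite /= ?normr1 ?normr0.
by move=> w w1; rewrite hornerC hornerXn normr1 normrX exprn_ege1 // ltW.
Qed.

Lemma size_recip n f : (size (recip n f) <= n.+1)%N.
Proof. exact: size_poly. Qed.

Lemma coef_recip n f k : (k <= n)%N -> (recip n f)`_k = (f`_(n - k))^*.
Proof. by move=> kn; rewrite coef_poly ltnS kn. Qed.

Lemma recipK n f : (size f <= n.+1)%N -> recip n (recip n f) = f.
Proof.
move=> sf; apply/polyP => k; have [kn|kn] := leqP k n.
  by rewrite coef_recip // coef_recip ?leq_subr // subKn // conjCK.
by rewrite !nth_default // (leq_trans _ kn) // size_recip.
Qed.

Lemma recip_disc_rooted n f : size f = n.+1 -> (forall z, `|z| < 1 -> f.[z] != 0) ->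
  disc_rooted n (recip n f).
Proof.
move=> sf fD; split.
  rewrite size_poly_eq // subnn conjC_eq0 -horner_coef0.
  by apply: fD; rewrite normr0 ltr01.
move=> w /rootP w0; rewrite real_leNgt //; apply/negP => w1.
have wn0 : w != 0 by rewrite -normr_gt0 (lt_trans ltr01).
move: w0; rewrite horner_recip ?sf // => /eqP; rewrite mulf_eq0 expf_eq0 (negPf wn0) andbF /=.
rewrite conjC_eq0; apply/negP; apply: fD.
by rewrite normfV norm_conjC invf_lt1 // (lt_trans ltr01).
Qed.

(** A polynomial without zeros in the open disc is dominated outside the disc by
its reciprocal polynomial, whose zeros are in the closed disc. *)
Lemma recip_comparison n e f w : zero_preserving n e -> size f = n.+1 ->
  (forall z, `|z| < 1 -> f.[z] != 0) -> 1 <= `|w| ->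
  `|(multop n e f).[w]| <= `|(multop n e (recip n f)).[w]|.
Proof.
move=> eI sf fD w1; have RI := recip_disc_rooted sf fD.
apply: (multop_comparison eI RI) => //; first by rewrite sf.
  have := recip_coef_le RI; rewrite !coef_recip // subn0 subnn !norm_conjC.
  by rewrite -[X in _ <= X]norm_conjC.
move=> z z1; have := recip_le RI (ltW z1).
by rewrite recipK // sf.
Qed.

End MoreMultipliers.

Local Open Scope classical_set_scope.
Local Open Scope ring_scope.
Local Open Scope complex_scope.

(** * Integrals of periodic functions *)

Section Circle.
Variable K : realType.
Local Notation mu := (@lebesgue_measure K).
Local Notation twopi := (2 * pi : K).

Lemma twopi_gt0 : 0 < twopi.
Proof. by rewrite mulr_gt0 // pi_gt0. Qed.

Lemma continuous_affine (c k : K) : continuous (fun x : K => c * x + k).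
Proof.
move=> x; apply: continuousD; last exact: cst_continuous.
by apply: continuousM; [exact: cst_continuous|exact: cvg_id].
Qed.

Lemma integral_affine (g : K -> K) (c k b : K) : 0 < c -> 0 <= b -> continuous g ->
  (\int[mu]_(x in `[k, (c * b + k)%R]) (g x)%:E =
   \int[mu]_(x in `[0%R, b]) (g (c * x + k)%R * c)%:E)%E.
Proof.
move=> c0 b0 cg.
have dF (x : K) : is_derive x 1 (fun x : K => c * x + k) c.
  by apply: is_derive_eq; rewrite addr0; exact: mulr1.
have F' : derive1 (fun x : K => c * x + k) = cst c.
  by apply/funext => x; rewrite derive1E derive_val.
have := @integration_by_substitution_increasing K (fun x => c * x + k) g 0 b b0.
rewrite mulr0 add0r F' => ->.
- by [].
- by move=> x y _ _ xy; rewrite ltrD2r ltr_pM2l.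
- by move=> x _; exact: cst_continuous.
- exact: is_cvg_cst.
- exact: is_cvg_cst.
- split; first by move=> x _; exact: ex_derive.
  + by apply: cvg_at_right_filter; exact: continuous_affine.
  + by apply: cvg_at_left_filter; exact: continuous_affine.
- exact: continuous_subspaceT.
Qed.

Lemma continuous_integrable (g : K -> K) (a b : K) : continuous g ->
  mu.-integrable `[a, b] (EFin \o g).
Proof.
move=> cg; apply: continuous_compact_integrable; first exact: segment_compact.
exact: continuous_subspaceT.
Qed.

Lemma Rintegral_split (g : K -> K) (a b c : K) : continuous g -> a <= b -> b <= c ->
  \int[mu]_(x in `[a, c]) g x =
  \int[mu]_(x in `[a, b]) g x + \int[mu]_(x in `[b, c]) g x.
Proof.
move=> cg ab bc.
have := @Rintegral_itvB K g (BLeft a) (BRight c) b.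
move=> /(_ (continuous_integrable a c cg)); rewrite !bnd_simp => /(_ ab bc).
rewrite Rintegral_itv_obnd_cbnd; last first.
  by apply: (integrableS _ _ _ (continuous_integrable b c cg)) => //; exact: subset_itv_oc_cc.
by move=> <-; rewrite addrC subrK.
Qed.

Lemma Rintegral_affine (g : K -> K) (c k b : K) : 0 < c -> 0 <= b -> continuous g ->
  \int[mu]_(x in `[k, c * b + k]) g x =
   c * \int[mu]_(x in `[0, b]) g (c * x + k).
Proof.
move=> c0 b0 cg; rewrite /Rintegral integral_affine //.
rewrite -[RHS]/(c * Rintegral _ _ _) -RintegralZl //.
  by rewrite /Rintegral; under eq_integral do rewrite mulrC.
apply: (@continuous_integrable (fun x => g (c * x + k))) => x.
apply: (@continuous_comp _ _ _ (fun x : K => c * x + k)); last exact: cg.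
exact: continuous_affine.
Qed.

Lemma Rintegral_rotation (g : K -> K) (k : K) : continuous g ->
  periodic g twopi -> 0 <= k <= twopi ->
  \int[mu]_(x in `[0, twopi]) g (x + k) = \int[mu]_(x in `[0, twopi]) g x.
Proof.
move=> cg pg /andP[k0 k2].
have p0 := ltW twopi_gt0.
transitivity (\int[mu]_(x in `[k, twopi + k]) g x).
  have := Rintegral_affine k ltr01 p0 cg; rewrite !mul1r => ->.
  by apply: eq_Rintegral => x _; rewrite mul1r.
rewrite (Rintegral_split cg k2) ?lerDl //.
rewrite (Rintegral_split cg k0 k2) addrC; congr (_ + _).
have := Rintegral_affine twopi ltr01 k0 cg; rewrite !mul1r addrC => ->.
by apply: eq_Rintegral => x _; rewrite mul1r pg.
Qed.

Lemma Rintegral_multiple (g : K -> K) n : continuous g -> periodic g twopi ->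
  \int[mu]_(x in `[0, n%:R * twopi]) g x = n%:R * \int[mu]_(x in `[0, twopi]) g x.
Proof.
move=> cg pg; have p0 := ltW twopi_gt0.
elim: n => [|n IH]; first by rewrite !mul0r set_itv1 Rintegral_set1.
have e : n.+1%:R * twopi = n%:R * twopi + twopi by rewrite -[n.+1%:R]natr1 (mulrDl _ _ twopi) mul1r.
rewrite e (@Rintegral_split g 0 (n%:R * twopi)) ?lerDl ?(mulr_ge0 _ p0) //.
rewrite IH -[n.+1%:R]natr1 (mulrDl n%:R 1 (Rintegral _ _ _)) mul1r.
congr (_ + _).
have := Rintegral_affine (n%:R * twopi) ltr01 p0 cg; rewrite !mul1r addrC => ->.
apply: eq_Rintegral => x _; rewrite mul1r.
elim: n {IH e} x => [|n IH] x; first by rewrite mul0r addr0.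
by rewrite -[n.+1%:R]natr1 (mulrDl _ _ twopi) mul1r addrA pg IH.
Qed.

Lemma Rintegral_scale (g : K -> K) n : (0 < n)%N -> continuous g -> periodic g twopi ->
  \int[mu]_(x in `[0, twopi]) g (n%:R * x) = \int[mu]_(x in `[0, twopi]) g x.
Proof.
move=> n0 cg pg; have p0 := ltW twopi_gt0.
have n0' : 0 < n%:R :> K by rewrite ltr0n.
have := Rintegral_affine 0 n0' p0 cg; rewrite addr0 Rintegral_multiple //.
move=> /mulfI -> //; last by rewrite gt_eqF.
by apply: eq_Rintegral => x _; rewrite addr0.
Qed.

(** A probability, so that integrals are means and integrals over pairs need no
restriction to a square. *)
Definition circle : probability (measurableTypeR K) K := uniform_prob twopi_gt0.

End Circle.

(** * Means over the circle and Jensen's formula away from the zeros *)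

Section Jensen.
Variable K : realType.
Local Notation mu := (@lebesgue_measure K).
Local Notation twopi := (2 * pi : K).
Local Notation circle := (circle K).
Implicit Types (g h : K -> K).

(** Finiteness of the positive part excludes an indeterminate difference; it holds
for the logarithms of moduli, which are bounded above. *)
Lemma circle_integralE (f : K -> \bar K) : measurable_fun setT f ->
  (\int[mu]_(x in `[0%R, twopi]) f^\+ x < +oo)%E ->
  (\int[circle]_x f x = (twopi^-1)%:E * \int[mu]_(x in `[0%R, twopi]) f x)%E.
Proof.
move=> mf fp; rewrite integralE [in RHS]integralE.
have U (u : K -> \bar K) : measurable_fun setT u -> (forall x, 0 <= u x)%E ->
    (\int[circle]_x u x = (twopi^-1)%:E * \int[mu]_(x in `[0%R, twopi]) u x)%E.
  by move=> mh h0; rewrite integral_uniform // subr0.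
rewrite (U f^\+%E) //; last exact: measurable_funepos.
rewrite (U f^\-%E) //; last exact: measurable_funeneg.
rewrite [RHS]muleDr ?muleN //.
rewrite -ge0_fin_numE ?integral_ge0 // in fp.
by rewrite fin_num_adde_defr.
Qed.

Definition cmean g : K := twopi^-1 * \int[mu]_(x in `[0, twopi]) g x.

Lemma continuous_measurable g : continuous g -> measurable_fun setT g.
Proof. exact: continuous_measurable_fun. Qed.

Lemma continuous_emeasurable g : continuous g -> measurable_fun setT (EFin \o g).
Proof. by move=> cg; apply/measurable_EFinP; exact: continuous_measurable. Qed.

Lemma circle_continuous g : continuous g ->
  (\int[circle]_x (g x)%:E = (cmean g)%:E)%E.
Proof.
move=> cg; have ig := continuous_integrable 0 twopi cg.
rewrite circle_integralE; first last.
- have /integrableP[_] := ig; apply: le_lt_trans.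
  apply: ge0_le_integral => //.
  + apply: measurable_funTS; apply: measurable_funepos.
    exact: continuous_emeasurable.
  + apply: measurable_funTS; apply: measurableT_comp => //.
    exact: continuous_emeasurable.
  + move=> x _; rewrite funeposE; case: (leP 0%R (g x)) => gx.
      by rewrite max_l ?lee_fin //= ger0_norm.
    by rewrite max_r ?lee_fin //= ltW.
- exact: continuous_emeasurable.
rewrite EFinM /Rintegral fineK //.
exact: integrable_fin_num.
Qed.

Lemma circle_integrable g : continuous g -> circle.-integrable setT (EFin \o g).
Proof.
move=> cg; apply/integrableP; split; first exact: continuous_emeasurable.
have cn : continuous (fun x => `|g x|).
  by move=> x; apply: (@cvg_comp _ _ _ g Num.norm); [exact: cg|exact: norm_continuous].
apply: (@le_lt_trans _ _ (\int[circle]_x (`|g x|)%:E)%E) => //.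
by rewrite (circle_continuous cn) ltry.
Qed.

Lemma eq_cmean g h : g =1 h -> cmean g = cmean h.
Proof. by move=> gh; rewrite /cmean (_ : g = h) //; exact/funext. Qed.

Lemma cmeanD g h : continuous g -> continuous h ->
  cmean (fun x => g x + h x) = cmean g + cmean h.
Proof.
move=> cg ch; rewrite /cmean RintegralD ?mulrDr //; exact: continuous_integrable.
Qed.

Lemma cmean_cst c : cmean (fun=> c) = c.
Proof.
rewrite /cmean Rintegral_cst //= lebesgue_measure_itv /= lte_fin twopi_gt0.
by rewrite oppr0 addr0 /= mulrCA mulVf ?mulr1 // gt_eqF // twopi_gt0.
Qed.

Lemma le_cmean g h : continuous g -> continuous h -> (forall x, g x <= h x) ->
  cmean g <= cmean h.
Proof.
move=> cg ch gh; rewrite /cmean ler_wpM2l //.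
  by rewrite invr_ge0 ltW // twopi_gt0.
by apply: le_Rintegral => //; exact: continuous_integrable.
Qed.

Lemma cmeanZ c g : continuous g -> cmean (fun x => c * g x) = c * cmean g.
Proof.
move=> cg; rewrite /cmean RintegralZl 1?mulrCA //.
exact: continuous_integrable.
Qed.

Lemma cmean_rotation g k : continuous g -> periodic g twopi -> 0 <= k <= twopi ->
  cmean (fun x => g (x + k)) = cmean g.
Proof. by move=> cg pg kp; rewrite /cmean Rintegral_rotation. Qed.

Lemma cmean_scale g n : (0 < n)%N -> continuous g -> periodic g twopi ->
  cmean (fun x => g (n%:R * x)) = cmean g.
Proof. by move=> n0 cg pg; rewrite /cmean Rintegral_scale. Qed.

Lemma cos_periodic : periodic (@cos K) twopi.
Proof. by move=> x; rewrite mulr_natl cosD2pi. Qed.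

Lemma sin_periodic : periodic (@sin K) twopi.
Proof. by move=> x; rewrite mulr_natl sinD2pi. Qed.

Lemma continuous_cos_kernel (a b k : K) : continuous (fun x : K => a + b * cos (x + k)).
Proof.
move=> x; apply: cvgD; first exact: cvg_cst.
apply: cvgM; first exact: cvg_cst.
apply: (@continuous_comp _ _ _ (fun x : K => x + k) cos); last exact: continuous_cos.
by apply: cvgD; [exact: cvg_id|exact: cvg_cst].
Qed.

Lemma continuous_ln_comp g : continuous g -> (forall x, 0 < g x) ->
  continuous (fun x => ln (g x)).
Proof.
move=> cg g0 x; apply: (@continuous_comp _ _ _ g (@ln K)); first exact: cg.
exact: continuous_ln.
Qed.

Let q (rho x : K) := 1 + rho ^+ 2 + 2 * rho * cos x.

Lemma cos_kernel_bounds rho x : (1 - `|rho|) ^+ 2 <= q rho x <= (1 + `|rho|) ^+ 2.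
Proof.
have r2 : rho ^+ 2 = `|rho| ^+ 2 by rewrite -normrX ger0_norm // sqr_ge0.
have : `|rho * cos x| <= `|rho| by rewrite normrM ler_piMr // cos_max.
rewrite ler_norml => /andP[h1 h2]; rewrite /q r2 -mulrA.
apply/andP; split; lra.
Qed.

Lemma cos_kernel_gt0 rho x : `|rho| < 1 -> 0 < q rho x.
Proof.
move=> r1; have /andP[+ _] := cos_kernel_bounds rho x; apply: lt_le_trans.
by rewrite exprn_gt0 // subr_gt0.
Qed.

Lemma continuous_q rho : continuous (q rho).
Proof.
by have := @continuous_cos_kernel (1 + rho ^+ 2) (2 * rho) 0; under eq_fun do rewrite addr0.
Qed.

Lemma continuous_ln_q rho : `|rho| < 1 -> continuous (fun x => ln (q rho x)).
Proof.
move=> r1; apply: continuous_ln_comp; first exact: continuous_q.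
by move=> x; exact: cos_kernel_gt0.
Qed.

(** (1 + rho^2 + 2 rho cos x)(1 + rho^2 - 2 rho cos x) is the same kernel for
- rho^2 at the angle 2 x, and the second factor is the first one rotated by
pi. *)
Lemma cmean_ln_q_doubling rho : `|rho| < 1 ->
  cmean (fun x => ln (q rho x)) *+ 2 = cmean (fun x => ln (q (- rho ^+ 2) x)).
Proof.
move=> r1; have r1N : `|- rho| < 1 by rewrite normrN.
have r2 : `|- rho ^+ 2| < 1 by rewrite normrN normrX expr_lt1.
have per s : periodic (fun x => ln (q s x)) twopi.
  by move=> x; rewrite /q cos_periodic.
rewrite -(@cmean_scale (fun x => ln (q (- rho ^+ 2) x)) 2) //; last exact: continuous_ln_q.
have eN : cmean (fun x => ln (q (- rho) x)) = cmean (fun x => ln (q rho x)).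
  rewrite -(@cmean_rotation (fun x => ln (q rho x)) pi) //.
  - by apply: eq_cmean => x; rewrite /q cosDpi; congr ln; ring.
  - exact: continuous_ln_q.
  - by rewrite pi_ge0 /= ler_peMl ?pi_ge0 // ler1n.
rewrite mulr2n -{2}eN -cmeanD; [|exact: continuous_ln_q..].
apply: eq_cmean => x.
rewrite -lnM ?posrE ?cos_kernel_gt0 //; congr ln.
by rewrite /q (mulr_natl x 2) cos_mulr2n; ring.
Qed.

(** Jensen's formula for a point rho off the circle: k doublings multiply the mean
by 2^k while |rho| does not grow, so that the mean stays bounded. *)
Lemma cmean_ln_q rho : `|rho| < 1 -> cmean (fun x => ln (q rho x)) = 0.
Proof.
move=> r1; pose B := Num.max `|ln ((1 - `|rho|) ^+ 2)| (ln 4).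
have HB k s : `|s| <= `|rho| -> `|cmean (fun x => ln (q s x))| *+ 2 ^ k <= B.
  elim: k s => [|k IH] s sr.
    rewrite expn0 mulr1n ler_norml.
    have s1 := le_lt_trans sr r1.
    have sq0 : 0 < (1 - `|rho|) ^+ 2 by rewrite exprn_gt0 // subr_gt0.
    have bd x : - B <= ln (q s x) <= B.
      have /andP[h1 h2] := cos_kernel_bounds s x.
      have q0 := cos_kernel_gt0 x s1.
      apply/andP; split; last first.
        apply: (@le_trans _ _ (ln 4)); last by rewrite le_max lexx orbT.
        rewrite ler_ln ?posrE // (le_trans h2) //.
        by have := normr_ge0 s; nra.
      rewrite lerNl (@le_trans _ _ (- ln ((1 - `|rho|) ^+ 2))) //.
        rewrite lerN2 ler_ln ?posrE // (le_trans _ h1) //.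
        by move: s1 sr (normr_ge0 s) (normr_ge0 rho) r1; nra.
      by rewrite (le_trans (ler_norm _)) // normrN le_max lexx.
    rewrite -{1}(cmean_cst (- B)) -{2}(cmean_cst B).
    apply/andP; split; apply: le_cmean => //; try exact: cst_continuous; try exact: continuous_ln_q.
    - by move=> x; case/andP: (bd x).
    - by move=> x; case/andP: (bd x).
  have s1 := le_lt_trans sr r1.
  rewrite expnS mulrnA -normrMn cmean_ln_q_doubling // IH // normrN normrX.
  by rewrite (le_trans _ sr) // expr2 ler_piMr // ltW.
apply/eqP; rewrite -normr_eq0 eq_le normr_ge0 andbT leNgt; apply/negP => J0.
have B0 : 0 <= B by rewrite le_max normr_ge0.
set J := `|_| in J0; have := HB (Num.bound (B / J)) rho (lexx _).
rewrite -/J -[X in X <= _]mulr_natl natrX leNgt => /negP; apply.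
by rewrite -ltr_pdivrMr //; apply: upper_nthrootP.
Qed.

End Jensen.

(** * Jensen's formula with a zero on the circle *)

Section JensenLinear.
Variable K : realType.
Local Notation twopi := (2 * pi : K).
Local Notation circle := (circle K).
Implicit Types (g h : K -> K) (k : K).

Lemma measurable_lne_comp g : measurable_fun setT g ->
  measurable_fun setT (fun x => lne (g x)%:E).
Proof.
move=> mg; rewrite (_ : (fun x => _) = (fun x => if g x <= 0 then -oo%E else (ln (g x))%:E)) //.
apply: measurable_fun_ifT.
- by apply: measurable_fun_ler => //; exact: measurable_cst.
- exact: measurable_cst.
- apply/measurable_EFinP; apply: measurableT_comp => //; exact: measurable_ln.
Qed.

Let c k x : K := 2 + 2 * cos (x + k).
Let rho j : K := j.+1%:R / j.+2%:R.
Let eps j : K := (j.+1%:R * j.+2%:R)^-1.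

Let c_ge0 k x : 0 <= c k x.
Proof. by have := cos_geN1 (x + k); rewrite /c; lra. Qed.

Let c_le4 k x : c k x <= 4.
Proof. by have := cos_le1 (x + k); rewrite /c; lra. Qed.

Let eps_gt0 j : 0 < eps j.
Proof. by rewrite invr_gt0 mulr_gt0. Qed.

Let eps_le1 j : eps j <= 1.
Proof. by rewrite invf_le1 ?mulr_gt0 // -natrM ler1n. Qed.

Let eps_harmonic j : eps j <= harmonic j.
Proof.
rewrite /eps /harmonic /= lef_pV2 ?posrE ?mulr_gt0 //.
by rewrite ler_peMr // ler1n.
Qed.

Let eps_mono i j : (i <= j)%N -> eps j <= eps i.
Proof.
move=> ij; rewrite /eps lef_pV2 ?posrE ?mulr_gt0 //.
by rewrite -!natrM ler_nat leq_mul.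
Qed.

(** 2 + 2 cos + eps_j is the kernel of parameter rho_j divided by rho_j. *)
Let cmean_ln_c_eps k j : 0 <= k <= twopi ->
  cmean (fun x => ln (c k x + eps j)) = - ln (rho j).
Proof.
move=> kp.
have j1 : 0 < j.+1%:R :> K by [].
have j2 : 0 < j.+2%:R :> K by [].
have rho0 : 0 < rho j by rewrite divr_gt0.
have rho1 : `|rho j| < 1 by rewrite gtr0_norm // /rho ltr_pdivrMr // mul1r ltr_nat.
have j12 : j.+2%:R = j.+1%:R + 1 :> K by rewrite -natr1.
have qE x : c k x + eps j = (1 + rho j ^+ 2 + 2 * rho j * cos (x + k)) / rho j.
  rewrite /c /eps /rho j12.
  move: j1 => {j2 rho0 rho1 j12}; move: (j.+1%:R) => u u0.
  by field; apply/andP; split; lra.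
have cq := continuous_ln_q rho1.
have crot : continuous (fun x => ln (1 + rho j ^+ 2 + 2 * rho j * cos (x + k))).
  apply: continuous_ln_comp; first exact: continuous_cos_kernel.
  by move=> x; exact: cos_kernel_gt0.
transitivity (cmean (fun x => ln (1 + rho j ^+ 2 + 2 * rho j * cos (x + k)) + (- ln (rho j)))).
  apply: eq_cmean => x; rewrite qE ln_div ?posrE //.
  exact: cos_kernel_gt0.
rewrite cmeanD //; last exact: cst_continuous.
rewrite cmean_cst (@cmean_rotation _ (fun x => ln (1 + rho j ^+ 2 + 2 * rho j * cos x))) //.
  by rewrite cmean_ln_q // add0r.
by move=> x; rewrite cos_periodic.
Qed.

Let g k j x : \bar K := (ln 5 - ln (c k x + eps j))%:E.

Let c_eps_gt0 k j x : 0 < c k x + eps j.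
Proof. exact: ltr_wpDl. Qed.

Let continuous_c_eps k j : continuous (fun x => ln 5 - ln (c k x + eps j)).
Proof.
move=> x; apply: cvgB; first exact: cvg_cst.
move: x; apply: continuous_ln_comp => // x; apply: cvgD; last exact: cvg_cst.
exact: continuous_cos_kernel.
Qed.

Let integral_g k j : 0 <= k <= twopi ->
  (\int[circle]_x g k j x = (ln 5 + ln (rho j))%:E)%E.
Proof.
move=> kp; rewrite /g (circle_continuous (@continuous_c_eps k j)).
congr (_%:E); rewrite -[ln (rho j)]opprK -(cmean_ln_c_eps _ kp).
have cl : continuous (fun x => ln (c k x + eps j)).
  apply: continuous_ln_comp => // x; apply: cvgD; last exact: cvg_cst.
  exact: continuous_cos_kernel.
rewrite -mulN1r -cmeanZ // -{2}(cmean_cst (ln 5)) -cmeanD.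
- by apply: eq_cmean => x; rewrite mulN1r.
- exact: cst_continuous.
- by move=> x; apply: cvgM; [exact: cvg_cst|exact: cl].
Qed.

Let cvg_eps : eps j @[j --> \oo] --> (0 : K).
Proof.
apply: (@squeeze_cvgr _ _ _ _ (cst 0) (@harmonic K)).
- by apply: nearW => j; rewrite (ltW (eps_gt0 j)) eps_harmonic.
- exact: cvg_cst.
- exact: cvg_harmonic.
Qed.

Let cvg_ln_rho : ln (rho j) @[j --> \oo] --> (0 : K).
Proof.
rewrite -(@ln1 K); apply: (@continuous_cvg _ _ _ _ _ rho (@ln K) 1).
  exact: continuous_ln.
have -> : rho = fun j => 1 - [sequence harmonic n.+1]_n j.
  apply/funext => j; rewrite /rho /harmonic /=.
  have -> : j.+1%:R = j.+2%:R - 1 :> K by rewrite -[j.+2%:R]natr1 addrK.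
  by rewrite mulrBl divff // mul1r.
rewrite -[X in _ --> X]subr0; apply: cvgB; first exact: cvg_cst.
rewrite cvg_shiftS; exact: cvg_harmonic.
Qed.

Let cvg_g k x : g k j x @[j --> \oo] --> ((ln 5)%:E - lne (c k x)%:E)%E.
Proof.
have [c0|c0] := ltP 0 (c k x).
  rewrite lne_EFin // -EFinB; apply: cvg_EFin; first exact: nearW.
  apply: cvgB; first exact: cvg_cst.
  apply: (@continuous_cvg _ _ _ _ _ (fun j => c k x + eps j) (@ln K) (c k x)).
    exact: continuous_ln.
  rewrite -[X in _ --> X]addr0; apply: cvgD; first exact: cvg_cst.
  exact: cvg_eps.
have cE : c k x = 0 by apply/eqP; rewrite eq_le c0 c_ge0.
rewrite le0_lneNy ?lee_fin //= addey //.
apply/cvgeyPge => A; near=> j.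
rewrite /g cE add0r lee_fin /eps lnV ?posrE ?mulr_gt0 // opprK.
apply: (@le_trans _ _ (ln j.+1%:R)).
  rewrite -[A]expRK ler_ln ?posrE ?expR_gt0 //.
  apply: (@le_trans _ _ j%:R); last by rewrite ler_nat.
  by near: j; exact: nbhs_infty_ger.
rewrite lnM ?posrE // addrC -addrA lerDl addr_ge0 // ln_ge0 // ler1n //.
Unshelve. all: by end_near. Qed.

(** The singular kernel 2 + 2 cos is the decreasing limit of the regular kernels
2 + 2 cos + eps_j, whose logarithmic means - ln rho_j tend to 0; integrability
comes out of the same monotone limit. *)
Lemma jensen_cos1 k : 0 <= k <= twopi ->
  circle.-integrable setT (fun x => lne (2 + 2 * cos (x + k))%:E) /\
  (\int[circle]_x lne (2 + 2 * cos (x + k))%:E = 0)%E.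
Proof.
move=> kp.
have mg j : measurable_fun setT (g k j).
  by apply: continuous_emeasurable; exact: continuous_c_eps.
have g0 j x : setT x -> (0 <= g k j x)%E.
  move=> _; rewrite lee_fin subr_ge0 ler_ln ?posrE // .
  by have := c_le4 k x; have := eps_le1 j; lra.
have ndg x : setT x -> nondecreasing_seq (g k ^~ x).
  move=> _ i j ij; rewrite lee_fin lerD2l lerN2 ler_ln ?posrE //.
  by rewrite lerD2l eps_mono.
(* 5 bounds 2 + 2 cos + eps_j, so that h and the g_j are nonnegative. *)
pose h x : \bar K := ((ln 5)%:E - lne (c k x)%:E)%E.
have hE x : h x = limn (g k ^~ x) by apply/esym/cvg_lim => //; exact: cvg_g.
have h0 x : (0 <= h x)%E.
  rewrite hE; apply: lime_ge; first by apply/cvg_ex; exists (h x); exact: cvg_g.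
  by apply: nearW => j; exact: g0.
have mc : measurable_fun setT (fun x => lne (c k x)%:E).
  by apply: measurable_lne_comp; apply: continuous_measurable; exact: continuous_cos_kernel.
have mh : measurable_fun setT h by apply: emeasurable_funB.
have ih : (\int[circle]_x h x = (ln 5)%:E)%E.
  transitivity (\int[circle]_x limn (g k ^~ x))%E.
    by apply: eq_integral => x _; exact: hE.
  etransitivity; first exact: (@monotone_convergence _ _ _ circle setT measurableT (g k) mg g0 ndg).
  under eq_fun do rewrite integral_g //.
  apply/cvg_lim => //; apply: cvg_EFin; first exact: nearW.
  rewrite -[X in _ --> X]addr0; apply: cvgD; first exact: cvg_cst.
  exact: cvg_ln_rho.
have inth : circle.-integrable setT h.
  apply/integrableP; split=> //.
  under eq_integral do rewrite gee0_abs //.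
  by rewrite ih ltry.
have intl : circle.-integrable setT (cst (ln 5)%:E).
  exact: finite_measure_integrable_cst.
have lneE x : lne (c k x)%:E = ((ln 5)%:E - h x)%E.
  rewrite /h; case: (lne _) => [r| |] //=.
  by rewrite -!EFinB; congr (_%:E); ring.
rewrite -/(c k _); split.
  rewrite (_ : (fun x => _) = (fun x => (cst (ln 5)%:E x - h x)%E)); last first.
    by apply/funext => x; exact: lneE.
  exact: integrableB.
transitivity (\int[circle]_x (cst (ln 5)%:E \- h) x)%E.
  by apply: eq_integral => x _; exact: lneE.
etransitivity; first exact: (@integralB _ _ _ circle setT measurableT _ _ intl inth).
rewrite ih integral_cst //= probability_setT mule1.
by rewrite -EFinB subrr.
Qed.

End JensenLinear.

(** * Jensen's formula for products of linear factors *)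

Section JensenComplex.
Variable K : realType.
Local Notation twopi := (2 * pi : K).
Local Notation circle := (circle K).
Local Notation C := (K[i]).
Implicit Types (g h : K -> K) (k : K).

Lemma polar_coordinates (p q m : K) : 0 <= m -> p ^+ 2 + q ^+ 2 = m ^+ 2 ->
  exists k, [/\ 0 <= k <= twopi, p = m * cos k & q = m * sin k].
Proof.
rewrite le_eqVlt => /predU1P[<-|m0].
  rewrite expr0n /= => /eqP; rewrite paddr_eq0 ?sqr_ge0 // !sqrf_eq0 => /andP[/eqP -> /eqP ->].
  by exists 0; rewrite lexx ltW ?twopi_gt0 // !mul0r.
move=> pq; have mn0 : m != 0 by rewrite gt_eqF.
pose x := p / m; pose y := q / m.
have xy : x ^+ 2 + y ^+ 2 = 1 by rewrite /x /y !expr_div_n -mulrDl pq divff // expf_neq0.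
have x1 : -1 <= x <= 1.
  by rewrite -ler_norml -(@expr_le1 _ 2) // -normrX ger0_norm ?sqr_ge0 // -xy lerDl sqr_ge0.
have ac := acosK (_ : x \in `[(-1), 1]).
have {}ac : cos (acos x) = x by apply: ac; rewrite in_itv.
have as1 : sin (acos x) = `|y|.
  by rewrite sin_acos // -xy addrAC subrr add0r sqrtr_sqr.
have a0 := acos_ge0 x1; have api := acos_lepi x1.
have pE : p = m * x by rewrite /x mulrC divfK.
have qE : q = m * y by rewrite /y mulrC divfK.
have [y0|y0] := leP 0 y.
  exists (acos x); rewrite ac as1 (ger0_norm y0); split=> //.
  by rewrite a0 (le_trans api) // ler_peMl ?pi_ge0 // ler1n.
exists (twopi - acos x); split.
- rewrite subr_ge0 (le_trans api) ?ler_peMl ?pi_ge0 ?ler1n //=.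
  by rewrite lerBlDr lerDl.
- by rewrite addrC cos_periodic cosN ac.
- by rewrite addrC sin_periodic sinN as1 ltr0_norm // opprK.
Qed.

Lemma norm_normc (z : C) : `|z| = (normc z)%:C.
Proof. by []. Qed.

Lemma normc_sqr (x y : K) : normc (x +i* y) ^+ 2 = x ^+ 2 + y ^+ 2.
Proof. by rewrite /= sqr_sqrtr // addr_ge0 ?sqr_ge0. Qed.

Lemma normc_ge0 (z : C) : 0 <= normc z.
Proof. by case: z => x y; exact: sqrtr_ge0. Qed.

Lemma le_normc (z w : C) : (normc z <= normc w) = (`|z| <= `|w|).
Proof. by rewrite !norm_normc lecR. Qed.

Lemma normc_real (x : K) : normc x%:C = `|x|.
Proof. by rewrite /= expr0n /= addr0 sqrtr_sqr. Qed.

Lemma normc_eq0 (z : C) : (normc z == 0) = (z == 0).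
Proof.
apply/eqP/eqP => [|->]; first exact: ComplexField.Normc.eq0_normc.
by rewrite ComplexField.Normc.normc0.
Qed.

Lemma normc_gt0 (z : C) : (0 < normc z) = (z != 0).
Proof. by rewrite lt_def normc_ge0 andbT normc_eq0. Qed.

Lemma normc_expi (x : K) : normc (expi x) = 1.
Proof. by rewrite /expi /= cos2Dsin2 sqrtr1. Qed.

Lemma norm_expi (x : K) : `|expi x| = 1 :> C.
Proof. by rewrite norm_normc normc_expi. Qed.

Lemma normc_linear_expi (a b : C) : exists2 k, 0 <= k <= twopi &
  forall x, normc (a + b * expi x) ^+ 2 =
    normc a ^+ 2 + normc b ^+ 2 + 2 * (normc a * normc b) * cos (x + k).
Proof.
case: a => a1 a2; case: b => b1 b2.
have [||k [kp h1 h2]] := @polar_coordinates (a1 * b1 + a2 * b2) (a1 * b2 - a2 * b1)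
   (normc (a1 +i* a2) * normc (b1 +i* b2)).
- by rewrite mulr_ge0 ?normc_ge0.
- by rewrite exprMn !normc_sqr; ring.
exists k => // x.
have -> : (a1 +i* a2) + (b1 +i* b2) * expi x =
   (a1 + (b1 * cos x - b2 * sin x)) +i* (a2 + (b1 * sin x + b2 * cos x)) by [].
rewrite !normc_sqr cosD.
move: (normc (a1 +i* a2) * normc (b1 +i* b2)) h1 h2 => M h1 h2.
have -> : 2 * M * (cos x * cos k - sin x * sin k) =
  2 * (cos x * (M * cos k) - sin x * (M * sin k)) by ring.
rewrite -h1 -h2.
transitivity (a1 ^+ 2 + a2 ^+ 2 + (b1 ^+ 2 + b2 ^+ 2) * (cos x ^+ 2 + sin x ^+ 2) +
   2 * (cos x * (a1 * b1 + a2 * b2) - sin x * (a1 * b2 - a2 * b1))); first by ring.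
by rewrite cos2Dsin2; ring.
Qed.

Lemma lne_sqr (x : K) : 0 <= x -> lne x%:E = ((2^-1)%:E * lne (x ^+ 2)%:E)%E.
Proof.
rewrite le_eqVlt => /predU1P[<-|x0].
  by rewrite expr0n /= lexx gt0_muleNy // lte_fin invr_gt0.
rewrite !lne_EFin ?exprn_gt0 // -EFinM lnXn //; congr (_%:E).
by rewrite mulr2n; field.
Qed.

(** The value of |alpha + beta e^(i x)|^2 for moduli a, b and relative argument k. *)
Definition cosine_kernel (a b k x : K) :=
  a ^+ 2 + b ^+ 2 + 2 * (a * b) * cos (x + k).

Lemma lneM_gt0 (x y : K) : 0 < x -> 0 <= y ->
  lne (x * y)%:E = ((ln x)%:E + lne y%:E)%E.
Proof.
move=> x0; rewrite le_eqVlt => /predU1P[<-|y0].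
  by rewrite mulr0 /= lexx.
by rewrite !lne_EFin ?mulr_gt0 // lnM.
Qed.

(** By symmetry b <= a; divide by a^2 to reach the kernel of parameter b/a, which
is singular exactly when a = b. *)
Lemma jensen_kernel (a b k : K) : 0 <= a -> 0 <= b -> 0 < Num.max a b ->
  0 <= k <= twopi ->
  circle.-integrable setT (fun x => lne (cosine_kernel a b k x)%:E) /\
  (\int[circle]_x lne (cosine_kernel a b k x)%:E = (2 * ln (Num.max a b))%:E)%E.
Proof.
move=> a0 b0 ab0 kp.
wlog ab : a b a0 b0 ab0 / b <= a.
  move=> H; have [|] := boolP (b <= a); first exact: H.
  rewrite -ltNge => /ltW ab; have := H b a b0 a0; rewrite maxC => /(_ ab0 ab).
  have QE : cosine_kernel b a k = cosine_kernel a b k.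
    by apply/funext => x; rewrite /cosine_kernel; ring.
  by rewrite QE; exact.
have {}a0 : 0 < a by move: ab0; rewrite max_l.
have -> : Num.max a b = a by rewrite max_l.
move: ab; rewrite le_eqVlt => /predU1P[->|ba].
  have [i1 i2] := jensen_cos1 kp.
  have e x : lne (cosine_kernel a a k x)%:E = ((2 * ln a)%:E + lne (2 + 2 * cos (x + k))%:E)%E.
    rewrite (_ : cosine_kernel a a k x = a ^+ 2 * (2 + 2 * cos (x + k)));
      last by rewrite /cosine_kernel; ring.
    have c0 : 0 <= 2 + 2 * cos (x + k) by have := cos_geN1 (x + k); lra.
    by rewrite lneM_gt0 ?exprn_gt0 // lnXn // [2 * ln a]mulr_natl.
  have ic : circle.-integrable setT (cst (2 * ln a)%:E).
    exact: finite_measure_integrable_cst.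
  rewrite (funext e).
  split; first exact: integrableD.
  etransitivity; first exact: (@integralD _ _ _ circle setT measurableT _ _ ic i1).
  by rewrite integral_cst //= probability_setT mule1 i2 adde0.
have r1 : `|b / a| < 1 by rewrite ger0_norm ?divr_ge0 // 1?ltW // ltr_pdivrMr // mul1r.
pose qk x := 1 + (b / a) ^+ 2 + 2 * (b / a) * cos (x + k).
have q0 x : 0 < qk x by exact: cos_kernel_gt0.
have cq : continuous (fun x => ln (qk x)).
  by apply: continuous_ln_comp => //; exact: continuous_cos_kernel.
have e x : lne (cosine_kernel a b k x)%:E = (2 * ln a + ln (qk x))%:E.
  rewrite (_ : cosine_kernel a b k x = a ^+ 2 * qk x);
    last by rewrite /cosine_kernel /qk; field; rewrite gt_eqF.
  by rewrite lne_EFin ?mulr_gt0 ?exprn_gt0 // lnM ?posrE ?exprn_gt0 // lnXn // [2 * ln a]mulr_natl.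
have cq2 : continuous (fun x => 2 * ln a + ln (qk x)).
  by move=> x; apply: cvgD; [exact: cvg_cst|exact: cq].
rewrite (funext e).
split; first exact: (circle_integrable cq2).
rewrite (circle_continuous cq2) cmeanD //; last exact: cst_continuous.
rewrite cmean_cst (@cmean_rotation _ (fun x => ln (1 + (b / a) ^+ 2 + 2 * (b / a) * cos x))) //.
- by rewrite cmean_ln_q // addr0.
- exact: continuous_ln_q.
- by move=> x; rewrite cos_periodic.
Qed.

Lemma jensen_linear (a b : C) : 0 < Num.max (normc a) (normc b) ->
  circle.-integrable setT (fun x => lne (normc (a + b * expi x))%:E) /\
  (\int[circle]_x lne (normc (a + b * expi x))%:E =
    (ln (Num.max (normc a) (normc b)))%:E)%E.
Proof.
move=> ab0; have [k kp e] := normc_linear_expi a b.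
have [i1 i2] := jensen_kernel (normc_ge0 a) (normc_ge0 b) ab0 kp.
have E x : lne (normc (a + b * expi x))%:E =
    ((2^-1)%:E * lne (cosine_kernel (normc a) (normc b) k x)%:E)%E.
  by rewrite lne_sqr ?normc_ge0 // e.
rewrite (funext E).
split; first exact: integrableZl.
etransitivity; first exact: (@integralZl _ _ _ circle setT measurableT _ i1).
by rewrite i2 -EFinM mulrA mulVf ?mul1r.
Qed.

Lemma jensen_prod (s : seq (C * C)) :
  (forall ab, ab \in s -> 0 < Num.max (normc ab.1) (normc ab.2)) ->
  circle.-integrable setT (fun x => lne (normc (\prod_(ab <- s) (ab.1 + ab.2 * expi x)))%:E) /\
  (\int[circle]_x lne (normc (\prod_(ab <- s) (ab.1 + ab.2 * expi x)))%:E =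
    (\sum_(ab <- s) ln (Num.max (normc ab.1) (normc ab.2)))%:E)%E.
Proof.
elim: s => [|[a b] s IH] sP.
  have E (x : K) : lne (normc (\prod_(ab <- [::] : seq (C * C)) (ab.1 + ab.2 * expi x)))%:E = 0%E.
    by rewrite big_nil ComplexField.Normc.normc1 lne1.
  rewrite (funext E) big_nil; split; first exact: (finite_measure_integrable_cst circle 0).
  by rewrite integral0.
have [|i1 i2] := @jensen_linear a b; first by have := sP (a, b) (mem_head _ _).
have [|j1 j2] := IH; first by move=> ab abs; apply: sP; rewrite in_cons abs orbT.
have E x : lne (normc (\prod_(ab <- (a, b) :: s) (ab.1 + ab.2 * expi x)))%:E =
   (lne (normc (a + b * expi x))%:E + lne (normc (\prod_(ab <- s) (ab.1 + ab.2 * expi x)))%:E)%E.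
  rewrite big_cons ComplexField.Normc.normcM -[(a, b).1]/a -[(a, b).2]/b.
  have := normc_ge0 (a + b * expi x); rewrite le_eqVlt => /predU1P[<-|h0].
    by rewrite mul0r /= lexx; case: ifP.
  by rewrite lneM_gt0 ?normc_ge0 // (lne_EFin h0).
rewrite (funext E).
split; first exact: integrableD.
etransitivity; first exact: (@integralD _ _ _ circle setT measurableT _ _ i1 j1).
by rewrite i2 j2 big_cons EFinD.
Qed.

End JensenComplex.

(** * Measurability of complex-valued functions *)

Section MeasurableComplex.
Variable K : realType.
Local Notation C := (K[i]).
Context d (T : measurableType d).
Implicit Types (f g : T -> C).

Definition cmeasurable f :=
  measurable_fun setT (fun x => complex.Re (f x)) /\
  measurable_fun setT (fun x => complex.Im (f x)).

Lemma cmeasurable_cst (z : C) : cmeasurable (fun=> z).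
Proof. by split; exact: measurable_cst. Qed.

Lemma cmeasurableD f g : cmeasurable f -> cmeasurable g ->
  cmeasurable (fun x => f x + g x).
Proof.
move=> [f1 f2] [g1 g2]; split.
- rewrite (_ : (fun x => _) = (fun x => complex.Re (f x)) \+ (fun x => complex.Re (g x))).
    exact: measurable_funD.
  by apply/funext => x /=; case: (f x) => ? ?; case: (g x).
- rewrite (_ : (fun x => _) = (fun x => complex.Im (f x)) \+ (fun x => complex.Im (g x))).
    exact: measurable_funD.
  by apply/funext => x /=; case: (f x) => ? ?; case: (g x).
Qed.

Lemma cmeasurableM f g : cmeasurable f -> cmeasurable g ->
  cmeasurable (fun x => f x * g x).
Proof.
move=> [f1 f2] [g1 g2]; split.
- rewrite (_ : (fun x => _) =
    (fun x => complex.Re (f x)) \* (fun x => complex.Re (g x)) \-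
    (fun x => complex.Im (f x)) \* (fun x => complex.Im (g x))).
    by apply: measurable_funB; exact: measurable_funM.
  by apply/funext => x /=; case: (f x) => ? ?; case: (g x).
- rewrite (_ : (fun x => _) =
    (fun x => complex.Re (f x)) \* (fun x => complex.Im (g x)) \+
    (fun x => complex.Im (f x)) \* (fun x => complex.Re (g x))).
    by apply: measurable_funD; exact: measurable_funM.
  by apply/funext => x /=; case: (f x) => ? ?; case: (g x).
Qed.

Lemma cmeasurable_horner (P : {poly C}) f : cmeasurable f ->
  cmeasurable (fun x => P.[f x]).
Proof.
move=> mf; elim/poly_ind: P => [|P c IH].
  by under eq_fun do rewrite horner0; exact: cmeasurable_cst.
under eq_fun do rewrite hornerMXaddC.
by apply: cmeasurableD; [exact: cmeasurableM|exact: cmeasurable_cst].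
Qed.

Lemma cmeasurable_expi (h : T -> K) : measurable_fun setT h ->
  cmeasurable (fun x => expi (h x)).
Proof.
move=> mh; split => /=; apply: measurableT_comp => //.
- by apply: continuous_measurable_fun; exact: continuous_cos.
- by apply: continuous_measurable_fun; exact: continuous_sin.
Qed.

Lemma measurable_normc f : cmeasurable f -> measurable_fun setT (fun x => normc (f x)).
Proof.
move=> [f1 f2].
rewrite (_ : (fun x => _) = (fun x => Num.sqrt (complex.Re (f x) ^+ 2 + complex.Im (f x) ^+ 2))).
  apply: (@measurableT_comp _ _ _ _ _ _ (@Num.sqrt K)).
    by apply: continuous_measurable_fun; exact: sqrt_continuous.
  by apply: measurable_funD; exact: measurable_funM.
by apply/funext => x; case: (f x).
Qed.

End MeasurableComplex.

(** * Mahler measures and level inequalities *)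

Section Mahler.
Variable K : realType.
Local Notation twopi := (2 * pi : K).
Local Notation circle := (circle K).
Local Notation C := (K[i]).
Implicit Types (f g P : {poly C}) (e : nat -> C).

Lemma measurable_normc_horner P : measurable_fun setT (fun x : K => normc P.[expi x]).
Proof.
by apply: measurable_normc; apply: cmeasurable_horner; apply: cmeasurable_expi.
Qed.

Lemma normc_norm (z : C) : normc `|z| = normc z.
Proof. by rewrite norm_normc normc_real ger0_norm // normc_ge0. Qed.

Lemma jensen_factor (c : C) (s : seq C) : c != 0 ->
  circle.-integrable setT (fun x => lne (normc (c *: \prod_(z <- s) ('X - z%:P)).[expi x])%:E) /\
  (\int[circle]_x lne (normc (c *: \prod_(z <- s) ('X - z%:P)).[expi x])%:E =
    (ln (normc c) + \sum_(z <- s) ln (Num.max (normc z) 1))%:E)%E.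
Proof.
move=> c0.
have [|i1 i2] := @jensen_prod K ((c, 0) :: [seq (- z, 1) | z <- s]).
  move=> ab; rewrite in_cons => /predU1P[->|/mapP[z _ ->]].
    by rewrite lt_max normc_gt0 c0.
  by rewrite lt_max [X in _ || X]normc_gt0 oner_neq0 orbT.
have E (x : K) : lne (normc (c *: \prod_(z <- s) ('X - z%:P)).[expi x])%:E =
   lne (normc (\prod_(ab <- (c, 0) :: [seq (- z, 1) | z <- s]) (ab.1 + ab.2 * expi x)))%:E.
  rewrite big_cons big_map /= mul0r addr0 hornerZ horner_prod; congr (lne (normc (_ * _))%:E).
  by apply: eq_bigr => z _; rewrite hornerXsubC mul1r addrC.
rewrite (funext E); split=> //; rewrite i2 big_cons big_map.
rewrite ComplexField.Normc.normc0 max_l ?normc_ge0 //; congr (_ + _)%:E.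
by apply: eq_bigr => z _; rewrite normcN ComplexField.Normc.normc1.
Qed.

Lemma jensen_integrable f : f != 0 ->
  circle.-integrable setT (fun x => lne (normc f.[expi x])%:E).
Proof.
move=> f0; have [s [fs _]] := linear_factors f.
rewrite fs; apply: (jensen_factor s _).1.
by rewrite lead_coef_eq0.
Qed.

Lemma jensen_disc_rooted n f : disc_rooted n f ->
  (\int[circle]_x lne (normc f.[expi x])%:E = (ln (normc f`_n))%:E)%E.
Proof.
move=> fI; have [s [ss fs sD]] := disc_rooted_factor fI.
rewrite {1}fs (jensen_factor s (disc_rooted_coef_neq0 fI)).2 big_seq big1 ?addr0 //.
move=> z /sD zD; rewrite max_r ?ln1 //.
by rewrite -lecR -norm_normc.
Qed.

(** Reflecting the zeros of f into the disc changes neither |f| on the circle nor,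
therefore, its Mahler measure, and can only increase the image; for polynomials
with all zeros in the disc both measures are moduli of leading coefficients. *)
Lemma mahler_measure_multop n e f : zero_preserving n e -> size f = n.+1 ->
  (\int[circle]_x lne (normc (multop n e f).[expi x])%:E <=
   (ln (normc (e n)))%:E + \int[circle]_x lne (normc f.[expi x])%:E)%E.
Proof.
move=> eI sf.
have [g [gI fg_top fg_out fg_eq]] := reflect_into_disc sf.
have fn0 : f`_n != 0.
  have : lead_coef f != 0 by rewrite lead_coef_eq0 -size_poly_eq0 sf.
  by rewrite lead_coefE sf.
have en0 := zero_preserving_neq0 eI.
have Tf0 : multop n e f != 0.
  by rewrite -size_poly_eq0 size_multE // mulf_neq0.
have -> : (\int[circle]_x lne (normc f.[expi x])%:E = (ln (normc g`_n))%:E)%E.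
  rewrite -(jensen_disc_rooted gI); apply: eq_integral => x _.
  by rewrite -[normc f.[_]]normc_norm -(fg_eq _ (norm_expi x)) normc_norm.
have Tg : (multop n e g)`_n = e n * g`_n by rewrite coef_multop ltnSn.
rewrite -EFinD -lnM ?posrE ?normc_gt0 ?(disc_rooted_coef_neq0 gI) //.
rewrite -ComplexField.Normc.normcM -Tg -(jensen_disc_rooted (eI _ gI)).
apply: le_integral => //.
- exact: jensen_integrable.
- by apply: jensen_integrable; exact: (disc_rooted_neq0 (eI _ gI)).
move=> x _; rewrite lee_lne ?in_itv /= ?leey ?lee_fin ?normc_ge0 // le_normc.
apply: (multop_comparison eI gI) => //; first by rewrite sf.
- by move=> w w1; apply: fg_out; exact: ltW.
- by rewrite norm_expi.
Qed.

Lemma normc_horner_bound P : exists2 M : K, 0 <= M & forall x, normc P.[expi x] <= M.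
Proof.
elim/poly_ind: P => [|P c [M M0 HM]].
  by exists 0 => // x; rewrite horner0 ComplexField.Normc.normc0.
exists (M + normc c); first by rewrite addr_ge0 ?normc_ge0.
move=> x; rewrite hornerMXaddC (le_trans (le_normcD _ _)) // lerD2r.
by rewrite ComplexField.Normc.normcM normc_expi mulr1.
Qed.

(** Jensen's formula in y for the inner linear function s e^(i y) + P(e^(i x)).  The
constant ln M makes the integrand nonnegative, which is what Tonelli's theorem
asks for. *)
Lemma log_potential_fubini P (s : C) (M : K) : s != 0 -> 0 < M ->
  (forall x, normc P.[expi x] + normc s <= M) ->
  (\int[circle]_x ((ln M)%:E - (ln (Num.max (normc P.[expi x]) (normc s)))%:E) =
   \int[circle]_y \int[circle]_x
      ((ln M)%:E - lne (normc (P + (s * expi y)%:P).[expi x])%:E))%E /\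
  measurable_fun setT (fun y : K => \int[circle]_x
      ((ln M)%:E - lne (normc (P + (s * expi y)%:P).[expi x])%:E))%E.
Proof.
move=> s0 M0 HM.
pose F (xy : K * K) : \bar K :=
  ((ln M)%:E - lne (normc (P.[expi xy.1] + s * expi xy.2))%:E)%E.
have mF : measurable_fun setT F.
  apply: emeasurable_funB; first exact: measurable_cst.
  rewrite (_ : (fun xy => _) = (fun r => lne r%:E) \o (fun xy : K * K => normc (P.[expi xy.1] + s * expi xy.2))) //.
  apply: measurableT_comp.
    by apply: (@measurable_lne_comp K idfun); exact: measurable_id.
  apply: measurable_normc; apply: cmeasurableD.
    by apply: cmeasurable_horner; apply: cmeasurable_expi; exact: measurable_fst.
  apply: cmeasurableM; first exact: cmeasurable_cst.
  by apply: cmeasurable_expi; exact: measurable_snd.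
have F0 xy : (0 <= F xy)%E.
  rewrite /F sube_ge0 ?orbT // -(lne_EFin M0).
  rewrite lee_lne ?in_itv /= ?leey ?lee_fin ?normc_ge0 ?(ltW M0) //.
  rewrite (le_trans (le_normcD _ _)) // ComplexField.Normc.normcM normc_expi mulr1.
  exact: HM.
split; last first.
  have := @measurable_fun_fubini_tonelli_G _ _ _ _ K circle F mF F0.
  apply: eq_measurable_fun => y _; apply: eq_integral => x _.
  by rewrite /F hornerD hornerC.
transitivity (\int[circle]_x \int[circle]_y F (x, y))%E; last first.
  etransitivity; first exact: (@fubini_tonelli _ _ _ _ K circle circle F mF F0).
  apply: eq_integral => y _.
  apply: eq_integral => x _.
  by rewrite /F hornerD hornerC.
apply: eq_integral => x _.
have [|i1 i2] := @jensen_linear K P.[expi x] s.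
  by rewrite lt_max [X in _ || X]normc_gt0 s0 orbT.
have ic : circle.-integrable setT (cst (ln M)%:E) by exact: finite_measure_integrable_cst.
apply/esym; etransitivity; first exact: (@integralB _ _ _ circle setT measurableT _ _ ic i1).
by rewrite i2 integral_cst //= probability_setT mule1.
Qed.

Lemma bounded_circle_integrable (g : K -> K) (B : K) : measurable_fun setT g ->
  (forall x, `|g x| <= B) -> circle.-integrable setT (EFin \o g).
Proof.
move=> mg gB; apply: (@measurable_bounded_integrable _ _ _ circle) => //.
  by rewrite -ge0_fin_numE // fin_num_measure.
by exists B; split; rewrite ?num_real // => y By x _ /=; rewrite (le_trans (gB x)) // ltW.
Qed.

(** The positive part of ln x - v, written so that it is finite at x = 0. *)
Definition excess (v x : K) : K := ln (Num.max x (expR v)) - v.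

Lemma excess_ge0 v x : 0 <= excess v x.
Proof.
rewrite /excess subr_ge0 -{1}(expRK v) ler_ln ?posrE ?lt_max ?expR_gt0 ?orbT //.
by rewrite le_max lexx orbT.
Qed.

Lemma measurable_excess v (g : K -> K) : measurable_fun setT g ->
  measurable_fun setT (fun x => excess v (g x)).
Proof.
move=> mg; apply: measurable_funB; last exact: measurable_cst.
apply: measurableT_comp; first exact: measurable_ln.
by apply: measurable_maxr => //; exact: measurable_cst.
Qed.

Lemma integral_potential (g : K -> K) (M c v : K) : measurable_fun setT g ->
  0 < c -> (forall x, 0 <= g x) -> (forall x, g x + c * expR v <= c * M) ->
  (\int[circle]_x (excess v (g x / c))%:E =
   (ln M - v)%:E - \int[circle]_x ((ln (c * M))%:E - (ln (Num.max (g x) (c * expR v)))%:E))%E.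
Proof.
move=> mg c0 g0 gM.
have M0 : 0 < M.
  by rewrite -(pmulr_rgt0 _ c0) (lt_le_trans _ (gM 0)) // ltr_wpDl // mulr_gt0 ?expR_gt0.
have mx0 x : 0 < Num.max (g x / c) (expR v) by rewrite lt_max expR_gt0 orbT.
have mxE x : Num.max (g x) (c * expR v) = c * Num.max (g x / c) (expR v).
  by rewrite maxr_pMr ?ltW // mulrCA divff ?mulr1 // gt_eqF.
pose h x := ln (c * M) - ln (Num.max (g x) (c * expR v)).
have hE x : h x = ln M - ln (Num.max (g x / c) (expR v)).
  by rewrite /h mxE !lnM ?posrE //; ring.
have mh : measurable_fun setT h.
  apply: measurable_funB; first exact: measurable_cst.
  apply: measurableT_comp; first exact: measurable_ln.
  by apply: measurable_maxr => //; exact: measurable_cst.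
have ih : circle.-integrable setT (EFin \o h).
  apply: (@bounded_circle_integrable _ (ln M - v)) => // x.
  have h1 : ln (Num.max (g x / c) (expR v)) <= ln M.
    rewrite ler_ln ?posrE // ge_max ler_pdivrMr // [M * c]mulrC.
    rewrite (le_trans _ (gM x)) ?lerDl ?mulr_ge0 ?(ltW c0) ?expR_ge0 //=.
    by rewrite -(ler_pM2l c0) (le_trans _ (gM x)) // lerDr.
  have := excess_ge0 v (g x / c); rewrite /excess hE ger0_norm ?subr_ge0 //.
  by move=> h2; lra.
have ic : circle.-integrable setT (cst (ln M - v)%:E) by exact: finite_measure_integrable_cst.
transitivity (\int[circle]_x (cst (ln M - v)%:E \- (EFin \o h)) x)%E.
  by apply: eq_integral => x _ /=; rewrite -EFinB hE /excess; congr (_%:E); ring.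
etransitivity; first exact: (@integralB _ _ _ circle setT measurableT _ _ ic ih).
by rewrite integral_cst //= probability_setT mule1.
Qed.

(** Since the operator T sends P + s to T P + e_0 s, the inequality of Mahler
measures holds for every s with |s| = e^v; averaging over the argument of s
replaces ln |P + s| by ln max(|P|, e^v) and ln |T P + e_0 s| by
ln max(|T P|, |e_0| e^v). *)
Lemma level_inequality n e P v : (0 < n)%N -> zero_preserving n e ->
  normc (e 0%N) = normc (e n) -> size P = n.+1 ->
  (\int[circle]_x (excess v (normc (multop n e P).[expi x] / normc (e n)))%:E <=
   \int[circle]_x (excess v (normc P.[expi x]))%:E)%E.
Proof.
move=> n0 eI e0n sP.
have c0 : 0 < normc (e n) by rewrite normc_gt0 (zero_preserving_neq0 eI).
set c := normc (e n) in e0n c0 *.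
have e00 : e 0%N != 0 by rewrite -normc_gt0 e0n.
have [B B0 HB] := normc_horner_bound P.
have [D D0 HD] := normc_horner_bound (multop n e P).
pose s : C := (expR v)%:C.
have sE : normc s = expR v by rewrite /s normc_real ger0_norm ?expR_ge0.
have s0 : s != 0 by rewrite -normc_gt0 sE expR_gt0.
have s'E : normc (e 0%N * s) = c * expR v by rewrite ComplexField.Normc.normcM e0n sE.
(* M serves for both polynomials, the image being rescaled by c. *)
pose M := B + D / c + expR v.
have M0 : 0 < M by rewrite ltr_wpDl ?expR_gt0 // addr_ge0 ?divr_ge0 // ltW.
have PM x : normc P.[expi x] + normc s <= M.
  by rewrite sE lerD2r (le_trans (HB x)) // lerDl divr_ge0 // ltW.
have TM x : normc (multop n e P).[expi x] + normc (e 0%N * s) <= c * M.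
  rewrite s'E /M !mulrDr lerD2r (le_trans (HD x)) // mulrCA divff ?gt_eqF // mulr1.
  by rewrite lerDr mulr_ge0 // ltW.
have -> : (\int[circle]_x (excess v (normc P.[expi x]))%:E =
    \int[circle]_x (excess v (normc P.[expi x] / 1))%:E)%E.
  by apply: eq_integral => x _; rewrite divr1.
have := @integral_potential (fun x => normc P.[expi x]) M 1 v (measurable_normc_horner P) ltr01.
rewrite !mul1r => -> //; first last.
- by move=> x; rewrite -sE.
- by move=> x; exact: normc_ge0.
have := @integral_potential (fun x => normc (multop n e P).[expi x]) M c v (measurable_normc_horner _) c0.
move=> -> //; first last.
- by move=> x; rewrite -s'E.
- by move=> x; exact: normc_ge0.
apply: leeB => //; rewrite -s'E -sE.
have e0s : e 0%N * s != 0 by rewrite mulf_neq0.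
have cM0 : 0 < c * M by rewrite mulr_gt0.
have [-> m1] := log_potential_fubini s0 M0 PM.
have [-> m2] := log_potential_fubini e0s cM0 TM.
apply: (@ge0_le_integral _ _ _ circle setT measurableT _ _ _ m1 m2).
  move=> y _; apply: integral_ge0 => x _.
  rewrite sube_ge0 ?orbT // -(lne_EFin M0).
  rewrite lee_lne ?in_itv /= ?leey ?lee_fin ?normc_ge0 ?(ltW M0) //.
  rewrite hornerD hornerC (le_trans (le_normcD _ _)) //.
  by rewrite ComplexField.Normc.normcM normc_expi mulr1.
move=> y _.
have ysz z : size (P + z%:P) = n.+1.
  by rewrite size_polyDl // sP ltnS (leq_trans (size_polyC_leq1 _)).
have TE : multop n e P + (e 0%N * s * expi y)%:P = multop n e (P + (s * expi y)%:P).
  apply/polyP => k; rewrite coefD !coef_multop coefD !coefC.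
  by case: k => [|k] /=; [ring|rewrite !addr0].
rewrite TE.
have Pn0 : P + (s * expi y)%:P != 0 by rewrite -size_poly_eq0 ysz.
have Tn0 : multop n e (P + (s * expi y)%:P) != 0.
  rewrite -size_poly_eq0 size_multE // mulf_neq0 ?(zero_preserving_neq0 eI) //.
  by move: Pn0; rewrite -lead_coef_eq0 lead_coefE ysz.
have iP := jensen_integrable Pn0.
have iT := jensen_integrable Tn0.
have ic (r : K) : circle.-integrable setT (cst r%:E) by exact: finite_measure_integrable_cst.
have pot (M' : K) f : circle.-integrable setT (fun x => lne (normc f.[expi x])%:E) ->
    (\int[circle]_x ((ln M')%:E - lne (normc f.[expi x])%:E) =
     (ln M')%:E - \int[circle]_x lne (normc f.[expi x])%:E)%E.
  move=> fi; etransitivity.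
    exact: (@integralB _ _ _ circle setT measurableT _ _ (ic (ln M')) fi).
  by rewrite integral_cst //= probability_setT mule1.
rewrite (pot M _ iP) (pot (c * M) _ iT).
have := mahler_measure_multop eI (ysz (s * expi y)).
have /fineK <- := integrable_fin_num measurableT iP.
have /fineK <- := integrable_fin_num measurableT iT.
rewrite -EFinD -!EFinB !lee_fin lnM ?posrE // -/c; lra.
Qed.

End Mahler.

(** * From level inequalities to p-th powers *)

Section Powers.
Variable K : realType.
Local Notation mu := (@lebesgue_measure K).
Local Notation circle := (circle K).

Let F (p u v : K) := (p * (u - v) + 1) * expR (p * v).

Let F_derive (p u v : K) : is_derive v 1 (F p u) (p ^+ 2 * ((u - v) * expR (p * v))).
Proof.
rewrite /F; apply: is_derive_eq.
by rewrite /GRing.scale /=; ring.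
Qed.

Let ramp_continuous (p u : K) : continuous (fun v => Num.max (u - v) 0 * expR (p * v)).
Proof.
move=> v; apply: cvgM.
  apply: (@continuous_max _ _ (fun v => u - v) (cst 0)); last exact: cvg_cst.
  by apply: cvgB; [exact: cvg_cst|exact: cvg_id].
apply: (@continuous_comp _ _ _ (fun v : K => p * v) expR); last exact: continuous_expR.
by apply: cvgM; [exact: cvg_cst|exact: cvg_id].
Qed.

(** Taylor's formula with integral remainder for e^(p u) at a; the remainder is an
integral over [a, b] of positive parts u - v. *)
Lemma ramp_integral (p a b u : K) : a <= u -> u <= b ->
  p ^+ 2 * \int[mu]_(v in `[a, b]) (Num.max (u - v) 0 * expR (p * v)) =
  expR (p * u) - (p * (u - a) + 1) * expR (p * a).
Proof.
move=> au ub; rewrite (Rintegral_split (@ramp_continuous p u) au ub).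
have -> : \int[mu]_(v in `[u, b]) (Num.max (u - v) 0 * expR (p * v)) = 0.
  transitivity (\int[mu]_(v in `[u, b]) (0 : K)).
    apply: eq_Rintegral => v; rewrite inE /= in_itv /= => /andP[uv _].
    by rewrite max_r ?mul0r // subr_le0.
  by rewrite Rintegral_cst // mul0r.
rewrite addr0; move: au; rewrite le_eqVlt => /predU1P[<-|au].
  by rewrite set_itv1 Rintegral_set1 subrr !mulr0 add0r mul1r subrr.
have cf : continuous (fun v => p ^+ 2 * (Num.max (u - v) 0 * expR (p * v))).
  by move=> v; apply: cvgM; [exact: cvg_cst|exact: ramp_continuous].
rewrite -RintegralZl //; last exact: continuous_integrable.
have cF : continuous (F p u).
  by move=> v; apply: differentiable_continuous; apply/derivable1_diffP; apply: ex_derive.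
rewrite /Rintegral (@continuous_FTC2 K _ (F p u)) //.
- by rewrite /F /= subrr mulr0 add0r mul1r.
- exact: continuous_subspaceT.
- split.
  + by move=> v _; exact: ex_derive.
  + by apply: cvg_at_right_filter; exact: cF.
  + by apply: cvg_at_left_filter; exact: cF.
- move=> v; rewrite in_itv /= => /andP[av vu].
  have -> : Num.max (u - v) 0 = u - v by rewrite max_l // subr_ge0 ltW.
  by rewrite derive1E; exact: (@derive_val _ _ _ _ _ _ _ (F_derive p u v)).
Qed.

Let excess_ramp (a u v x : K) : Num.max x (expR a) = expR u -> a <= v ->
  excess v x = Num.max (u - v) 0.
Proof.
move=> xu av.
have -> : excess v x = ln (Num.max (expR u) (expR v)) - v.
  rewrite /excess -xu -maxA; congr (ln (Num.max x _) - v).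
  by apply/esym/max_idPr; rewrite ler_expR.
have -> : Num.max (u - v) 0 = Num.max u v - v by rewrite addr_maxl subrr.
congr (_ - _); have [uv|vu] := leP u v.
  by rewrite max_r ?ler_expR // expRK.
by rewrite max_l ?ler_expR ?expRK // ltW.
Qed.

(** The previous formula at u = ln max(x, e^a): above the floor e^a, the power x^p is
a combination with nonnegative coefficients of 1 and of the excesses. *)
Lemma power_from_excess (p a b x : K) (ab : a < b) : 0 <= x -> x <= expR b ->
  ((Num.max x (expR a) `^ p)%:E = (expR (p * a))%:E + (p * expR (p * a))%:E * (excess a x)%:E
   + (p ^+ 2 * (b - a))%:E *
     \int[uniform_prob ab]_v (excess v x * expR (p * v))%:E)%E.
Proof.
move=> x0 xb; pose u := ln (Num.max x (expR a)).
have xu : Num.max x (expR a) = expR u by rewrite lnK // posrE lt_max expR_gt0 orbT.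
have au : a <= u by rewrite -ler_expR -xu le_max lexx orbT.
have ub : u <= b by rewrite -ler_expR -xu ge_max xb ler_expR ltW.
have ba0 : b - a != 0 by rewrite subr_eq0 gt_eqF.
rewrite integral_uniform; first last.
- by move=> v; rewrite lee_fin mulr_ge0 ?excess_ge0 ?expR_ge0.
- apply/measurable_EFinP; apply: measurable_funM; last first.
    apply: measurableT_comp; first exact: measurable_expR.
    by apply: measurable_funM => //; exact: measurable_cst.
  apply: measurable_funB => //.
  apply: measurableT_comp; first exact: measurable_ln.
  by apply: measurable_maxr; [exact: measurable_cst|exact: measurable_expR].
have -> : (\int[mu]_(v in `[a, b]) (excess v x * expR (p * v))%:E =
    (\int[mu]_(v in `[a, b]) (Num.max (u - v) 0 * expR (p * v)))%:E)%E.
  rewrite /Rintegral fineK; last first.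
    apply: integrable_fin_num => //; apply: continuous_integrable.
    exact: ramp_continuous.
  apply: eq_integral => v; rewrite inE /= in_itv /= => /andP[av _].
  by rewrite (excess_ramp xu av).
rewrite -!EFinM -!EFinD; congr (_%:E).
rewrite mulrA mulfK // ramp_integral // xu -expRM [u * p]mulrC.
by rewrite (excess_ramp xu (lexx a)) max_l ?subr_ge0 //; ring.
Qed.

Let weighted_excess (p : K) (X : K -> K) (xv : K * K) : \bar K :=
  (excess xv.2 (X xv.1) * expR (p * xv.2))%:E.

Let weighted_excess_ge0 p X xv : (0 <= weighted_excess p X xv)%E.
Proof. by rewrite lee_fin mulr_ge0 ?excess_ge0 ?expR_ge0. Qed.

Let measurable_weighted_excess (p : K) (X : K -> K) : measurable_fun setT X ->
  measurable_fun setT (weighted_excess p X).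
Proof.
move=> mX; apply/measurable_EFinP; apply: measurable_funM; last first.
  apply: measurableT_comp; first exact: measurable_expR.
  by apply: measurable_funM; [exact: measurable_cst|exact: measurable_snd].
apply: measurable_funB; last exact: measurable_snd.
apply: measurableT_comp; first exact: measurable_ln.
apply: measurable_maxr; first by apply: measurableT_comp => //; exact: measurable_fst.
by apply: measurableT_comp; [exact: measurable_expR|exact: measurable_snd].
Qed.

Let integral_power (p a b : K) (ab : a < b) (X : K -> K) : 0 < p ->
  measurable_fun setT X -> (forall x, 0 <= X x <= expR b) ->
  (\int[circle]_x (Num.max (X x) (expR a) `^ p)%:E = (expR (p * a))%:E
   + (p * expR (p * a))%:E * \int[circle]_x (excess a (X x))%:E
   + (p ^+ 2 * (b - a))%:E *
     \int[uniform_prob ab]_v \int[circle]_x weighted_excess p X (x, v))%E.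
Proof.
move=> p0 mX X0.
have mW := measurable_weighted_excess p mX.
have mE : measurable_fun setT (fun x => (excess a (X x))%:E).
  by apply/measurable_EFinP; exact: measurable_excess.
have mI := @measurable_fun_fubini_tonelli_F _ _ _ _ K (uniform_prob ab) _ mW (weighted_excess_ge0 p X).
have I0 x : (0 <= \int[uniform_prob ab]_v weighted_excess p X (x, v))%E.
  by apply: integral_ge0 => v _; exact: weighted_excess_ge0.
have c1 : (0 <= (p * expR (p * a))%:E)%E by rewrite lee_fin mulr_ge0 ?expR_ge0 // ltW.
have c2 : (0 <= (p ^+ 2 * (b - a))%:E)%E.
  by rewrite lee_fin mulr_ge0 ?sqr_ge0 // subr_ge0 ltW.
have E0 x : (0 <= (excess a (X x))%:E)%E by rewrite lee_fin excess_ge0.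
transitivity (\int[circle]_x ((cst (expR (p * a))%:E x + (p * expR (p * a))%:E * (excess a (X x))%:E)
   + (p ^+ 2 * (b - a))%:E * \int[uniform_prob ab]_v weighted_excess p X (x, v)))%E.
  apply: eq_integral => x _; case/andP: (X0 x) => h1 h2.
  exact: (power_from_excess p ab h1 h2).
etransitivity.
  apply: (@ge0_integralD _ _ _ circle setT measurableT).
  - move=> x _; apply: adde_ge0; first by rewrite lee_fin expR_ge0.
    exact: mule_ge0.
  - apply: emeasurable_funD; first exact: measurable_cst.
    exact: measurable_funeM.
  - by move=> x _; exact: mule_ge0.
  - exact: measurable_funeM.
congr (_ + _)%E.
  etransitivity.
    apply: (@ge0_integralD _ _ _ circle setT measurableT).
    - by move=> x _; rewrite lee_fin expR_ge0.
    - exact: measurable_cst.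
    - by move=> x _; exact: mule_ge0.
    - exact: measurable_funeM.
  rewrite integral_cst //= probability_setT mule1; congr (_ + _)%E.
  by apply: (@ge0_integralZl _ _ _ circle setT measurableT).
etransitivity.
  by apply: (@ge0_integralZl _ _ _ circle setT measurableT).
congr (_ * _)%E.
exact: (@fubini_tonelli _ _ _ _ K circle (uniform_prob ab) _ mW (weighted_excess_ge0 p X)).
Qed.

(** Integrate the representation of x^p by excesses, with the floor e^a let down
to 0. *)
Lemma power_mean_le (p : K) (X Y : K -> K) (B : K) : 0 < p ->
  measurable_fun setT X -> measurable_fun setT Y ->
  (forall x, 0 <= X x <= B) -> (forall x, 0 <= Y x <= B) ->
  (forall v, \int[circle]_x (excess v (X x))%:E <= \int[circle]_x (excess v (Y x))%:E)%E ->
  (\int[circle]_x (X x `^ p)%:E <= \int[circle]_x (Y x `^ p)%:E)%E.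
Proof.
move=> p0 mX mY X0 Y0 XY.
have B1 : 0 < `|B| + 1 by rewrite ltr_wpDl.
have [b bB] : exists b, expR b = `|B| + 1 by exists (ln (`|B| + 1)); rewrite lnK.
have BB : B <= expR b by rewrite bB (le_trans (ler_norm B)) // lerDl.
have X1 x : 0 <= X x <= expR b by case/andP: (X0 x) => -> /le_trans ->.
have Y1 x : 0 <= Y x <= expR b by case/andP: (Y0 x) => -> /le_trans ->.
have mpow (Z : K -> K) : measurable_fun setT Z -> measurable_fun setT (fun x => (Z x `^ p)%:E).
  move=> mZ; apply/measurable_EFinP.
  by apply: (@measurableT_comp _ _ _ _ _ _ (@powR K ^~ p) _ Z).
have mmax (Z : K -> K) a : measurable_fun setT Z -> measurable_fun setT (fun x => Num.max (Z x) (expR a)).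
  by move=> mZ; apply: measurable_maxr => //; exact: measurable_cst.
have step a : a < b ->
    (\int[circle]_x (X x `^ p)%:E <= \int[circle]_x (Y x `^ p)%:E + (expR (p * a))%:E)%E.
  move=> ab.
  apply: (@le_trans _ _ (\int[circle]_x (Num.max (X x) (expR a) `^ p)%:E)%E).
    apply: (@ge0_le_integral _ _ _ circle setT measurableT).
    - by move=> x _; rewrite lee_fin powR_ge0.
    - exact: mpow.
    - by apply: mpow; exact: mmax.
    - move=> x _; rewrite lee_fin ge0_ler_powR ?nnegrE ?(ltW p0) //.
      + by case/andP: (X0 x).
      + by rewrite le_max expR_ge0 orbT.
      + by rewrite le_max lexx.
  apply: (@le_trans _ _ (\int[circle]_x (Num.max (Y x) (expR a) `^ p)%:E)%E).
    rewrite (integral_power ab p0 mX X1) (integral_power ab p0 mY Y1).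
    apply: leeD; [apply: leeD => //|].
      by apply: lee_wpmul2l => //; rewrite lee_fin mulr_ge0 ?expR_ge0 // ltW.
    apply: lee_wpmul2l.
      by rewrite lee_fin mulr_ge0 ?sqr_ge0 // subr_ge0 ltW.
    have mG (Z : K -> K) (mZ : measurable_fun setT Z) :=
      @measurable_fun_fubini_tonelli_G _ _ _ _ K circle _
        (measurable_weighted_excess p mZ) (weighted_excess_ge0 p Z).
    apply: (@ge0_le_integral _ _ _ (uniform_prob ab) setT measurableT).
    - by move=> v _; apply: integral_ge0 => x _; exact: weighted_excess_ge0.
    - exact: (mG X mX).
    - exact: (mG Y mY).
    - have WE (Z : K -> K) v : measurable_fun setT Z ->
        (\int[circle]_x weighted_excess p Z (x, v) =
         (expR (p * v))%:E * \int[circle]_x (excess v (Z x))%:E)%E.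
        move=> mZ; transitivity (\int[circle]_x ((expR (p * v))%:E * (excess v (Z x))%:E))%E.
          by apply: eq_integral => x _; rewrite /weighted_excess EFinM muleC.
        apply: (@ge0_integralZl _ _ _ circle setT measurableT).
        + by apply/measurable_EFinP; exact: measurable_excess.
        + by move=> x _; rewrite lee_fin excess_ge0.
        + by rewrite lee_fin expR_ge0.
      by move=> v _; rewrite (WE X) // (WE Y) // lee_wpmul2l // lee_fin expR_ge0.
  have -> : (\int[circle]_x (Y x `^ p)%:E + (expR (p * a))%:E =
      \int[circle]_x ((Y x `^ p)%:E + cst (expR (p * a))%:E x))%E.
    apply/esym; etransitivity.
      apply: (@ge0_integralD _ _ _ circle setT measurableT).
      - by move=> x _; rewrite lee_fin powR_ge0.
      - exact: mpow.
      - by move=> x _; rewrite lee_fin expR_ge0.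
      - exact: measurable_cst.
    by rewrite integral_cst //= probability_setT mule1.
  apply: (@ge0_le_integral _ _ _ circle setT measurableT).
  - by move=> x _; rewrite lee_fin powR_ge0.
  - by apply: mpow; exact: mmax.
  - by apply: emeasurable_funD; [exact: mpow|exact: measurable_cst].
  - move=> x _; rewrite -EFinD lee_fin.
    have [_|_] := leP (Y x) (expR a).
      by rewrite -expRM mulrC lerDr powR_ge0.
    by rewrite lerDl expR_ge0.
apply/lee_addgt0Pr => eps eps0.
(* The floor e^a costs at most e^(p a) <= eps. *)
pose a := Num.min (b - 1) (ln eps / p).
have ab : a < b by rewrite gt_min ltrBlDr ltrDl ltr01.
apply: (le_trans (step a ab)); apply: leeD => //; rewrite lee_fin.
rewrite -[leRHS]lnK ?posrE // ler_expR mulrC -ler_pdivlMr //.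
by rewrite ge_min lexx orbT.
Qed.

End Powers.

(** * The operator B and the dilations as multipliers *)

Section OperatorB.
Variable K : realType.
Local Notation C := (K[i]).
Implicit Types (f P : {poly C}).

Definition opB_multiplier (n : nat) (l0 l1 l2 : C) (k : nat) : C :=
  l0 + l1 * ((n%:R / 2) * k%:R) + l2 * ((n%:R / 2) ^+ 2 * ((k * k.-1)%:R / 2)).

Lemma coef_opB n (l0 l1 l2 : C) P k :
  (opB n l0 l1 l2 P)`_k = opB_multiplier n l0 l1 l2 k * P`_k.
Proof.
have scaleM (a b c : C) (p q : {poly C}) :
    a *: ((b *: p) * (c *: q)) = (a * (b * c)) *: (p * q).
  by rewrite -!mul_polyC !polyCM; ring.
have -> : opB n l0 l1 l2 P = l0 *: P
    + (l1 * (n%:R / 2)) *: ('X * P^`())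
    + (l2 * ((n%:R / 2) ^+ 2 / 2)) *: ('X^2 * P^`(2)).
  rewrite /opB (_ : 1`! = 1%N) // (_ : 2`! = 2%N) // invr1 exprZn !scaleM.
  by rewrite mulr1.
rewrite /opB_multiplier !coefD !coefZ coefXM coefXnM.
case: k => [|[|k]] /=.
- by rewrite !mul0n; ring.
- by rewrite coef_deriv muln0; ring.
rewrite !subSS subn0 !coef_deriv natrM.
by field.
Qed.

Lemma opB_multop n (l0 l1 l2 : C) P : (size P <= n.+1)%N ->
  opB n l0 l1 l2 P = multop n (opB_multiplier n l0 l1 l2) P.
Proof.
move=> sP; apply/polyP => k; rewrite coef_opB coef_multop; case: ltnP => // nk.
by rewrite nth_default ?mulr0 // (leq_trans sP).
Qed.

Lemma opB_multiplier_n n (l0 l1 l2 : C) : (0 < n)%N -> opB_multiplier n l0 l1 l2 n = Lambda n l0 l1 l2.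
Proof.
case: n => // n _; rewrite /opB_multiplier /Lambda subn1 !natrM.
by field.
Qed.

Lemma opB_multiplier_0 n (l0 l1 l2 : C) : opB_multiplier n l0 l1 l2 0 = l0.
Proof. by rewrite /opB_multiplier mul0n; ring. Qed.

(** The polynomial in the second factor is u, which defines the class of operators;
the condition on its zeros is thereby translated into |w| <= |zeta|. *)
Lemma horner_opB_XsubC_exp n (l0 l1 l2 zeta w : C) : (0 < n)%N -> w != zeta ->
  (opB n l0 l1 l2 (('X - zeta%:P) ^+ n)).[w] =
  (w - zeta) ^+ n *
  (l0%:P + ('C(n, 1)%:R * l1) *: 'X + ('C(n, 2)%:R * l2) *: 'X^2).[n%:R / 2 * w / (w - zeta)].
Proof.
move=> n0 wz; have d0 : w - zeta != 0 by rewrite subr_eq0.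
have der k : (('X - zeta%:P) ^+ k)^`() = k%:R *: ('X - zeta%:P) ^+ k.-1 :> {poly C}.
  by rewrite deriv_exp derivXsubC mul1r scaler_nat.
have bin2E : 'C(n, 2)%:R = n%:R * n.-1%:R / 2 :> C.
  have := mul_bin_diag n 1; rewrite bin1 => /(congr1 (fun k => k%:R : C)).
  by rewrite !natrM => ->; field.
rewrite /opB (_ : 1`! = 1%N) // (_ : 2`! = 2%N) // invr1 scale1r exprZn.
rewrite derivnS derivn1 der derivZ der.
rewrite !hornerE bin1 bin2E.
case: n n0 {bin2E} => // -[|n] _ /=; first by field.
by rewrite !exprS; field.
Qed.

Lemma opB_multiplier_zero_preserving n (l0 l1 l2 : C) : (0 < n)%N -> classB n l0 l1 l2 ->
  zero_preserving n (opB_multiplier n l0 l1 l2).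
Proof.
move=> n0; rewrite /classB /=; set u := (X in forall z, root X z -> _) => uR.
have s0 : n%:R / 2 != 0 :> C by rewrite mulf_neq0 ?invr_eq0 ?pnatr_eq0 // -lt0n.
apply: zero_preserving_grace.
  rewrite opB_multiplier_n //; apply/negP => /eqP L0.
  have := uR (n%:R / 2); rewrite subrr normr0 normr_le0 (negPf s0) => /(_ _)/negP; apply => //.
  apply/rootP; rewrite -L0 /u /Lambda !(hornerD, hornerZ, hornerC, hornerX, hornerXn) bin1.
  have := mul_bin_diag n 1; rewrite bin1 => /(congr1 (fun k => k%:R : C)).
  rewrite !natrM -subn1 => H.
  have -> : 'C(n, 2)%:R = n%:R * (n - 1)%:R / 2 :> C by rewrite H; field.
  by rewrite ?natrM; field.
move=> zeta w zeta1 w1.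
have wz : w != zeta by apply: contraTneq w1 => ->; rewrite -real_leNgt.
have d0 : w - zeta != 0 by rewrite subr_eq0.
rewrite -opB_multop ?size_XsubC_exp // horner_opB_XsubC_exp //.
rewrite mulf_neq0 ?expf_neq0 //; apply/negP => /uR.
have -> : n%:R / 2 * w / (w - zeta) - n%:R / 2 = n%:R / 2 * zeta / (w - zeta).
  by field.
rewrite !normrM ler_pM2r ?normr_gt0 ?invr_eq0 // ler_pM2l.
  by apply/negP; rewrite -real_ltNge // (le_lt_trans zeta1).
by rewrite -normrM normr_gt0.
Qed.

Lemma coef_dilate (s : K) P k : (poly_dilate s P)`_k = (s%:C) ^+ k * P`_k.
Proof.
rewrite /poly_dilate; elim/poly_ind: P k => [|P c IH] k.
  by rewrite comp_poly0 coef0 mulr0.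
rewrite comp_poly_MXaddC -scalerAr !coefD coefZ !coefMX !coefC.
by case: k => [|k] /=; rewrite ?expr0 ?IH ?exprS; ring.
Qed.

Definition opB_dilate_multiplier (n : nat) (l0 l1 l2 : C) (R r : K) (ph : C) (k : nat) : C :=
  opB_multiplier n l0 l1 l2 k * (R%:C ^+ k + ph * r%:C ^+ k).

Lemma opB_dilate_multop n (l0 l1 l2 : C) (R r : K) ph P : (size P <= n.+1)%N ->
  opB n l0 l1 l2 (poly_dilate R P) + ph *: opB n l0 l1 l2 (poly_dilate r P) =
  multop n (opB_dilate_multiplier n l0 l1 l2 R r ph) P.
Proof.
move=> sP; apply/polyP => k; rewrite coefD coefZ !coef_opB !coef_dilate coef_multop /opB_dilate_multiplier.
case: ltnP => nk; first by ring.
by rewrite [P`_k]nth_default ?(leq_trans sP) //; ring.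
Qed.

(** phi = beta (k - |alpha|) - alpha with k >= 1 >= |alpha|. *)
Lemma norm_phi n (R r : K) (alpha beta : C) : 1 <= r -> r < R ->
  `|alpha| <= 1 -> `|beta| <= 1 ->
  `|phi n R r alpha beta| <= ((R%:C + 1) / (r%:C + 1)) ^+ n.
Proof.
move=> r1 rR a1 b1; rewrite /phi.
have -> : (((R + 1) / (r + 1)) ^+ n)%:C = ((R%:C + 1) / (r%:C + 1)) ^+ n.
  by rewrite rmorphXn fmorph_div !rmorphD rmorph1.
set k := (_ ^+ n).
have r0 : 0 < r%:C + 1 by rewrite addr_gt0 ?ltr01 // ltcR (lt_le_trans ltr01).
have k1 : 1 <= k.
  rewrite exprn_ege1 // ler_pdivlMr // mul1r lerD2r lecR; exact: ltW.
have ka : 0 <= k - `|alpha| by rewrite subr_ge0 (le_trans a1).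
rewrite (le_trans (ler_normB _ _)) // normrM (ger0_norm ka).
by rewrite -lerBrDr ler_piMl.
Qed.

Lemma opB_dilate_multiplier_zero_preserving n (l0 l1 l2 : C) (R r : K) (alpha beta : C) :
  (0 < n)%N -> classB n l0 l1 l2 -> 1 <= r -> r < R -> `|alpha| <= 1 -> `|beta| <= 1 ->
  zero_preserving n (opB_dilate_multiplier n l0 l1 l2 R r (phi n R r alpha beta)).
Proof.
move=> n0 hB r1 rR a1 b1; apply: zero_preserving_comp.
  exact: opB_multiplier_zero_preserving.
by apply: dilation_zero_preserving; rewrite ?lecR ?ltcR ?norm_phi.
Qed.

End OperatorB.

(** * The bound on the circle *)

Section Pointwise.
Variable K : realType.
Local Notation twopi := (2 * pi : K).
Local Notation circle := (circle K).
Local Notation C := (K[i]).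
Implicit Types (P f : {poly C}) (e : nat -> C).

(** Let psi(z) = (z + z0)/(1 + conj(z0) z), an automorphism of the disc.  The
polynomial (1 + conj(z0) z)^n P(psi(z)) has no zero in the open disc and takes
the value P(z0) at 0, so by Jensen's formula ln |P(z0)| is its logarithmic mean
over the circle, while ln |1 + conj(z0) z| has mean 0. *)
Lemma minimum_modulus n P (m : K) (z0 : C) : size P = n.+1 ->
  (forall z, `|z| < 1 -> P.[z] != 0) ->
  (forall z, `|z| = 1 -> m <= normc P.[z]) -> `|z0| < 1 -> m <= normc P.[z0].
Proof.
move=> sP PD Pm z01.
have [m0|m0] := leP m 0; first exact: le_trans (normc_ge0 _).
have [s [Ps ss]] := linear_factors P.
have P0 : P != 0 by rewrite -size_poly_eq0 sP.
have lP : lead_coef P != 0 by rewrite lead_coef_eq0.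
have sD z : z \in s -> 1 <= `|z|.
  move=> zs; rewrite real_leNgt //; apply/negP => /PD.
  by rewrite Ps hornerZ mulf_eq0 negb_or -rootE root_prod_XsubC zs andbF.
pose zc := Num.conj z0.
have zcE : `|zc| = `|z0| by exact: norm_conjC.
have facle z : z \in s -> `|1 - z * zc| <= `|z0 - z|.
  move=> /sD z1; rewrite [X in _ <= X]distrC [z * zc]mulrC.
  exact: (@factor_reflect _ z0 z (ltW z01) z1).
have facgt z : z \in s -> 0 < normc (z0 - z).
  move=> /sD z1; rewrite normc_gt0 subr_eq0; apply: contraTneq z01 => ->.
  by rewrite -real_leNgt.
(* s1 lists the factors of (1 + conj(z0) z)^n P(psi(z)), and s2 those of
   m (1 + conj(z0) z)^n. *)
pose s1 : seq (C * C) := (lead_coef P, 0) :: [seq (z0 - z, 1 - z * zc) | z <- s].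
pose s2 : seq (C * C) := (m%:C, 0) :: [seq (1, zc) | z <- s].
have [|i1 I1] := @jensen_prod K s1.
  move=> ab; rewrite in_cons => /predU1P[->|/mapP[z zs ->]].
    by rewrite lt_max normc_gt0 lP.
  by rewrite lt_max facgt.
have [|i2 I2] := @jensen_prod K s2.
  move=> ab; rewrite in_cons => /predU1P[->|/mapP[z zs ->]].
    by rewrite lt_max normc_real (gtr0_norm m0) m0.
  by rewrite lt_max normc_gt0 oner_neq0.
have zc1 : normc zc <= 1 by rewrite -lecR -norm_normc zcE ltW.
have I1E : \sum_(ab <- s1) ln (Num.max (normc ab.1) (normc ab.2)) = ln (normc P.[z0]).
  rewrite big_cons big_map ComplexField.Normc.normc0 max_l ?normc_ge0 //.
  rewrite (_ : \sum_(z <- s) _ = \sum_(z <- s) ln (normc (z0 - z))); last first.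
    by rewrite big_seq [RHS]big_seq; apply: eq_bigr => z zs; rewrite max_l // le_normc facle.
  rewrite [in RHS]Ps hornerZ horner_prod ComplexField.Normc.normcM.
  have : 0 < normc (lead_coef P) by rewrite normc_gt0.
  move: (normc (lead_coef P)) (s) facgt => c r + c0.
  elim: r c c0 => [|z r IH] c c0 H.
    by rewrite !big_nil ComplexField.Normc.normc1 mulr1 addr0.
  rewrite !big_cons ComplexField.Normc.normcM hornerXsubC mulrA -IH.
  - by rewrite addrA lnM ?posrE // H ?mem_head.
  - by rewrite mulr_gt0 // H ?mem_head.
  - by move=> y yr; apply: H; rewrite in_cons yr orbT.
have I2E : \sum_(ab <- s2) ln (Num.max (normc ab.1) (normc ab.2)) = ln m.
  rewrite big_cons big_map ComplexField.Normc.normc0 max_l ?normc_ge0 //.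
  rewrite normc_real gtr0_norm // big1 ?addr0 // => z _.
  by rewrite ComplexField.Normc.normc1 max_l // ln1.
have Pz0 : 0 < normc P.[z0] by rewrite normc_gt0 PD.
rewrite -ler_ln ?posrE // -I1E -I2E -lee_fin -I1 -I2.
apply: (@le_integral _ _ _ circle setT measurableT _ _ i2 i1).
move=> x _; rewrite lee_lne ?in_itv /= ?leey ?lee_fin ?normc_ge0 //.
rewrite !big_cons !big_map !mul0r !addr0 /=.
set w := expi x; have w1 : `|w| = 1 := norm_expi x.
have d0 : 1 + zc * w != 0.
  rewrite addr_eq0; apply/eqP => /(congr1 Num.norm).
  by rewrite normrN normrM w1 zcE normr1 mulr1 => E; rewrite -E ltxx in z01.
pose psi := (w + z0) / (1 + zc * w).
have psi1 : `|psi| = 1.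
  have ww : w * Num.conj w = 1 by rewrite -normCK w1 expr1n.
  have wE : w + z0 = w * Num.conj (1 + zc * w).
    rewrite rmorphD rmorphM rmorph1 /zc /= conjCK mulrDr mulr1 mulrCA ww.
    by rewrite mulr1.
  by rewrite normf_div wE normrM w1 mul1r norm_conjC divff // normr_eq0.
have -> : lead_coef P * \prod_(z <- s) (z0 - z + (1 - z * zc) * w) =
   P.[psi] * \prod_(z <- s) (1 + zc * w).
  rewrite [in RHS]Ps hornerZ horner_prod -mulrA -big_split /=; congr (_ * _).
  by apply: eq_bigr => z _; rewrite hornerXsubC /psi; field.
rewrite !ComplexField.Normc.normcM ler_wpM2r ?normc_ge0 // normc_real gtr0_norm //.
exact: Pm.
Qed.

Lemma linear_bound_limit (D G : K) : (forall t, 0 <= t < 1 -> D + t * G <= 0) ->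
  D + G <= 0.
Proof.
move=> H; rewrite leNgt; apply/negP => DG.
have D0 : D <= 0 by have := H 0; rewrite lexx ltr01 mul0r addr0; exact.
have G0 : 0 < G by lra.
(* The midpoint between - D / G and 1. *)
pose t := (G - D) / (2 * G).
have t01 : 0 <= t < 1.
  by rewrite divr_ge0 ?mulr_ge0 ?(ltW G0) ?subr_ge0 ?(le_trans D0) 1?ltW //= ltr_pdivrMr ?mulr_gt0 //; lra.
have := H t t01; rewrite /t.
have -> : (G - D) / (2 * G) * G = (G - D) / 2 by field; rewrite gt_eqF.
lra.
Qed.

Lemma multop_polyC n e (c : C) : multop n e c%:P = (e 0%N * c)%:P.
Proof.
apply/polyP => k; rewrite coef_multop !coefC; case: k => [|k] //=.
by rewrite mulr0; case: ifP.
Qed.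

Lemma horner_multop_Xn n e (c w : C) : (multop n e (c *: 'X^n)).[w] = c * e n * w ^+ n.
Proof.
rewrite multopZ hornerZ horner_poly (bigD1 ord_max) //= coefXn eqxx mulr1 big1 ?addr0 ?mulrA //.
by move=> i; rewrite -val_eqE /= => /negPf; rewrite coefXn => ->; rewrite mulr0 mul0r.
Qed.

Lemma recip_addC n f (c : C) : recip n (f + c%:P) = recip n f + (Num.conj c) *: 'X^n.
Proof.
apply/polyP => k; rewrite coefD coefZ coefXn; have [kn|kn] := leqP k n.
  rewrite !coef_recip // coefD rmorphD coefC; congr (_ + _).
  rewrite subn_eq0 eqn_leq kn andTb.
  by case: ifP; rewrite ?mulr1 ?rmorph0 ?mulr0.
rewrite !nth_default ?(leq_trans (size_recip _ _)) //.
by rewrite gtn_eqF // mulr0 addr0.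
Qed.

(** Compare P + c with its reciprocal polynomial Q + conj(c) X^n for |c| = t m,
t < 1, and choose the argument of c so that conj(c) e_n w^n points opposite to
E Q(w); since |E Q(w)| >= m |e_n|, the right-hand side is then
|E Q(w)| - t m |e_n|.  Let t tend to 1. *)
Lemma pointwise_bound n e P (m : K) (w : C) : (0 < n)%N -> zero_preserving n e ->
  zero_free n P -> 0 <= m -> (forall z, `|z| = 1 -> m <= normc P.[z]) -> `|w| = 1 ->
  normc (multop n e P).[w] + m * (normc (e n) - normc (e 0%N)) <=
  normc (multop n e (recip n P)).[w].
Proof.
move=> n0 eI [sP PD] m0 Pm w1.
move: m0; rewrite le_eqVlt => /predU1P[<-|m0].
  by rewrite mul0r addr0 le_normc recip_comparison // w1.
set Q := recip n P; set F := (multop n e P).[w]; set G := (multop n e Q).[w].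
have Pmin z : `|z| < 1 -> m <= normc P.[z] by exact: minimum_modulus sP PD Pm.
have en0 := zero_preserving_neq0 eI.
have QI : disc_rooted n Q by exact: recip_disc_rooted.
have mC : `|m%:C| = m%:C by rewrite ger0_norm // lecR ltW.
have Gbig : m * normc (e n) <= normc G.
  have : `|(multop n e (m%:C *: 'X^n)).[w]| <= `|G|.
    apply: (multop_comparison eI QI); rewrite ?w1 //.
    - by rewrite (leq_trans (size_scale_leq _ _)) // size_polyXn.
    - rewrite coefZ coefXn eqxx mulr1 mC coef_recip // subnn norm_conjC.
      by rewrite -horner_coef0 norm_normc lecR; apply: Pmin; rewrite normr0 ltr01.
    - move=> z z1; have z0 : z != 0 by rewrite -normr_gt0 (lt_trans ltr01).
      rewrite hornerZ hornerXn horner_recip ?sP // !normrM mC norm_conjC mulrC.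
      rewrite ler_wpM2l // norm_normc lecR; apply: Pmin.
      by rewrite normfV norm_conjC invf_lt1 // (lt_trans ltr01).
  rewrite horner_multop_Xn !normrM mC normrX w1 expr1n mulr1 !norm_normc.
  by rewrite -rmorphM lecR.
have G0 : 0 < normc G by rewrite (lt_le_trans _ Gbig) // mulr_gt0 // normc_gt0.
suff : normc F - normc G + m * (normc (e n) - normc (e 0%N)) <= 0 by lra.
apply: linear_bound_limit => t /andP[t0 t1].
have GC : `|G| = (normc G)%:C by [].
(* v e_n w^n is a negative multiple of G, of modulus t m |e_n|. *)
pose v := - (t * m)%:C * (G / `|G|) * Num.conj (e n * w ^+ n) / `|e n|.
pose c := Num.conj v.
have Gn0 : `|G| != 0 by rewrite GC; apply/eqP => /complexI /eqP; rewrite gt_eqF.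
have enn0 : `|e n| != 0 by rewrite normr_eq0.
have cn : normc c = t * m.
  have : `|c| = (t * m)%:C.
    rewrite norm_conjC /v !normrM norm_conjC normrM normrX w1 expr1n mulr1 normrN.
    rewrite !normfV !normr_id mulfK // divff // mulr1 ger0_norm // lecR.
    by rewrite mulr_ge0 // ltW.
  by rewrite norm_normc => /complexI.
pose g := P + c%:P.
have sg : size g = n.+1 by rewrite size_polyDl // sP ltnS (leq_trans (size_polyC_leq1 _)).
have gD z : `|z| < 1 -> g.[z] != 0.
  move=> /Pmin Pz; rewrite hornerD hornerC addr_eq0; apply/eqP => E.
  have : normc P.[z] = t * m by rewrite E normcN.
  have : t * m < m by rewrite gtr_pMl.
  lra.
have := recip_comparison eI sg gD (w := w); rewrite w1 lexx => /(_ isT).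
rewrite -le_normc recip_addC /g.
have -> : multop n e (P + c%:P) = multop n e P + (e 0%N * c)%:P.
  by rewrite -[c%:P]opprK multopB -polyCN multop_polyC mulrN polyCN opprK.
have -> : (multop n e (recip n P + Num.conj c *: 'X^n)).[w] = G + v * e n * w ^+ n.
  rewrite -[in LHS](scale1r (recip n P)) multop_linear scale1r hornerD horner_multop_Xn.
  by rewrite /c conjCK.
rewrite hornerD hornerC -/F => H.
have h1 : normc F - t * m * normc (e 0%N) <= normc (F + e 0%N * c).
  rewrite lerBlDr -cn [normc c * _]mulrC -ComplexField.Normc.normcM.
  have := le_normcD (F + e 0%N * c) (- (e 0%N * c)); rewrite addrK.
  by rewrite normcN.
have h2 : normc (G + v * e n * w ^+ n) = normc G - t * m * normc (e n).
  have ww : (e n * w ^+ n) * Num.conj (e n * w ^+ n) = `|e n| ^+ 2.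
    by rewrite -normCK normrM normrX w1 expr1n mulr1.
  have -> : G + v * e n * w ^+ n = (G / `|G|) * (`|G| - (t * m)%:C * `|e n|).
    rewrite /v; transitivity (G - (t * m)%:C * (G / `|G|) * (e n * w ^+ n * Num.conj (e n * w ^+ n)) / `|e n|).
      by field; rewrite enn0 Gn0.
    by rewrite ww; field; rewrite enn0 Gn0.
  rewrite ComplexField.Normc.normcM.
  have -> : normc (G / `|G|) = 1.
    have : `|G / `|G| | = 1 by rewrite normf_div normr_id divff.
    by rewrite norm_normc => /complexI.
  rewrite mul1r !norm_normc -rmorphM -rmorphB normc_real ger0_norm // subr_ge0.
  rewrite (le_trans _ Gbig) // ler_wpM2r ?normc_ge0 // ler_piMl // ltW //.
rewrite h2 in H; have := le_trans h1 H; lra.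
Qed.

End Pointwise.

(** * Averaging over the twisted operators *)

Section Main.
Variable K : realType.
Local Notation mu := (@lebesgue_measure K).
Local Notation twopi := (2 * pi : K).
Local Notation circle := (circle K).
Local Notation C := (K[i]).
Implicit Types (P f : {poly C}) (e : nat -> C) (g : K -> K).

Lemma continuous_powR_comp g (r : K) : 0 < r -> continuous g ->
  (forall x, 0 <= g x) -> continuous (fun x => g x `^ r).
Proof.
move=> r0 cg g0 x; have [gx0|gx0] := ltP 0 (g x).
  apply: (@continuous_comp _ _ _ g (@powR K ^~ r)); first exact: cg.
  apply: differentiable_continuous; apply/derivable1_diffP.
  by apply: derivable_powR; rewrite in_itv /= gx0.
have gxE : g x = 0 by apply/eqP; rewrite eq_le gx0 g0.
apply/cvgrPdist_lt => eps eps0; rewrite gxE powR0 ?gt_eqF //.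
have e0 : 0 < eps `^ r^-1 by exact: powR_gt0.
have /cvgrPdist_lt /(_ _ e0) := cg x; apply: filterS => y.
rewrite gxE !sub0r !normrN !ger0_norm ?powR_ge0 // => H.
have -> : eps = (eps `^ r^-1) `^ r by rewrite -powRrM mulVf ?gt_eqF // powRr1 // ltW.
by apply: gt0_ltr_powR => //; rewrite nnegrE // ltW.
Qed.

Lemma expi_periodic (x : K) : expi (x + twopi) = expi x :> C.
Proof. by rewrite /expi cos_periodic sin_periodic. Qed.

Lemma expi_exp (x : K) n : (expi x) ^+ n = expi (n%:R * x) :> C.
Proof.
elim: n => [|n IH]; first by rewrite mul0r /expi cos0 sin0 expr0.
rewrite exprS IH -[n.+1%:R]nat1r (mulrDl 1 n%:R x) mul1r /expi cosD sinD.
by apply/eqP; rewrite eq_complex /= eqxx /=; apply/eqP; ring.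
Qed.

Lemma cosine_kernel_ge0 (a b k x : K) : 0 <= a -> 0 <= b -> 0 <= cosine_kernel a b k x.
Proof.
move=> a0 b0; have c1 := cos_geN1 (x + k).
have -> : cosine_kernel a b k x = (a - b) ^+ 2 + 2 * (a * b) * (1 + cos (x + k)).
  by rewrite /cosine_kernel; ring.
have s0 : 0 <= 1 + cos (x + k) by lra.
by rewrite addr_ge0 ?sqr_ge0 // !mulr_ge0.
Qed.

Lemma powR_sqr (x p : K) : 0 <= x -> x `^ p = (x ^+ 2) `^ (p / 2).
Proof.
by move=> x0; rewrite -powR_mulrn // -powRrM mulrCA divff ?mulr1.
Qed.

Lemma continuous_cosine_kernel_powR (a b k p : K) : 0 < p -> 0 <= a -> 0 <= b ->
  continuous (fun x => cosine_kernel a b k x `^ (p / 2)).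
Proof.
move=> p0 a0 b0; apply: continuous_powR_comp; first by rewrite divr_gt0.
  exact: continuous_cos_kernel.
by move=> x; exact: cosine_kernel_ge0.
Qed.

(** The mean depends on the two moduli only: the relative argument is removed by a
rotation. *)
Lemma power_rotation (a b : C) (p : K) : 0 < p ->
  (\int[circle]_x (normc (a + b * expi x) `^ p)%:E =
   \int[circle]_x (cosine_kernel (normc a) (normc b) 0 x `^ (p / 2))%:E)%E.
Proof.
move=> p0; have [k kp kE] := normc_linear_expi a b.
have a0 := normc_ge0 a; have b0 := normc_ge0 b.
transitivity (\int[circle]_x (cosine_kernel (normc a) (normc b) k x `^ (p / 2))%:E)%E.
  by apply: eq_integral => x _; rewrite powR_sqr ?normc_ge0 // kE.
have ck h := @continuous_cosine_kernel_powR (normc a) (normc b) h p p0 a0 b0.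
rewrite (circle_continuous (@ck k)) (circle_continuous (@ck 0)).
rewrite -(@cmean_rotation _ (fun x => cosine_kernel (normc a) (normc b) 0 x `^ (p / 2)) k) //.
  by congr (_%:E); apply: eq_cmean => x; rewrite /cosine_kernel addr0.
by move=> x; rewrite /cosine_kernel !addr0 cos_periodic.
Qed.

Lemma power_multiple (a b : C) (p : K) n : 0 < p -> (0 < n)%N ->
  (\int[circle]_x (normc (a + b * expi x ^+ n) `^ p)%:E =
   \int[circle]_x (normc (a + b * expi x) `^ p)%:E)%E.
Proof.
move=> p0 n0; have [k kp kE] := normc_linear_expi a b.
pose h x := normc (a + b * expi x) `^ p.
have hE : h = fun x => cosine_kernel (normc a) (normc b) k x `^ (p / 2).
  by apply/funext => x; rewrite /h powR_sqr ?normc_ge0 // kE.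
have ch : continuous h by rewrite hE; apply: continuous_cosine_kernel_powR => //; exact: normc_ge0.
have ph : periodic h twopi by move=> x; rewrite /h expi_periodic.
have chn : continuous (fun x : K => h (n%:R * x)).
  move=> x; apply: (@continuous_comp _ _ _ (fun x : K => n%:R * x) h); last exact: ch.
  by apply: cvgM; [exact: cvg_cst|exact: cvg_id].
transitivity (\int[circle]_x (h (n%:R * x))%:E)%E.
  by apply: eq_integral => x _; rewrite /h expi_exp.
by rewrite (circle_continuous chn) (circle_continuous ch) cmean_scale.
Qed.

Lemma measurable_normc_powR f (p : K) :
  measurable_fun setT (fun x : K => (normc f.[expi x] `^ p)%:E).
Proof.
apply/measurable_EFinP.
apply: (@measurableT_comp _ _ _ _ _ _ (@powR K ^~ p) _ (fun x : K => normc f.[expi x])) => //.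
exact: measurable_normc_horner.
Qed.

(** The p-th power of the level inequality; this is where equality of the two
extreme moduli is used. *)
Lemma power_mean_multop n e P (p : K) : (0 < n)%N -> zero_preserving n e ->
  normc (e 0%N) = normc (e n) -> size P = n.+1 -> 0 < p ->
  (\int[circle]_x (normc (multop n e P).[expi x] `^ p)%:E <=
   (normc (e n) `^ p)%:E * \int[circle]_x (normc P.[expi x] `^ p)%:E)%E.
Proof.
move=> n0 eI e0n sP p0.
have c0 : 0 < normc (e n) by rewrite normc_gt0 (zero_preserving_neq0 eI).
have [B B0 HB] := normc_horner_bound P.
have [D D0 HD] := normc_horner_bound (multop n e P).
set c := normc (e n) in c0 e0n *.
have -> : (\int[circle]_x (normc (multop n e P).[expi x] `^ p)%:E =
   \int[circle]_x ((c `^ p)%:E * ((normc (multop n e P).[expi x] / c) `^ p)%:E))%E.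
  apply: eq_integral => x _; rewrite -EFinM -powRM ?divr_ge0 ?normc_ge0 // 1?ltW //.
  by rewrite mulrC divfK // gt_eqF.
have mX : measurable_fun setT (fun x : K => normc (multop n e P).[expi x] / c).
  by apply: measurable_funM; [exact: measurable_normc_horner|exact: measurable_cst].
have mXp : measurable_fun setT (fun x : K => ((normc (multop n e P).[expi x] / c) `^ p)%:E).
  apply/measurable_EFinP.
  exact: (@measurableT_comp _ _ _ _ _ _ (@powR K ^~ p) _ (fun x : K => normc (multop n e P).[expi x] / c)).
have -> : (\int[circle]_x ((c `^ p)%:E * ((normc (multop n e P).[expi x] / c) `^ p)%:E) =
   (c `^ p)%:E * \int[circle]_x ((normc (multop n e P).[expi x] / c) `^ p)%:E)%E.
  apply: (@ge0_integralZl _ _ _ circle setT measurableT) => //.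
  - by move=> x _; rewrite lee_fin powR_ge0.
  - by rewrite lee_fin powR_ge0.
apply: lee_wpmul2l; first by rewrite lee_fin powR_ge0.
apply: (@power_mean_le _ p (fun x => normc (multop n e P).[expi x] / c)
   (fun x => normc P.[expi x]) (B + D / c)) => //.
- exact: measurable_normc_horner.
- move=> x; rewrite divr_ge0 ?normc_ge0 ?(ltW c0) //=.
  by rewrite (le_trans (_ : _ <= D / c)) ?lerDr // ler_wpM2r ?invr_ge0 ?(ltW c0).
- by move=> x; rewrite normc_ge0 (le_trans (HB x)) // lerDl divr_ge0 // ltW.
- by move=> v; exact: level_inequality.
Qed.

(** The inequality f |1 + e^(i x)| <= |a e^(i x) + b|, squared: moving d from b to a
leaves the sum a + b unchanged and brings the moduli closer, which decreases
|a e^(i x) + b|. *)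
Lemma cosine_kernel_lower_bound (a b f x d : K) : 0 <= a -> 0 <= d -> 0 <= f ->
  f <= a + d -> a + 2 * d <= b ->
  f ^+ 2 * cosine_kernel 1 1 0 x <= cosine_kernel b a 0 x.
Proof.
move=> a0 d0 f0 fa ab; rewrite /cosine_kernel addr0.
have c1 := cos_geN1 x; have c2 := cos_le1 x.
have f2 : f ^+ 2 <= (a + d) ^+ 2 by rewrite lerXn2r ?nnegrE ?addr_ge0.
have s0 : 0 <= 2 + 2 * cos x by lra.
apply: (@le_trans _ _ ((a + d) ^+ 2 * (2 + 2 * cos x))).
  have -> : 1 ^+ 2 + 1 ^+ 2 + 2 * (1 * 1) * cos x = 2 + 2 * cos x by ring.
  exact: ler_wpM2r.
pose h := b - (a + 2 * d); have h0 : 0 <= h by rewrite subr_ge0.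
have -> : b = a + 2 * d + h by rewrite /h; ring.
have -> : (a + 2 * d + h) ^+ 2 + a ^+ 2 + 2 * ((a + 2 * d + h) * a) * cos x =
  (a + d) ^+ 2 * (2 + 2 * cos x) +
  (h ^+ 2 + 4 * (d * h) + 2 * (a * h) * (1 + cos x) + 2 * d ^+ 2 * (1 - cos x)) by ring.
rewrite lerDl !addr_ge0 ?sqr_ge0 // !mulr_ge0 ?sqr_ge0 //; lra.
Qed.

(** The mean over x and y of |E' P(e^(i x)) + e^(i y) E P(e^(i x))|^p is bounded
below for fixed x by the kernel inequality and above for fixed y by the bound
for the twisted operator. *)
Lemma twisted_power_bound n e P (m p d : K) (delta : C) :
  (0 < n)%N -> zero_preserving n e -> zero_free n P -> 0 <= m ->
  (forall z, `|z| = 1 -> m <= normc P.[z]) -> `|delta| <= 1 -> 0 < p ->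
  d = m * (normc (e n) - normc (e 0%N)) / 2 ->
  (\int[circle]_x (normc (multop n e P + (delta * d%:C)%:P).[expi x] `^ p)%:E *
   \int[circle]_y (normc (1 + 1 * expi y) `^ p)%:E <=
   \int[circle]_y (normc (e 0%N + e n * expi y) `^ p)%:E *
   \int[circle]_x (normc P.[expi x] `^ p)%:E)%E.
Proof.
move=> n0 eI zP m0 Pm d1 p0 dE.
have [sP PD] := zP.
have d0 : 0 <= d.
  rewrite dE divr_ge0 // mulr_ge0 // subr_ge0 le_normc.
  exact: zero_preserving_coef_le.
pose eh k := Num.conj (e (n - k)%N).
pose EP := multop n e P; pose EhP := multop n eh P.
set F := multop n e P + _.
have EhPE x : normc EhP.[expi x] = normc (multop n e (recip n P)).[expi x].
  have -> : EhP = recip n (multop n e (recip n P)) by rewrite recip_multop recipK ?sP.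
  apply: complexI; rewrite -!norm_normc norm_horner_recip ?norm_expi //.
  exact: size_multop.
have FE x : normc F.[expi x] <= normc EP.[expi x] + d.
  rewrite /F hornerD hornerC (le_trans (le_normcD _ _)) // lerD2l.
  rewrite ComplexField.Normc.normcM normc_real (ger0_norm d0) ler_piMl //.
  by rewrite -lecR -norm_normc.
have EE x : normc EP.[expi x] + 2 * d <= normc EhP.[expi x].
  rewrite EhPE.
  have := pointwise_bound n0 eI zP m0 Pm (norm_expi x).
  by rewrite /EP dE; have -> : 2 * (m * (normc (e n) - normc (e 0%N)) / 2) =
     m * (normc (e n) - normc (e 0%N)) by field.
pose T (xy : K * K) : \bar K := (normc (EhP.[expi xy.1] + EP.[expi xy.1] * expi xy.2) `^ p)%:E.
have T0 xy : (0 <= T xy)%E by rewrite lee_fin powR_ge0.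
have mT : measurable_fun setT T.
  apply/measurable_EFinP.
  apply: (@measurableT_comp _ _ _ _ _ _ (@powR K ^~ p) _
     (fun xy : K * K => normc (EhP.[expi xy.1] + EP.[expi xy.1] * expi xy.2))) => //.
  have m1 f : cmeasurable (fun xy : K * K => f.[expi xy.1]).
    by apply: cmeasurable_horner; apply: cmeasurable_expi; exact: measurable_fst.
  apply: measurable_normc; apply: cmeasurableD => //; apply: cmeasurableM => //.
  by apply: cmeasurable_expi; exact: measurable_snd.
have m1 := measurable_normc_powR F p.
have J0 : (0 <= \int[circle]_y (normc (1 + 1 * expi y) `^ p)%:E)%E.
  by apply: integral_ge0 => y _; rewrite lee_fin powR_ge0.
apply: (@le_trans _ _ (\int[circle]_x \int[circle]_y T (x, y))%E).
  rewrite muleC.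
  have -> : (\int[circle]_y (normc (1 + 1 * expi y) `^ p)%:E *
      \int[circle]_x (normc F.[expi x] `^ p)%:E =
      \int[circle]_x (\int[circle]_y (normc (1 + 1 * expi y) `^ p)%:E *
        (normc F.[expi x] `^ p)%:E))%E.
    apply/esym; apply: (@ge0_integralZl _ _ _ circle setT measurableT) => //.
    by move=> x _; rewrite lee_fin powR_ge0.
  apply: (@ge0_le_integral _ _ _ circle setT measurableT).
  - by move=> x _; apply: mule_ge0 => //; rewrite lee_fin powR_ge0.
  - exact: measurable_funeM.
  - exact: (@measurable_fun_fubini_tonelli_F _ _ _ _ K circle T mT T0).
  move=> x _.
  rewrite (_ : (\int[circle]_y T (x, y) =
    \int[circle]_y (normc (EhP.[expi x] + EP.[expi x] * expi y) `^ p)%:E)%E) //.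
  rewrite !power_rotation // muleC.
  have mk (a b : K) : 0 <= a -> 0 <= b ->
      measurable_fun setT (fun y : K => (cosine_kernel a b 0 y `^ (p / 2))%:E).
    by move=> a0 b0; apply: continuous_emeasurable; exact: continuous_cosine_kernel_powR.
  have -> : ((normc F.[expi x] `^ p)%:E *
      \int[circle]_y (cosine_kernel (normc 1) (normc 1) 0 y `^ (p / 2))%:E =
      \int[circle]_y ((normc F.[expi x] `^ p)%:E *
      (cosine_kernel (normc 1) (normc 1) 0 y `^ (p / 2))%:E))%E.
    apply/esym; apply: (@ge0_integralZl _ _ _ circle setT measurableT).
    - by apply: mk; exact: normc_ge0.
    - by move=> y _; rewrite lee_fin powR_ge0.
    - by rewrite lee_fin powR_ge0.
  apply: (@ge0_le_integral _ _ _ circle setT measurableT).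
  - by move=> y _; rewrite mule_ge0 // lee_fin powR_ge0.
  - by apply: measurable_funeM; apply: mk; exact: normc_ge0.
  - by apply: mk; exact: normc_ge0.
  move=> y _; rewrite -EFinM lee_fin powR_sqr ?normc_ge0 // -powRM ?sqr_ge0 //; last first.
    by apply: cosine_kernel_ge0; exact: normc_ge0.
  rewrite ge0_ler_powR ?nnegrE ?mulr_ge0 ?sqr_ge0 ?cosine_kernel_ge0 ?normc_ge0 // ?divr_ge0 ?(ltW p0) //.
  rewrite ComplexField.Normc.normc1.
  by apply: (@cosine_kernel_lower_bound _ _ _ _ d) => //; exact: normc_ge0.
rewrite (@fubini_tonelli _ _ _ _ K circle circle T mT T0).
have mG := @measurable_fun_fubini_tonelli_G _ _ _ _ K circle T mT T0.
have P0 : (0 <= \int[circle]_x (normc P.[expi x] `^ p)%:E)%E.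
  by apply: integral_ge0 => y _; rewrite lee_fin powR_ge0.
have mgam : measurable_fun setT (fun y : K => (normc (eh n + e n * expi y) `^ p)%:E).
  apply/measurable_EFinP.
  apply: (@measurableT_comp _ _ _ _ _ _ (@powR K ^~ p) _
     (fun y : K => normc (eh n + e n * expi y))) => //.
  apply: measurable_normc; apply: cmeasurableD; first exact: cmeasurable_cst.
  apply: cmeasurableM; first exact: cmeasurable_cst.
  exact: cmeasurable_expi.
have -> : (\int[circle]_y (normc (e 0%N + e n * expi y) `^ p)%:E =
    \int[circle]_y (normc (eh n + e n * expi y) `^ p)%:E)%E.
  rewrite !power_rotation //.
  by have -> : normc (eh n) = normc (e 0%N) by apply: complexI; rewrite -!norm_normc norm_conjC subnn.
rewrite muleC.
have -> : (\int[circle]_x (normc P.[expi x] `^ p)%:E *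
    \int[circle]_y (normc (eh n + e n * expi y) `^ p)%:E =
    \int[circle]_y (\int[circle]_x (normc P.[expi x] `^ p)%:E *
     (normc (eh n + e n * expi y) `^ p)%:E))%E.
  apply/esym; apply: (@ge0_integralZl _ _ _ circle setT measurableT) => //.
  by move=> y _; rewrite lee_fin powR_ge0.
apply: (@ae_ge0_le_integral _ _ _ circle setT measurableT).
- by move=> y _; apply: integral_ge0 => x _; exact: T0.
- exact: mG.
- by move=> y _; apply: mule_ge0 => //; rewrite lee_fin powR_ge0.
- exact: measurable_funeM.
have en0 := zero_preserving_neq0 eI.
have [|il _] := @jensen_linear K (eh n) (e n).
  by rewrite lt_max [X in _ || X]normc_gt0 en0 orbT.
(* The top multiplier of the twisted operator vanishes only on a null set of
   angles, because its logarithm is integrable. *)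
have := integrable_ae measurableT il.
apply: filterS => y Hy _; have {}Hy := Hy Logic.I.
have gam0 : expi y * e n + Num.conj (e 0%N) != 0.
  apply: contraTneq Hy => g0.
  have -> : eh n + e n * expi y = 0 by rewrite /eh subnn addrC mulrC.
  by rewrite ComplexField.Normc.normc0 /= lexx.
pose gam k := expi y * e k + Num.conj (e (n - k)%N).
have gI : zero_preserving n gam by apply: twist_zero_preserving => //; exact: norm_expi.
have g0n : normc (gam 0%N) = normc (gam n).
  have ww : expi y * Num.conj (expi y) = 1 :> C by rewrite -normCK norm_expi expr1n.
  have -> : gam 0%N = expi y * Num.conj (gam n).
    by rewrite /gam subnn subn0 rmorphD rmorphM /= conjCK mulrDr mulrA ww mul1r addrC.
  rewrite ComplexField.Normc.normcM normc_expi mul1r.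
  by apply: complexI; rewrite -!norm_normc norm_conjC.
have := power_mean_multop n0 gI g0n sP p0.
rewrite muleC.
have -> : gam n = eh n + e n * expi y by rewrite /gam /eh addrC mulrC.
apply: le_trans; rewrite le_eqVlt; apply/orP; left; apply/eqP.
apply: eq_integral => x _; rewrite /T /=; congr ((normc _ `^ p)%:E).
have -> : multop n gam P = expi y *: EP + EhP.
  apply/polyP => k; rewrite coefD coefZ !coef_multop /gam /eh.
  by case: ifP => _; ring.
by rewrite hornerD hornerZ addrC mulrC.
Qed.

End Main.

(** * The norms as means over the circle *)

Section Norms.
Variable K : realType.
Local Notation mu := (@lebesgue_measure K).
Local Notation twopi := (2 * pi : K).
Local Notation circle := (circle K).
Local Notation C := (K[i]).
Implicit Types (P f g : {poly C}) (e : nat -> C) (p : K).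

Lemma pnorm_gt0E p f : 0 < p ->
  pnorm p f = (fine (\int[circle]_x (normc f.[expi x] `^ p)%:E)%E) `^ p^-1.
Proof.
move=> p0; rewrite /pnorm gt_eqF //; congr (_ `^ _).
rewrite integral_uniform ?subr0; last first.
- by move=> x; rewrite lee_fin powR_ge0.
- exact: measurable_normc_powR.
rewrite /Rintegral; case: (\int[_]_(x in _) _)%E => [r| |] //=.
- by rewrite mulry gtr0_sg ?invr_gt0 ?twopi_gt0 // mul1e mulr0.
- by rewrite mulrNy gtr0_sg ?invr_gt0 ?twopi_gt0 // mul1e mulr0.
Qed.

Lemma pnorm0E f :
  pnorm 0 f = fine (expeR (\int[circle]_x lne (normc f.[expi x])%:E))%E.
Proof.
rewrite /pnorm eqxx circle_integralE //.
  by apply: measurable_lne_comp; exact: measurable_normc_horner.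
have [M M0 HM] := normc_horner_bound f.
have mf : measurable_fun setT (fun x : K => lne (normc f.[expi x])%:E).
  by apply: measurable_lne_comp; exact: measurable_normc_horner.
apply: (@le_lt_trans _ _ (\int[mu]_(x in `[0%R, twopi]) (cst M%:E x))%E).
  apply: ge0_le_integral => //.
  - by apply: measurable_funTS; exact: measurable_funepos.
  - move=> x _; rewrite funeposE ge_max lee_fin M0 andbT.
    by rewrite (le_trans (ltW (lne_sublinear _))) // lee_fin.
rewrite integral_cst //= lebesgue_measure_itv /= lte_fin twopi_gt0.
by rewrite -EFinD -EFinM ltry.
Qed.

Lemma pnorm0_disc_rooted n f : disc_rooted n f -> pnorm 0 f = normc f`_n.
Proof.
move=> fI; rewrite pnorm0E (jensen_disc_rooted fI) /= lnK // posrE normc_gt0.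
exact: disc_rooted_coef_neq0 fI.
Qed.

(** The polynomial f may be 0, with norm exp(-oo). *)
Lemma pnorm0_le n f g : disc_rooted n g -> (forall x, normc f.[expi x] <= normc g.[expi x]) ->
  pnorm 0 f <= pnorm 0 g.
Proof.
move=> gI fg; rewrite (pnorm0_disc_rooted gI) pnorm0E.
have [->|f0] := eqVneq f 0.
  rewrite (_ : (\int[circle]_x _ = \int[circle]_x cst -oo x)%E); last first.
    by apply: eq_integral => x _; rewrite horner0 ComplexField.Normc.normc0 /= lexx.
  by rewrite integral_cst //= probability_setT mule1 /= normc_ge0.
have if_ := jensen_integrable f0; have ig := jensen_integrable (disc_rooted_neq0 gI).
have /fineK fE := integrable_fin_num measurableT if_.
rewrite -fE /= -ler_ln ?posrE ?expR_gt0 ?normc_gt0 ?(disc_rooted_coef_neq0 gI) // expRK.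
rewrite -lee_fin fE -(jensen_disc_rooted gI).
apply: (@le_integral _ _ _ circle setT measurableT _ _ if_ ig) => x _.
by rewrite lee_lne ?in_itv /= ?leey ?lee_fin ?normc_ge0.
Qed.

Lemma pnorm0_linear (a b : C) : 0 < Num.max (normc a) (normc b) ->
  pnorm 0 (b *: 'X + a%:P) = Num.max (normc a) (normc b).
Proof.
move=> ab0; rewrite pnorm0E.
rewrite (_ : (\int[circle]_x _ = \int[circle]_x lne (normc (a + b * expi x))%:E)%E).
  by rewrite (jensen_linear ab0).2 /= lnK.
by apply: eq_integral => x _; rewrite hornerD hornerZ hornerX hornerC addrC.
Qed.

Lemma power_integral_fin p f : 0 <= p ->
  (\int[circle]_x (normc f.[expi x] `^ p)%:E \is a fin_num)%E.
Proof.
move=> p0; have [M M0 HM] := normc_horner_bound f.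
apply: integrable_fin_num => //.
apply: (@bounded_circle_integrable _ _ (M `^ p)).
  by apply/measurable_EFinP; exact: measurable_normc_powR.
move=> x; rewrite ger0_norm ?powR_ge0 // ge0_ler_powR ?nnegrE ?normc_ge0 //.
Qed.

Lemma horner_linear_expi (a b : C) (x : K) : (b *: 'X + a%:P).[expi x] = a + b * expi x.
Proof. by rewrite hornerD hornerZ hornerX hornerC addrC. Qed.

(** x^p >= 1 + p ln x, and ln |1 + e^(i x)| has mean 0. *)
Lemma power_integral_one_ge1 p : 0 < p ->
  (1 <= \int[circle]_x (normc (1 + 1 * expi x : C) `^ p)%:E)%E.
Proof.
move=> p0; have [|il l0] := @jensen_linear K 1 1.
  by rewrite lt_max ComplexField.Normc.normc1 ltr01.
have ic : circle.-integrable setT (cst 1%E) by exact: finite_measure_integrable_cst.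
have ipl : circle.-integrable setT (fun x => p%:E * lne (normc (1 + 1 * expi x : C))%:E)%E.
  exact: integrableZl.
have e1 : (\int[circle]_x (cst 1 x + p%:E * lne (normc (1 + 1 * expi x : C))%:E) = 1)%E.
  etransitivity; first exact: (@integralD _ _ _ circle setT measurableT _ _ ic ipl).
  rewrite integral_cst //= probability_setT mule1.
  rewrite (@integralZl _ _ _ circle setT measurableT _ il) l0.
  by rewrite ComplexField.Normc.normc1 maxxx ln1 mule0 adde0.
rewrite -{1}e1.
apply: (@le_integral _ _ _ circle setT measurableT).
- exact: integrableD.
- have := @bounded_circle_integrable K (fun x => normc (1 + 1 * expi x : C) `^ p) (2 `^ p).
  apply.
    have := measurable_normc_powR (1 *: 'X + 1%:P : {poly C}) p.
    by move=> /measurable_EFinP; apply: eq_measurable_fun => x _; rewrite horner_linear_expi.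
  move=> x; rewrite ger0_norm ?powR_ge0 // ge0_ler_powR ?nnegrE ?normc_ge0 ?(ltW p0) //.
  rewrite (le_trans (le_normcD _ _)) // ComplexField.Normc.normcM normc_expi.
  by rewrite !ComplexField.Normc.normc1 mulr1.
move=> x _; have := normc_ge0 (1 + 1 * expi x : C).
rewrite le_eqVlt => /predU1P[<-|h0].
  by rewrite /= lexx gt0_muleNy ?lte_fin // addeNy leNye.
rewrite lne_EFin // -EFinM -EFinD lee_fin /powR gt_eqF //.
exact: expR_ge1Dx.
Qed.

Lemma power_integral_scale p (a b a' b' : C) (t : K) : 0 < p -> 0 <= t ->
  normc a' = t * normc a -> normc b' = t * normc b ->
  (\int[circle]_x (normc (a' + b' * expi x) `^ p)%:E =
   (t `^ p)%:E * \int[circle]_x (normc (a + b * expi x) `^ p)%:E)%E.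
Proof.
move=> p0 t0 aE bE; rewrite !power_rotation // aE bE.
transitivity (\int[circle]_x ((t `^ p)%:E * (cosine_kernel (normc a) (normc b) 0 x `^ (p / 2))%:E))%E.
  apply: eq_integral => x _; rewrite -EFinM [t `^ p]powR_sqr // -powRM ?sqr_ge0 //; last first.
    by apply: cosine_kernel_ge0; exact: normc_ge0.
  by congr ((_ `^ _)%:E); rewrite /cosine_kernel; ring.
apply: (@ge0_integralZl _ _ _ circle setT measurableT).
- by apply: continuous_emeasurable; apply: continuous_cosine_kernel_powR => //; exact: normc_ge0.
- by move=> x _; rewrite lee_fin powR_ge0.
- by rewrite lee_fin powR_ge0.
Qed.

End Norms.

(** * The inequality and its extremal polynomials *)

Section Final.
Variable K : realType.
Local Notation circle := (circle K).
Local Notation C := (K[i]).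
Implicit Types (P f g : {poly C}) (e : nat -> C) (p : K).

(** The quotient of norms on the right-hand side of the theorem, in terms of the
extreme multipliers. *)
Definition multop_norm n e p : K :=
  pnorm p (e n *: 'X + (e 0%N)%:P) / pnorm p (1 + 'X : {poly C}).

Lemma one_plus_X : (1 + 'X : {poly C}) = 1 *: 'X + 1%:P.
Proof. by rewrite scale1r polyC1 addrC. Qed.

Lemma powR_div (x y q : K) : 0 <= x -> 0 <= y -> (x / y) `^ q = x `^ q / y `^ q.
Proof.
move=> x0 y0; rewrite powRM ?invr_ge0 //; congr (_ * _).
by rewrite -powR_inv1 // powRAC powR_inv1 // powR_ge0.
Qed.

Lemma powR_quotient_le (L J A I q : K) : 0 <= L -> 0 < J -> 0 <= A -> 0 <= I ->
  0 <= q -> L * J <= A * I -> L `^ q <= (A / J) `^ q * I `^ q.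
Proof.
move=> L0 J0 A0 I0 q0 H.
have AJ0 : 0 <= A / J by rewrite divr_ge0 // ltW.
rewrite -powRM //; apply: ge0_ler_powR => //; first by rewrite nnegrE mulr_ge0.
by rewrite mulrAC ler_pdivlMr.
Qed.

Lemma powR_quotient_eq (J A t q : K) : 0 < J -> 0 <= A -> 0 <= t ->
  (t * A) `^ q = (A / J) `^ q * (t * J) `^ q.
Proof.
move=> J0 A0 t0; rewrite -powRM ?divr_ge0 ?mulr_ge0 ?(ltW J0) //.
by congr (_ `^ _); field; rewrite gt_eqF.
Qed.

Lemma pnorm_linear (a b : C) p : 0 < p -> pnorm p (b *: 'X + a%:P) =
  (fine (\int[circle]_x (normc (a + b * expi x) `^ p)%:E)%E) `^ p^-1.
Proof.
move=> p0.
have E : (\int[circle]_x (normc (b *: 'X + a%:P).[expi x] `^ p)%:E =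
    \int[circle]_x (normc (a + b * expi x) `^ p)%:E)%E.
  by apply: eq_integral => x _; rewrite horner_linear_expi.
by rewrite (pnorm_gt0E _ p0) E.
Qed.

Lemma pnorm_binomial n (a b : C) p : (0 < n)%N -> 0 < p ->
  pnorm p (a *: 'X^n + b%:P) =
  (fine (\int[circle]_x (normc (b + a * expi x) `^ p)%:E)%E) `^ p^-1.
Proof.
move=> n0 p0.
have E : (\int[circle]_x (normc (a *: 'X^n + b%:P).[expi x] `^ p)%:E =
    \int[circle]_x (normc (b + a * expi x ^+ n) `^ p)%:E)%E.
  by apply: eq_integral => x _; rewrite hornerD hornerZ hornerXn hornerC addrC.
by rewrite (pnorm_gt0E _ p0) E power_multiple.
Qed.

Lemma multop_norm_gt0E n e p : 0 < p ->
  multop_norm n e p =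
  (fine (\int[circle]_y (normc (e 0%N + e n * expi y) `^ p)%:E)%E /
   fine (\int[circle]_y (normc (1 + 1 * expi y : C) `^ p)%:E)%E) `^ p^-1.
Proof.
move=> p0; rewrite /multop_norm one_plus_X !pnorm_linear // powR_div //.
- by rewrite fine_ge0 // integral_ge0 // => x _; rewrite lee_fin powR_ge0.
- by rewrite fine_ge0 // integral_ge0 // => x _; rewrite lee_fin powR_ge0.
Qed.

Lemma multop_norm0E n e : zero_preserving n e -> multop_norm n e 0 = normc (e n).
Proof.
move=> eI; have en0 := zero_preserving_neq0 eI.
rewrite /multop_norm one_plus_X !pnorm0_linear; last 2 first.
- by rewrite lt_max ComplexField.Normc.normc1 ltr01.
- by rewrite lt_max [X in _ || X]normc_gt0 en0 orbT.
rewrite ComplexField.Normc.normc1 maxxx divr1 max_r // le_normc.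
exact: zero_preserving_coef_le.
Qed.

Lemma integral_one_gt0 p : 0 < p ->
  0 < fine (\int[circle]_y (normc (1 + 1 * expi y : C) `^ p)%:E)%E.
Proof.
move=> p0; have fin : (\int[circle]_y (normc (1 + 1 * expi y : C) `^ p)%:E \is a fin_num)%E.
  have := power_integral_fin (1 *: 'X + 1%:P : {poly C}) (ltW p0).
  by under eq_integral do rewrite horner_linear_expi.
rewrite -lte_fin fineK //; apply: (@lt_le_trans _ _ 1%E); first by rewrite lte_fin ltr01.
exact: power_integral_one_ge1.
Qed.

(** The case p > 0 is the averaged inequality.  For p = 0 the left-hand polynomial
is dominated on the circle by the image of the reciprocal polynomial of P, all
of whose zeros are in the disc. *)
Lemma multop_inequality n e P (m p d : K) (delta : C) :
  (0 < n)%N -> zero_preserving n e -> zero_free n P -> 0 <= m ->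
  (forall z, `|z| = 1 -> m <= normc P.[z]) -> `|delta| <= 1 -> 0 <= p ->
  d = m * (normc (e n) - normc (e 0%N)) / 2 ->
  pnorm p (multop n e P + (delta * d%:C)%:P) <= multop_norm n e p * pnorm p P.
Proof.
move=> n0 eI zP m0 Pm d1; rewrite le_eqVlt => /predU1P[<-|p0] dE; last first.
  rewrite multop_norm_gt0E // !pnorm_gt0E //.
  have ge0 f : 0 <= fine (\int[circle]_x (normc f.[expi x] `^ p)%:E)%E.
    by rewrite fine_ge0 // integral_ge0 // => x _; rewrite lee_fin powR_ge0.
  have J0 := integral_one_gt0 p0.
  have A0 : 0 <= fine (\int[circle]_y (normc (e 0%N + e n * expi y) `^ p)%:E)%E.
    by rewrite fine_ge0 // integral_ge0 // => x _; rewrite lee_fin powR_ge0.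
  apply: (powR_quotient_le (ge0 _) J0 A0 (ge0 _)); first by rewrite invr_ge0 ltW.
  have := twisted_power_bound n0 eI zP m0 Pm d1 p0 dE.
  have lin (a b : C) : (\int[circle]_y (normc (a + b * expi y) `^ p)%:E \is a fin_num)%E.
    have := power_integral_fin (b *: 'X + a%:P : {poly C}) (ltW p0).
    by under eq_integral do rewrite horner_linear_expi.
  have /fineK <- := power_integral_fin (multop n e P + (delta * d%:C)%:P) (ltW p0).
  have /fineK <- := power_integral_fin P (ltW p0).
  have /fineK <- := lin 1 1.
  have /fineK <- := lin (e 0%N) (e n).
  by rewrite -!EFinM lee_fin.
rewrite multop_norm0E //; have [sP PD] := zP.
have QI := recip_disc_rooted sP PD.
have -> : pnorm 0 P = normc (recip n P)`_n.
  rewrite -(pnorm0_disc_rooted QI) !pnorm0E; congr (fine (expeR _)); apply: eq_integral => x _.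
  congr (lne _%:E); apply: complexI; rewrite -!norm_normc norm_horner_recip ?norm_expi //.
  by rewrite sP.
have EI := eI _ QI.
rewrite -ComplexField.Normc.normcM.
have -> : e n * (recip n P)`_n = (multop n e (recip n P))`_n by rewrite coef_multop ltnSn.
rewrite -(pnorm0_disc_rooted EI); apply: (pnorm0_le EI) => x.
rewrite hornerD hornerC (le_trans (le_normcD _ _)) //.
apply: le_trans (pointwise_bound n0 eI zP m0 Pm (norm_expi x)).
rewrite lerD2l ComplexField.Normc.normcM.
have G0 : 0 <= m * (normc (e n) - normc (e 0%N)).
  by rewrite mulr_ge0 // subr_ge0 le_normc; exact: zero_preserving_coef_le.
have D1 : normc delta <= 1 by rewrite -lecR -norm_normc.
have d0 : 0 <= d by rewrite dE divr_ge0.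
rewrite normc_real (ger0_norm d0) (le_trans (ler_piMl d0 D1)) // dE.
by rewrite ler_pdivrMr // ler_peMr // ler1n.
Qed.

Lemma binomial_unit_zero n (a b : C) : (0 < n)%N -> a != 0 -> `|a| = `|b| ->
  exists2 z, `|z| = 1 & (a *: 'X^n + b%:P).[z] = 0.
Proof.
move=> n0 a0 ab; exists (n.-root (- b / a)).
  have : `|n.-root (- b / a)| ^+ n = 1.
    by rewrite -normrX rootCK // normf_div normrN -ab divff ?normr_eq0.
  by move/eqP; rewrite pexpr_eq1 // => /eqP.
by rewrite !hornerE rootCK // mulrC divfK // addNr.
Qed.

Lemma binomial_disc_rooted n (a b : C) : (0 < n)%N -> a != 0 -> `|a| = `|b| ->
  disc_rooted n (a *: 'X^n + b%:P).
Proof.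
move=> n0 a0 ab; split.
  rewrite size_polyDl size_scale // size_polyXn //.
  by rewrite ltnS (leq_trans (size_polyC_leq1 _)).
move=> z /rootP; rewrite hornerD hornerZ hornerXn hornerC => /eqP.
rewrite addr_eq0 => /eqP /(congr1 Num.norm).
rewrite normrM normrX normrN -ab -[RHS]mulr1 => /mulfI H.
have /eqP : `|z| ^+ n = 1 by apply: H; rewrite normr_eq0.
by rewrite pexpr_eq1 // => /eqP ->.
Qed.

Lemma multop_binomial n e (a b : C) : (0 < n)%N ->
  multop n e (a *: 'X^n + b%:P) = (e n * a) *: 'X^n + (e 0%N * b)%:P.
Proof.
move=> n0; apply/polyP => k; rewrite coef_multop !(coefD, coefZ, coefC) coefXn.
have [->|kn] := eqVneq k n.
  by rewrite ltnSn gtn_eqF // !mulr1 !addr0.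
by case: k kn => [|k] _ /=; [ring|case: ifP => _; ring].
Qed.

(** Only the extreme multipliers act on a X^n + b, and both sides depend only on
moduli. *)
Lemma multop_equality n e (a b : C) p : (0 < n)%N -> zero_preserving n e -> 0 <= p ->
  `|a| = `|b| -> b != 0 ->
  pnorm p (multop n e (a *: 'X^n + b%:P)) = multop_norm n e p * pnorm p (a *: 'X^n + b%:P).
Proof.
move=> n0 eI + ab b0; have a0 : a != 0 by rewrite -normr_eq0 ab normr_eq0.
rewrite le_eqVlt => /predU1P[<-|p0].
  have PI := binomial_disc_rooted n0 a0 ab.
  rewrite multop_norm0E // (pnorm0_disc_rooted PI) (pnorm0_disc_rooted (eI _ PI)).
  by rewrite coef_multop ltnSn ComplexField.Normc.normcM.
have nab : normc a = normc b by apply: complexI.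
rewrite multop_binomial // multop_norm_gt0E // !pnorm_binomial //.
rewrite (@power_integral_scale _ p 1 1 b a (normc b)) ?normc_ge0 //; last 2 first.
- by rewrite ComplexField.Normc.normc1 mulr1.
- by rewrite ComplexField.Normc.normc1 mulr1.
rewrite (@power_integral_scale _ p (e 0%N) (e n) (e 0%N * b) (e n * a) (normc b)) ?normc_ge0 //; last 2 first.
- by rewrite ComplexField.Normc.normcM mulrC.
- by rewrite ComplexField.Normc.normcM mulrC nab.
have J0 := integral_one_gt0 p0.
have lin (u v : C) : (\int[circle]_y (normc (u + v * expi y) `^ p)%:E \is a fin_num)%E.
  have := power_integral_fin (v *: 'X + u%:P : {poly C}) (ltW p0).
  by under eq_integral do rewrite horner_linear_expi.
have A0 : 0 <= fine (\int[circle]_y (normc (e 0%N + e n * expi y) `^ p)%:E)%E.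
  by rewrite fine_ge0 // integral_ge0 // => x _; rewrite lee_fin powR_ge0.
rewrite (fineM _ (lin (e 0%N) (e n))) // (fineM _ (lin 1 1)) //.
exact: (powR_quotient_eq _ J0 A0 (powR_ge0 _ _)).
Qed.

Lemma unit_binomial_zero_free n : (0 < n)%N -> zero_free n (1 *: 'X^n + 1%:P : {poly C}).
Proof.
move=> n0; split; first exact: (binomial_disc_rooted n0 (oner_neq0 _) erefl).1.
move=> w w1; rewrite scale1r hornerD hornerXn hornerC addr_eq0.
apply/eqP => E; have : `|w| ^+ n < 1 by rewrite exprn_ilt1 // -lt0n.
by rewrite -normrX E normrN normr1 ltxx.
Qed.

Lemma unit_binomial_min n : (0 < n)%N -> is_min_on_circle (1 *: 'X^n + 1%:P : {poly C}) 0.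
Proof.
move=> n0; have [z zn z0] := binomial_unit_zero n0 (oner_neq0 C) (erefl `|1|).
split; last by move=> w _; exact: normc_ge0.
by exists z => //; rewrite z0 ComplexField.Normc.normc0.
Qed.

Lemma pnorm_unit_binomial_gt0 n p : (0 < n)%N -> 0 <= p ->
  0 < pnorm p (1 *: 'X^n + 1%:P : {poly C}).
Proof.
move=> n0; rewrite le_eqVlt => /predU1P[<-|p0].
  have PI := binomial_disc_rooted n0 (oner_neq0 C) (erefl `|1|).
  by rewrite (pnorm0_disc_rooted PI) normc_gt0 (disc_rooted_coef_neq0 PI).
rewrite pnorm_binomial //; apply: powR_gt0.
exact: integral_one_gt0.
Qed.

End Final.

Theorem theorem1p2 (K : realType) (n : nat) (hn : (1 <= n)%N)
    (l0 l1 l2 : K[i]) (hB : classB n l0 l1 l2)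
    (alpha beta delta : K[i])
    (halpha : `|alpha| <= 1) (hbeta : `|beta| <= 1) (hdelta : `|delta| <= 1)
    (R r : K) (hr : 1 <= r) (hR : r < R) (p : K) (hp : 0 <= p) :
  [/\ (* the inequality *)
      forall (P : {poly K[i]}) (m : K),
        zero_free n P -> is_min_on_circle P m ->
        pnorm p (lhs_poly n l0 l1 l2 R r alpha beta delta P m)
          <= rhs_const n l0 l1 l2 R r alpha beta p * pnorm p P,
      (* equality for a z^n + b with |a| = |b| <> 0 *)
      forall (a b : K[i]) (m : K),
        `|a| = `|b| -> b != 0 ->
        is_min_on_circle (a *: 'X^n + b%:P) m ->
        pnorm p (lhs_poly n l0 l1 l2 R r alpha beta delta (a *: 'X^n + b%:P) m)
          = rhs_const n l0 l1 l2 R r alpha beta p * pnorm p (a *: 'X^n + b%:P)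
    & (* the constant is best possible *)
      forall c : K,
        (forall (P : {poly K[i]}) (m : K),
           zero_free n P -> is_min_on_circle P m ->
           pnorm p (lhs_poly n l0 l1 l2 R r alpha beta delta P m)
             <= c * pnorm p P) ->
        rhs_const n l0 l1 l2 R r alpha beta p <= c].
Proof.
set ph := phi n R r alpha beta.
pose e := opB_dilate_multiplier n l0 l1 l2 R r ph.
have eI : zero_preserving n e by exact: opB_dilate_multiplier_zero_preserving.
have en : e n = (R%:C ^+ n + ph * r%:C ^+ n) * Lambda n l0 l1 l2.
  by rewrite /e /opB_dilate_multiplier opB_multiplier_n // mulrC.
have e0 : e 0%N = (1 + ph) * l0.
  by rewrite /e /opB_dilate_multiplier opB_multiplier_0 !expr0 mulr1 mulrC.
have rhsE : rhs_const n l0 l1 l2 R r alpha beta p = multop_norm n e p.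
  by rewrite /rhs_const /multop_norm en e0.
have normen : `|R%:C ^+ n + ph * r%:C ^+ n| * `|Lambda n l0 l1 l2| = (normc (e n))%:C.
  by rewrite -normrM -en.
have norme0 : `|1 + ph| * `|l0| = (normc (e 0%N))%:C by rewrite -normrM -e0.
have realE (x y m : K) : (m * (x - y) / 2)%:C = (x%:C - y%:C) * m%:C / 2.
  by rewrite rmorphM fmorphV rmorph_nat rmorphM rmorphB /= [m%:C * _]mulrC.
have lhsE (P : {poly K[i]}) (m : K) : (size P <= n.+1)%N ->
    lhs_poly n l0 l1 l2 R r alpha beta delta P m =
    multop n e P + (delta * (m * (normc (e n) - normc (e 0%N)) / 2)%:C)%:P.
  move=> sP; rewrite /lhs_poly (opB_dilate_multop _ _ _ _ _ _ sP).
  by rewrite -/ph normen norme0 -realE.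
have eq_case (a b : K[i]) (m : K) : `|a| = `|b| -> b != 0 ->
    is_min_on_circle (a *: 'X^n + b%:P) m ->
    pnorm p (lhs_poly n l0 l1 l2 R r alpha beta delta (a *: 'X^n + b%:P) m)
    = rhs_const n l0 l1 l2 R r alpha beta p * pnorm p (a *: 'X^n + b%:P).
  move=> ab b0 [[z1 z11 mE] mle].
  have a0 : a != 0 by rewrite -normr_eq0 ab normr_eq0.
  have [z zn z0] := binomial_unit_zero hn a0 ab.
  have m0 : m = 0.
    apply/eqP; rewrite eq_le -{2}mE normc_ge0 andbT.
    by have := mle z zn; rewrite z0 ComplexField.Normc.normc0.
  rewrite lhsE; last by rewrite (binomial_disc_rooted hn a0 ab).1.
  by rewrite m0 !mul0r mulr0 addr0 rhsE multop_equality.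
split; [clear eq_case|exact: eq_case|].
  move=> P m zP [[z1 z11 mE] mle].
  have m0 : 0 <= m by rewrite -mE normc_ge0.
  have sP : (size P <= n.+1)%N by rewrite (proj1 zP).
  rewrite rhsE (lhsE P m sP).
  exact: (multop_inequality hn eI zP m0 mle hdelta hp erefl).
move=> c Hc.
have zP := unit_binomial_zero_free K hn.
have minP := unit_binomial_min K hn.
have N0 : 0 < pnorm p (1 *: 'X^n + 1%:P : {poly K[i]}) := pnorm_unit_binomial_gt0 hn hp.
rewrite -(ler_pM2r N0) -(eq_case 1 1 0 erefl (oner_neq0 _) minP).
exact: (Hc _ 0 zP minP).
Qed.
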